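(* Let $M$ be a von Neumann algebra with a normal, tracial state $\varphi$, and let $a_1,\ldots,a_n$ be self-adjoint elements of $M$. Then the modified free entropy dimension $\delta_0(a_1,\ldots,a_n)$ satisfies \[ \delta_0(a_1,\ldots,a_n) = \limsup_{\epsilon\to 0}\frac{\mathbb P_\epsilon(a_1,\ldots,a_n)}{|\log\epsilon|}=\limsup_{\epsilon\to 0}\frac{\mathbb K_\epsilon(a_1,\ldots,a_n)}{|\log\epsilon|}. \]
   Context: Limits $\epsilon\to 0$ are over $\epsilon>0$, and $\log 0=-\infty$ (so all quantities below take values in $[-\infty,\infty]$). Matrix notation. $M_k^{sa}(\mathbb C)$ is the set of $k\times k$ self-adjoint complex matrices, $(M_k^{sa}(\mathbb C))^n$ the real vector space of $n$-tuples of such matrices, and $tr_k$ the normalized trace on $k\times k$ complex matrices. On $(M_k^{sa}(\mathbb C))^n$ let $\|(x_1,\ldots,x_n)\|_2^2=\sum_{i=1}^n k\cdot tr_k(x_i^2)$, let $\mathrm{vol}$ be Lebesgue measure with respect to the inner product norm $\|\cdot\|_2$, and let $\rho_k$ be the metric induced by the norm $k^{-1/2}\|\cdot\|_2$. Microstates. For self-adjoint $c_1,\ldots,c_q\in M$, $m,k\in\mathbb N$, $R,\gamma>0$, $\Gamma_R(c_1,\ldots,c_q;m,k,\gamma)$ is the set of $(x_1,\ldots,x_q)\in(M_k^{sa}(\mathbb C))^q$ with operator norms $\|x_i\|\le R$ for all $i$ and \[|tr_k(x_{i_1}\cdots x_{i_p})-\varphi(c_{i_1}\cdots c_{i_p})|<\gamma\]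 for all $1\le p\le m$ and $1\le i_1,\ldots,i_p\le q$. For self-adjoint $c_1,\ldots,c_n,b_1,\ldots,b_p\in M$, $\Gamma_R(c_1,\ldots,c_n:b_1,\ldots,b_p;m,k,\gamma)$ is the image of $\Gamma_R(c_1,\ldots,c_n,b_1,\ldots,b_p;m,k,\gamma)$ under the projection onto the first $n$ coordinates. Free entropy (Voiculescu). Define \[\chi_R(c_1,\ldots,c_n:b_1,\ldots,b_p;m,\gamma)=\limsup_{k\to\infty}\left(k^{-2}\log \mathrm{vol}(\Gamma_R(c_1,\ldots,c_n:b_1,\ldots,b_p;m,k,\gamma))+\tfrac n2\log k\right),\] \[\chi_R(c_1,\ldots,c_n:b_1,\ldots,b_p)=\inf_{m\in\mathbb N,\gamma>0}\chi_R(c_1,\ldots,c_n:b_1,\ldots,b_p;m,\gamma),\] \[\chi(c_1,\ldots,c_n:b_1,\ldots,b_p)=\sup_{R>0}\chi_R(c_1,\ldots,c_n:b_1,\ldots,b_p).\] Modified free entropy dimension. \[\delta_0(a_1,\ldots,a_n)=n+\limsup_{\epsilon\to0}\frac{\chi(a_1+\epsilon s_1,\ldots,a_n+\epsilon s_n:s_1,\ldots,s_n)}{|\log\epsilon|},\] where $\{s_1,\ldots,s_n\}$ is a semicircular family (freely independent self-adjoint elements, each having the semicircular distribution with density $\frac1{2\pi}\sqrt{4-t^2}$ on $[-2,2]$) that is freely independent with respect to $\{a_1,\ldots,a_n\}$. If necessary, $(M,\varphi)$ is enlarged (e.g. by a free product) to contain such a family; the value depends only on the joint distribution. Packing and covering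 numbers. For a metric space $(X,d)$ and $\epsilon>0$, $P_\epsilon(X,d)$ is the maximum number of elements in a collection of mutually disjoint open $\epsilon$-balls of $X$, and $K_\epsilon(X,d)$ is the minimum number of open $\epsilon$-balls of $X$ required to cover $X$ (both are $0$ if $X=\emptyset$). Define successively \[\mathbb P_{\epsilon,R}(a_1,\ldots,a_n;m,k,\gamma)=P_\epsilon(\Gamma_R(a_1,\ldots,a_n;m,k,\gamma),\rho_k),\] \[\mathbb P_{\epsilon,R}(a_1,\ldots,a_n;m,\gamma)=\limsup_{k\to\infty}k^{-2}\log \mathbb P_{\epsilon,R}(a_1,\ldots,a_n;m,k,\gamma),\] \[\mathbb P_{\epsilon,R}(a_1,\ldots,a_n)=\inf\{\mathbb P_{\epsilon,R}(a_1,\ldots,a_n;m,\gamma):m\in\mathbb N,\gamma>0\},\] \[\mathbb P_\epsilon(a_1,\ldots,a_n)=\sup_{R>0}\mathbb P_{\epsilon,R}(a_1,\ldots,a_n).\] $\mathbb K_\epsilon(a_1,\ldots,a_n)$ is defined in the same way, replacing $P_\epsilon$ by $K_\epsilon$ in the first line. *)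

(* Defs.v *)
From HB Require Import structures.
From mathcomp Require Import all_boot all_order all_algebra complex.
From mathcomp Require Import all_classical all_reals all_analysis.
Import Order.TTheory GRing.Theory Num.Theory.
Import numFieldNormedType.Exports.

Set Implicit Arguments.
Unset Strict Implicit.
Unset Printing Implicit Defensive.

Local Open Scope classical_set_scope.
Local Open Scope ring_scope.
Local Open Scope complex_scope.

(** * Hilbert spaces and von Neumann algebras *)

(* The norm of a normed module over R[i] takes its values in R[i]; [inner] is
   linear in its first argument. *)
Record hilbert (R : realType) := Hilbert {
  hspace :> completeNormedModType R[i] ;
  inner : hspace -> hspace -> R[i] ;
  inner_linear : forall (c : R[i]) (u v w : hspace),
    inner (c *: u + v) w = c * inner u w + inner v w ;
  inner_conj : forall u v : hspace, inner v u = (inner u v)^* ;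
  inner_norm : forall u : hspace, inner u u = `|u| ^+ 2 }.

Section Operators.
Variables (R : realType) (H : hilbert R).
Implicit Types (x y z : H -> H) (S D M : set (H -> H)).

Definition bounded_operator x : Prop := linear x /\ continuous x.

Definition is_adjoint x y : Prop :=
  forall u v : H, inner (x u) v = inner u (y v).

Definition commutant S : set (H -> H) :=
  [set y | bounded_operator y /\ forall x, S x -> x \o y = y \o x].

Definition von_neumann_algebra M : Prop :=
  (forall x y, M x -> is_adjoint x y -> M y) /\ commutant (commutant M) = M.

Definition selfadjoint_in M x : Prop := M x /\ is_adjoint x x.

Definition op_le x y : Prop := forall u : H, inner (x u) u <= inner (y u) u.

Definition directed D : Prop :=
  D !=set0 /\
  forall x y, D x -> D y -> exists z, [/\ D z, op_le x z & op_le y z].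

(* [x] is the least upper bound of [D] in the self-adjoint part of [M]. *)
Definition op_sup M D x : Prop :=
  [/\ selfadjoint_in M x,
      forall y, D y -> op_le y x &
      forall z, selfadjoint_in M z -> (forall y, D y -> op_le y z) ->
        op_le x z].

(* [phi] matters only on [M].  Normality is the preservation of least upper
   bounds of bounded increasing nets of self-adjoint elements. *)
Record normal_tracial_state M (phi : (H -> H) -> R[i]) : Prop := {
  state_linear : forall (c : R[i]) x y, M x -> M y ->
    phi (c *: x + y) = c * phi x + phi y ;
  state_positive : forall x, M x -> op_le (fun=> 0) x -> 0 <= phi x ;
  state_unit : phi id = 1 ;
  state_tracial : forall x y, M x -> M y -> phi (x \o y) = phi (y \o x) ;
  state_normal : forall D x, D `<=` selfadjoint_in M -> directed D ->
    op_sup M D x -> supremums (phi @` D) (phi x) }.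

Definition star_subalgebra S : Prop :=
  [/\ S id,
      forall (c : R[i]) x y, S x -> S y -> S (c *: x + y),
      forall x y, S x -> S y -> S (x \o y) &
      forall x y, S x -> is_adjoint x y -> S y].

Definition star_alg_gen S : set (H -> H) := smallest star_subalgebra S.

Definition op_prod (s : seq (H -> H)) : H -> H :=
  foldr (fun x y => x \o y) id s.

(* Free independence of the sets [S j]: alternating products of centered
   elements of the generated unital *-algebras are centered. *)
Definition free (phi : (H -> H) -> R[i]) (J : Type) (S : J -> set (H -> H))
    : Prop :=
  forall (p : nat) (j : nat -> J) (x : nat -> H -> H),
    (0 < p)%N ->
    (forall k, (k < p)%N -> star_alg_gen (S (j k)) (x k) /\ phi (x k) = 0) ->
    (forall k, (k.+1 < p)%N -> j k <> j k.+1) ->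
    phi (op_prod (mkseq x p)) = 0.

(* All the moments of [s] are those of the given density; the semicircle law is
   compactly supported, hence determined by them. *)
Definition semicircular (phi : (H -> H) -> R[i]) (s : H -> H) : Prop :=
  forall p : nat,
    phi (iter p s) =
    (\int[lebesgue_measure]_(t in `[(- 2 : R), 2])
        (t ^+ p * ((2 * pi)^-1 * Num.sqrt (4 - t ^+ 2))))%R%:C.

End Operators.

Record tracial_vna (R : realType) := TracialVNA {
  vna_hilbert :> hilbert R ;
  vna_set : set (vna_hilbert -> vna_hilbert) ;
  vna_state : (vna_hilbert -> vna_hilbert) -> R[i] ;
  vna_setP : von_neumann_algebra vna_set ;
  vna_stateP : normal_tracial_state vna_set vna_state }.

(* [iota] presents [(B, psi)] as an enlargement of [(A, phi)]: an injective,
   unital, normal, state-preserving *-homomorphism. *)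
Record enlargement (R : realType) (A B : tracial_vna R)
    (iota : (A -> A) -> (B -> B)) : Prop := {
  enl_in : forall x, vna_set x -> vna_set (iota x) ;
  enl_linear : forall (c : R[i]) x y, vna_set x -> vna_set y ->
    iota (c *: x + y) = c *: iota x + iota y ;
  enl_unit : iota id = id ;
  enl_mul : forall x y, vna_set x -> vna_set y ->
    iota (x \o y) = iota x \o iota y ;
  enl_adjoint : forall x y, vna_set x -> vna_set y -> is_adjoint x y ->
    is_adjoint (iota x) (iota y) ;
  enl_inj : forall x y, vna_set x -> vna_set y -> iota x = iota y -> x = y ;
  enl_state : forall x, vna_set x -> vna_state (iota x) = vna_state x ;
  enl_normal : forall D x, D `<=` selfadjoint_in (@vna_set R A) ->
    directed D -> op_sup (@vna_set R A) D x ->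
    op_sup (@vna_set R B) (iota @` D) (iota x) }.

(* [s] is a semicircular family in the algebra [B], free with respect to [a]. *)
Definition free_semicircular_family (R : realType) (B : tracial_vna R) (n : nat)
    (a s : 'I_n -> B -> B) : Prop :=
  [/\ forall i, selfadjoint_in (@vna_set R B) (s i),
      forall i, semicircular (@vna_state R B) (s i),
      free (@vna_state R B) (fun i : 'I_n => [set s i]) &
      free (@vna_state R B) (fun b : bool => if b then range s else range a)].

(** * Packing and covering numbers of a set [X] for a metric [d] *)

Section Packing.
Variables (R : realType) (T : Type) (d : T -> T -> R) (X : set T) (e : R).
Local Open Scope ereal_scope.

Definition rel_ball (x : T) : set T := [set y | X y /\ (d x y < e)%R].

Definition packing_number : \bar R :=
  ereal_sup [set N%:R%:E | N in [set N : nat | exists x : 'I_N -> T,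
    (forall i, X (x i)) /\ trivIset setT (fun i => rel_ball (x i))]].

Definition covering_number : \bar R :=
  ereal_inf [set N%:R%:E | N in [set N : nat | exists x : 'I_N -> T,
    (forall i, X (x i)) /\ X `<=` \bigcup_i rel_ball (x i)]].

End Packing.

(** * Matrices *)

Section Matrices.
Variable R : realType.

Definition ntrace (k : nat) (x : 'M[R[i]]_k) : R[i] := k%:R^-1 * \tr x.

Definition selfadjoint_mx (k : nat) (x : 'M[R[i]]_k) : Prop :=
  forall i j, x j i = (x i j)^*.

Definition vec_norm (k : nat) (v : 'cV[R[i]]_k) : R :=
  Num.sqrt (\sum_i (complex.Re (v i 0) ^+ 2 + complex.Im (v i 0) ^+ 2)).

Definition op_norm (k : nat) (x : 'M[R[i]]_k) : R :=
  sup [set vec_norm (x *m v) | v in [set v | vec_norm v <= 1]].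

Definition hs_norm (I : finType) (k : nat) (x : I -> 'M[R[i]]_k) : R :=
  Num.sqrt (\sum_i k%:R * complex.Re (ntrace (x i *m x i))).

Definition rho (I : finType) (k : nat) (x y : I -> 'M[R[i]]_k) : R :=
  (Num.sqrt k%:R)^-1 * hs_norm (fun i => x i - y i).

(* Coordinates in an orthonormal basis of the self-adjoint tuples, for the
   inner product with norm [hs_norm]; see [hs_coordP]. *)
Definition hs_coord (I : finType) (k : nat) (x : I -> 'M[R[i]]_k)
    (l : I * 'I_k * 'I_k) : R :=
  let: (m, i, j) := l in
  if i == j then complex.Re (x m i i)
  else if (i < j)%N then Num.sqrt 2 * complex.Re (x m i j)
  else Num.sqrt 2 * complex.Im (x m i j).

(* Product of [d] copies of the Lebesgue measure of the line, as an iterated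
   integral: the Lebesgue measure of R^d on Borel sets. *)
Fixpoint lebesgue_tuple (d : nat) : set (d.-tuple R) -> \bar R :=
  match d with
  | 0 => fun S => \d_([tuple] : 0.-tuple R) S
  | d'.+1 => fun S =>
      (\int[lebesgue_measure]_(t in [set: R])
         lebesgue_tuple [set v : d'.-tuple R | S [tuple of t :: v]])%E
  end.

Definition vol (I : finType) (k : nat) (S : set (I -> 'M[R[i]]_k)) : \bar R :=
  lebesgue_tuple
    [set [tuple hs_coord x (enum_val l) | l < #|{: I * 'I_k * 'I_k}|]
      | x in S].

End Matrices.

Lemma hs_coordP (R : realType) (I : finType) (k : nat) (x : I -> 'M[R[i]]_k) :
  (forall i, selfadjoint_mx (x i)) ->
  \sum_l hs_coord x l ^+ 2 = hs_norm x ^+ 2.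
Proof.
move=> xsa; pose g m i j := complex.Re (x m i j) ^+ 2 + complex.Im (x m i j) ^+ 2.
have ReS : forall (J : finType) (F : J -> R[i]),
    complex.Re (\sum_j F j) = \sum_j complex.Re (F j).
  by move=> J F; apply: (big_morph (@complex.Re R)) => // -[? ?] [].
have normE m : k%:R * complex.Re (ntrace (x m *m x m)) = \sum_i \sum_j g m i j.
  have -> : \sum_i \sum_j g m i j = complex.Re (\tr (x m *m x m)).
    rewrite /mxtrace ReS; apply: eq_bigr => i _; rewrite mxE ReS.
    apply: eq_bigr => j _; rewrite /g (xsa m i j).
    by case: (x m i j) => u v /=; rewrite mulrN opprK !expr2.
  have [k0|k0] := eqVneq k 0%N.
    rewrite {1}k0 mul0r /mxtrace ReS big1// => i _.
    by exfalso; have := ltn_ord i; rewrite [X in (_ < X)%N]k0 ltn0.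
  rewrite /ntrace; have -> : (k%:R^-1 : R[i]) = ((k%:R^-1)%:C)%C.
    by rewrite fmorphV rmorph_nat.
  case: (\tr _) => u v /=; rewrite mul0r subr0 mulrA divff ?mul1r//.
  by rewrite pnatr_eq0.
have g0 m i j : 0 <= g m i j by rewrite addr_ge0// sqr_ge0.
rewrite /hs_norm sqr_sqrtr; last first.
  by apply: sumr_ge0 => m _; rewrite normE; apply: sumr_ge0 => i _; exact: sumr_ge0.
under [RHS]eq_bigr do rewrite normE.
pose f m i j := hs_coord x (m, i, j) ^+ 2.
have -> : \sum_l hs_coord x l ^+ 2 = \sum_m \sum_i \sum_j f m i j.
  rewrite pair_bigA /= (pair_bigA _ (fun p j => f p.1 p.2 j)) /=.
  by apply: eq_bigr => -[[m i] j].
apply: eq_bigr => m _.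
have two : (2 : R) != 0 by rewrite pnatr_eq0.
apply: (mulfI two); rewrite !mulr_natl !mulr2n.
rewrite {2}exchange_big /= -!big_split /=; apply: eq_bigr => i _.
rewrite -!big_split /=; apply: eq_bigr => j _.
have s2 : Num.sqrt 2 ^+ 2 = 2 :> R by rewrite sqr_sqrtr ?ler0n.
have gg : g m j i = g m i j.
  by rewrite /g (xsa m i j); case: (x m i j) => u v /=; rewrite sqrrN.
rewrite /f /hs_coord -!val_eqE /=; case: (ltngtP i j) => [ij|ij|/val_inj ij].
- rewrite !exprMn s2.
  rewrite (xsa m i j) /g; case: (x m i j) => u v /=; rewrite sqrrN.
  by rewrite -mulrDr mulr_natl mulr2n.
- rewrite !exprMn s2.
  rewrite (xsa m i j) /g; case: (x m i j) => u v /=.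
  by rewrite -mulrDr mulr_natl mulr2n addrC.
- rewrite ij /g; have := xsa m j j; case: (x m j j) => u v /= [] vN.
  have -> : v = 0.
    by apply/eqP; have := mulrn_eq0 v 2%N; rewrite mulr2n {1}vN addNr eqxx.
  by rewrite expr0n /= addr0.
Qed.

(** * Microstates, free entropy, free entropy dimension *)

Section FreeEntropy.
Variables (R : realType) (H : hilbert R) (phi : (H -> H) -> R[i]).
Local Open Scope ereal_scope.

Definition microstates (I : finType) (c : I -> H -> H) (r : R) (m k : nat)
    (gamma : R) : set (I -> 'M[R[i]]_k) :=
  [set x | [/\ forall i, selfadjoint_mx (x i),
               forall i, (op_norm (x i) <= r)%R &
               forall w : seq I, (0 < size w <= m)%N ->
                 `|ntrace (\big[mulmx/1%:M]_(i <- w) x i)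
                   - phi (op_prod (map c w))|%R < gamma%:C]%R].

Definition join_tuple (T I J : Type) (c : I -> T) (b : J -> T) (l : I + J) : T :=
  match l with inl i => c i | inr j => b j end.

Definition rel_microstates (I J : finType) (c : I -> H -> H) (b : J -> H -> H)
    (r : R) (m k : nat) (gamma : R) : set (I -> 'M[R[i]]_k) :=
  [set (fun i => x (inl i)) |
    x in @microstates (I + J)%type (join_tuple c b) r m k gamma].

Section Chi.
Variables (n p : nat) (c : 'I_n -> H -> H) (b : 'I_p -> H -> H).

Definition chi_Rmg (r : R) (m : nat) (gamma : R) : \bar R :=
  limn_esup (fun k : nat =>
    (k%:R ^- 2)%:E * lne (vol (@rel_microstates _ _ c b r m k gamma))
    + (n%:R / 2 * ln k%:R)%:E).

Definition chi_R (r : R) : \bar R :=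
  ereal_inf [set chi_Rmg r mg.1 mg.2
             | mg in [set mg : nat * R | (0 < mg.2)%R]].

Definition chi : \bar R := ereal_sup [set chi_R r | r in [set r | (0 < r)%R]].

End Chi.

(* The modified free entropy dimension of [a], computed with the semicircular
   family [s]. *)
Definition delta0 (n : nat) (a s : 'I_n -> H -> H) : \bar R :=
  n%:R%:E +
  limf_esup (fun e : R =>
      chi (fun i => (a i + e%:C *: s i)%R) s / `|ln e|%R%:E)
    (0%R : R)^'+.

(* [num] is [packing_number] or [covering_number]. *)
Section Rate.
Variable num : forall T : Type, (T -> T -> R) -> set T -> R -> \bar R.
Variables (n : nat) (a : 'I_n -> H -> H) (e : R).

Definition rate_Rmg (r : R) (m : nat) (gamma : R) : \bar R :=
  limn_esup (fun k : nat =>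
    (k%:R ^- 2)%:E *
    lne (num (@rho R _ k) (@microstates _ a r m k gamma) e)).

Definition rate_R (r : R) : \bar R :=
  ereal_inf [set rate_Rmg r mg.1 mg.2
             | mg in [set mg : nat * R | (0 < mg.2)%R]].

Definition rate : \bar R :=
  ereal_sup [set rate_R r | r in [set r | (0 < r)%R]].

End Rate.

Definition packing_rate := rate (@packing_number R).
Definition covering_rate := rate (@covering_number R).

End FreeEntropy.

(* Main.v *)
(* Both bounds compare, at scale [e], the volume of the microstates of
   [a + e s] in the presence of [s] with the number of balls of radius of order
   [e] in the microstates of [a].

   If [(x', g)] is a microstate of [(a + e s, s)], then [x' - e g] is a
   microstate of [a] at distance [O(e)] from [x'].  Hence balls of radius [O(e)]
   around the centers of an [e]-cover of the microstates of [a] contain the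
   microstates of [a + e s], and a Chernoff bound controls their volume in
   dimension [n k ^ 2].  Conversely, let the [x_j] be microstates of [a] at
   mutual distances at least [C e].  The sets of all [x_j + e g], with
   [(x_j, g)] a microstate of [(a, s)], are disjoint, and each has at least half
   the Gaussian volume because a Gaussian random matrix [g] is such a partner
   with probability at least 1/2.  This is asymptotic freeness: the joint moments
   of [a] and [s] satisfy the Schwinger-Dyson equations, which the expected traces
   of words in [x_j] and [g] satisfy up to [k ^ -2]; a second moment argument
   gives the traces, and exponential moments along a net of the unit ball give
   the operator norm.  Dividing by [|ln e|] removes the constants.

   Volumes being iterated integrals of possibly non-measurable indicators, these
   indicators are compared with finite sums of products of functions of one
   variable, for which the iterated integral is explicit. *)

Require Import Defs.
From HB Require Import structures.
From mathcomp Require Import all_boot all_order all_algebra.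
Import GRing.Theory.
Set Implicit Arguments.
Unset Strict Implicit.
Unset Printing Implicit Defensive.
Local Open Scope ring_scope.

(** * Gaussian expectation on polynomials *)

(** Gaussian expectations are needed without a product measure. For polynomials the mean is a
    functional on a polynomial ring obeying integration by parts, which is all that the
    Schwinger-Dyson equations ask for. The event that [g] is a good partner never receives a
    probability: it is bounded below by one test function, namely 1, minus the squared trace errors
    divided by [gamma ^ 2], minus the exponentials along the net. This function is at most 1 and
    positive only on the event, and each of the two subtracted terms has mean at most 1/4. On the
    operator side, integrating the derivative of [t ^ p (4 - t ^ 2) ^ (3/2)] gives the Catalan
    recurrence, hence the equation for one semicircular letter. Freeness extends it to all words,
    because both sides vanish on alternating products of centered blocks. Each coordinate gets the
    standard deviation [e / sqrt k]: the normalization in dimension [n k ^ 2] then cancels the term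
    [n / 2 * ln k] of [chi] and leaves [n ln e], which becomes the summand [n] of [delta0]. *)

Fixpoint gauss_moment (p : nat) : nat :=
  match p with
  | 0 => 1
  | 1 => 0
  | (q.+1 as p').+1 => p' * gauss_moment q
  end.

Lemma gauss_momentSS p : gauss_moment p.+2 = (p.+1 * gauss_moment p)%N.
Proof. by []. Qed.

(** Interface of the polynomials in [d] variables with the mean of independent standard normal
    variables. [ga_mean_ibp] drives the algebra; [ga_expand] later identifies [ga_mean] with
    integrals of monomials. *)
Record gauss_algebra (C : comNzRingType) (d : nat) := GaussAlgebra {
  ga_ring : comNzRingType ;
  ga_const : {rmorphism C -> ga_ring} ;
  ga_var : 'I_d -> ga_ring ;
  ga_deriv : 'I_d -> ga_ring -> ga_ring ;
  ga_mean : ga_ring -> C ;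
  ga_eval : ('I_d -> C) -> {rmorphism ga_ring -> C} ;
  ga_derivD : forall l p q, ga_deriv l (p + q) = ga_deriv l p + ga_deriv l q ;
  ga_derivM : forall l p q,
    ga_deriv l (p * q) = ga_deriv l p * q + p * ga_deriv l q ;
  ga_deriv_var : forall l j, ga_deriv l (ga_var j) = (l == j)%:R ;
  ga_deriv_const : forall l c, ga_deriv l (ga_const c) = 0 ;
  ga_meanD : forall p q, ga_mean (p + q) = ga_mean p + ga_mean q ;
  ga_meanZ : forall c p, ga_mean (ga_const c * p) = c * ga_mean p ;
  ga_mean1 : ga_mean 1 = 1 ;
  ga_mean_ibp : forall l p, ga_mean (ga_var l * p) = ga_mean (ga_deriv l p) ;
  ga_eval_const : forall v c, ga_eval v (ga_const c) = c ;
  ga_eval_var : forall v l, ga_eval v (ga_var l) = v l ;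
  ga_expand : forall p, exists s : seq (C * ('I_d -> nat)),
    (forall v, ga_eval v p = \sum_(t <- s) t.1 * \prod_l v l ^+ t.2 l) /\
    ga_mean p = \sum_(t <- s) t.1 * \prod_l (gauss_moment (t.2 l))%:R }.

Module GaussPoly.
From mathcomp Require Import ssrcomplements mpoly.

Section Mean.
Variables (C : comNzRingType) (d : nat).
Implicit Types (p q : {mpoly C[d]}) (m : 'X_{1..d}).

Definition mean_mon m : C := \prod_l (gauss_moment (m l))%:R.
Definition mean p : C := \sum_(m <- msupp p) p@_m * mean_mon m.

Lemma meanwE b p : (msize p <= b)%N ->
  mean p = \sum_(m : 'X_{1..d < b}) p@_m * mean_mon m.
Proof.
move=> pb; rewrite /mean (big_mksub 'X_{1..d < b}) ?msupp_uniq//=; last first.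
  by move=> m /msize_mdeg_lt /leq_trans; apply.
by rewrite big_rmcond//= => i /memN_msupp_eq0 ->; rewrite mul0r.
Qed.

Lemma meanD p q : mean (p + q) = mean p + mean q.
Proof.
pose b := maxn (maxn (msize p) (msize q)) (msize (p + q)).
rewrite !(@meanwE b) ?leq_max ?leqnn ?orbT//.
rewrite -big_split/=; apply: eq_bigr => m _; by rewrite mcoeffD mulrDl.
Qed.

Lemma meanZ c p : mean (c%:MP * p) = c * mean p.
Proof.
pose b := maxn (msize p) (msize (c%:MP * p)).
rewrite !(@meanwE b) ?leq_max ?leqnn ?orbT//.
by rewrite mulr_sumr; apply: eq_bigr => m _; rewrite mcoeffCM mulrA.
Qed.

Lemma mean0 : mean 0 = 0.
Proof. by rewrite /mean msupp0 big_nil. Qed.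

Lemma mean_sum (T : Type) (s : seq T) (F : T -> {mpoly C[d]}) :
  mean (\sum_(t <- s) F t) = \sum_(t <- s) mean (F t).
Proof. by apply: (big_morph mean meanD mean0). Qed.

Lemma meanX m : mean 'X_[m] = mean_mon m.
Proof. by rewrite /mean msuppX big_seq1 mcoeffX eqxx mul1r. Qed.

Lemma mean1 : mean 1 = 1.
Proof. by rewrite -mpolyX0 meanX /mean_mon big1// => i _; rewrite mnm0E. Qed.

Lemma mean_ibp l p : mean ('X_l * p) = mean (p^`M(l)).
Proof.
rewrite [in LHS](mpolyE p) [in RHS](mpolyE p) mulr_sumr linear_sum/= !mean_sum.
apply: eq_bigr => m _; rewrite -scalerAr linearZ/= -!mul_mpolyC !meanZ.
congr (_ * _); rewrite mderivX -mpolyXD meanX -mul_mpolyC meanZ meanX /mean_mon.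
(* Only the exponent of the variable [l] changes, and there the claim is the recursion of
   [gauss_moment]. *)
rewrite (bigD1 l)//= [in RHS](bigD1 l)//= mulrA.
congr (_ * _).
  rewrite mnmDE mnm1E eqxx add1n mnmBE mnm1E eqxx.
  case: (m l) => [|[|e]]; first by rewrite mul0r.
    by rewrite /= mul1r.
  by rewrite gauss_momentSS natrM subn1.
apply: eq_bigr => i /negPf il; rewrite mnmDE mnmBE mnm1E eq_sym il.
by rewrite add0n subn0.
Qed.

End Mean.

Lemma exists_gauss_algebra (C : comNzRingType) (d : nat) :
  inhabited (gauss_algebra C d).
Proof.
constructor.
refine (@GaussAlgebra C d {mpoly C[d]} (@mpolyC d C) (fun l => 'X_l) (@mderiv d C)
  (@mean C d) (fun v => @meval d C v) _ _ _ _ _ _ _ _ _ _ _).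
- by move=> l p q; rewrite linearD.
- by move=> l p q; rewrite mderivM.
- move=> l j; rewrite mderivX mnm1E eq_sym; case: eqP => [->|_]; last by rewrite scale0r.
  rewrite scale1r; have -> : (U_(j) - U_(j))%MM = 0%MM :> 'X_{1..d} by apply/mnmP => i; rewrite mnmBE subnn mnm0E.
  by rewrite mpolyX0.
- by move=> l c; rewrite mderivC.
- exact: meanD.
- exact: meanZ.
- exact: mean1.
- exact: mean_ibp.
- by move=> v c; rewrite /= mevalC.
- by move=> v l; rewrite /= mevalXU.
- move=> p; exists [seq (p@_m, fun l => m l) | m <- msupp p]; split.
    by move=> v; rewrite /= mevalE big_map.
  by rewrite big_map.
Qed.
End GaussPoly.

From mathcomp Require Import complex ring lra zify.
From mathcomp Require Import all_classical all_reals all_analysis measurable_realfun.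
Import Order.TTheory GRing.Theory Num.Theory.
Import numFieldNormedType.Exports.
Local Open Scope classical_set_scope.
Local Open Scope ring_scope.

(** * Schwinger-Dyson equations for Gaussian matrices *)

Section Splits.
Variable L : eqType.
Implicit Types (c : L) (w u v : seq L).

(* The factorizations [w = u ++ c :: v]. *)
Fixpoint splits c w : seq (seq L * seq L) :=
  if w is b :: w' then
    (if b == c then [:: ([::], w')] else [::]) ++
    [seq (b :: uv.1, uv.2) | uv <- splits c w']
  else [::].

Lemma splits_cat c w w' :
  splits c (w ++ w') = [seq (uv.1, uv.2 ++ w') | uv <- splits c w] ++
                       [seq (w ++ uv.1, uv.2) | uv <- splits c w'].
Proof.
elim: w => [|b w IH] /=; first by rewrite -[LHS]map_id; apply: eq_map => -[].
rewrite IH map_cat map_cat -!catA -!map_comp; case: eqP => _ //=.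
Qed.

Lemma mem_splits c w uv : uv \in splits c w -> w = uv.1 ++ c :: uv.2.
Proof.
elim: w uv => //= b w IH uv; rewrite mem_cat => /orP[|].
  by case: eqP => // ->; rewrite inE => /eqP ->.
by move=> /mapP[uv' /IH -> ->].
Qed.

(** Mergers of [w] with one word of [ws]: that word is cut at an occurrence of [c], read cyclically
    from there and appended to [w]. They index the derivatives of the other traces in a product. *)
Fixpoint splices c w (ws : seq (seq L)) : seq (seq (seq L)) :=
  if ws is w' :: ws' then
    [seq (w ++ uv.2 ++ uv.1) :: ws' | uv <- splits c w'] ++
    [seq w' :: us | us <- splices c w ws']
  else [::].

End Splits.

Lemma splits_map (L K : eqType) (f : L -> K) c w : injective f ->
  splits (f c) (map f w) = [seq (map f uv.1, map f uv.2) | uv <- splits c w].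
Proof.
move=> fI; elim: w => //= b w ->; rewrite map_cat -!map_comp.
by rewrite (inj_eq fI); case: eqP.
Qed.

Section HermitianEntries.
Variables (I : Type) (k : nat).

(* Entries of the Hermitian matrices with the coordinates [t] of [hs_coord];
   [c] stands for the inverse square root of 2. *)
Definition herm_entry (A : comNzRingType) (c i : A) (t : I * 'I_k * 'I_k -> A)
    (m : I) (a b : 'I_k) : A :=
  if a == b then t (m, a, a)
  else if (a < b)%N then c * (t (m, a, b) - i * t (m, b, a))
  else c * (t (m, b, a) + i * t (m, a, b)).

Variables (A : comNzRingType) (c i : A).

Lemma herm_entryD t u m a b :
  herm_entry c i (fun l => t l + u l) m a b =
  herm_entry c i t m a b + herm_entry c i u m a b.
Proof. by rewrite /herm_entry; case: ifP => // _; case: ifP => _; ring. Qed.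

Lemma herm_entryZ z t m a b :
  herm_entry c i (fun l => z * t l) m a b = z * herm_entry c i t m a b.
Proof. by rewrite /herm_entry; case: ifP => // _; case: ifP => _; ring. Qed.

Lemma eq_herm_entry t u m a b : t =1 u ->
  herm_entry c i t m a b = herm_entry c i u m a b.
Proof. by move=> tu; rewrite /herm_entry !tu. Qed.

Lemma herm_entry0 m a b : herm_entry c i (fun=> 0) m a b = 0.
Proof. by rewrite /herm_entry; case: ifP => // _; case: ifP => _; ring. Qed.

End HermitianEntries.

(** This is the covariance of the entries of a Gaussian Hermitian matrix: [x_ab] pairs with [x_ba]
    only. *)
Lemma herm_entry_dual (I : eqType) k (A : comNzRingType) (s i : A)
    (m m' : I) (a b c d : 'I_k) : s * s * 2 = 1 -> i * i = -1 ->
  herm_entry s i (fun l => herm_entry s i (fun l' => (l == l')%:R) m' c d) m a b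
  = ((m == m') && (c == b) && (d == a))%:R.
Proof.
move=> ss ii; rewrite /herm_entry !xpair_eqE -!val_eqE /=.
case: (m == m') => /=; last by do 4?case: ifP => _; ring.
case: (ltngtP a b) => ab; case: (ltngtP c d) => cd;
  case: (eqVneq (a : nat) d) => ad; case: (eqVneq (b : nat) c) => bc;
  case: (eqVneq (a : nat) c) => ac; case: (eqVneq (b : nat) d) => bd;
  rewrite /= ?ad ?bc ?ac ?bd ?eqxx//=; try (exfalso; lia).
all: rewrite ?(eq_sym (d : nat)) ?(eq_sym (c : nat)).
all: try (rewrite ?(negPf ad) ?(negPf bc) ?(negPf ac) ?(negPf bd)); try done.
all: rewrite ?andbF ?andFb ?andbT /=; try ring.
all: try ring: ss ii.
Qed.

Section SchwingerDyson.
Variables (R : realType) (I : finType) (k : nat).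
Let C : comNzRingType := R[i]%C.
Let L : finType := (I * 'I_k * 'I_k)%type.
Variable ga : gauss_algebra C #|L|.
Let P := ga_ring ga.
Local Notation const := (ga_const ga).
Local Notation mean := (@ga_mean _ _ ga).

Definition isqrt2 : C := (Num.sqrt 2)^-1%:C%C.
Definition gvar (l : L) : P := ga_var ga (enum_rank l).
Definition gmx (m : I) : 'M[P]_k :=
  \matrix_(a, b) herm_entry (const isqrt2) (const 'i%C) gvar m a b.
(** The combination of partial derivatives with the coefficients of the entry [gmx m a b], so that
    it is the partner of this entry in integration by parts. *)
Definition gderiv (m : I) (a b : 'I_k) (p : P) : P :=
  herm_entry (const isqrt2) (const 'i%C)
    (fun l => ga_deriv (enum_rank l) p) m a b.

Lemma isqrt2_sqr : isqrt2 * isqrt2 * 2 = 1.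
Proof.
have -> : 2 = (2 : R)%:C%C :> C by rewrite -(rmorph_nat (real_complex R)).
by rewrite -!rmorphM/= -invfM -expr2 sqr_sqrtr ?ler0n// mulVf ?pnatr_eq0.
Qed.

Lemma mean_gmx m a b p : mean (gmx m a b * p) = mean (gderiv m a b p).
Proof.
have meanN q : mean (- q) = - mean q.
  by rewrite -mulN1r -[1 in LHS](rmorph1 const) -rmorphN ga_meanZ mulN1r.
rewrite mxE /gderiv /herm_entry; case: ifP => _; first exact: ga_mean_ibp.
case: ifP => _.
- rewrite -mulrA mulrBl !ga_meanZ -mulrA !ga_meanD !meanN !ga_meanZ.
  by rewrite !ga_mean_ibp.
- rewrite -mulrA mulrDl !ga_meanZ -mulrA !ga_meanD !ga_meanZ.
  by rewrite !ga_mean_ibp.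
Qed.

Lemma gderivD m a b p q : gderiv m a b (p + q) = gderiv m a b p + gderiv m a b q.
Proof.
by rewrite /gderiv -herm_entryD; apply: eq_herm_entry => l; exact: ga_derivD.
Qed.

Lemma gderiv_const m a b c : gderiv m a b (const c) = 0.
Proof.
rewrite /gderiv -[RHS](herm_entry0 (const isqrt2) (const 'i%C) m a b).
by apply: eq_herm_entry => l; exact: ga_deriv_const.
Qed.

Lemma gderiv0 m a b : gderiv m a b 0 = 0.
Proof. by rewrite -[0 in LHS](rmorph0 const) gderiv_const. Qed.

Lemma gderiv_sum m a b (J : Type) (s : seq J) (F : J -> P) :
  gderiv m a b (\sum_(j <- s) F j) = \sum_(j <- s) gderiv m a b (F j).
Proof. by apply: (big_morph _ (gderivD m a b) (gderiv0 m a b)). Qed.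

Lemma gderivM m a b p q :
  gderiv m a b (p * q) = gderiv m a b p * q + p * gderiv m a b q.
Proof.
rewrite /gderiv [X in _ = X + _]mulrC -!herm_entryZ -herm_entryD.
by apply: eq_herm_entry => l; rewrite ga_derivM; ring.
Qed.

Lemma gderiv_gmx m a b m' c d :
  gderiv m a b (gmx m' c d) = ((m == m') && (c == b) && (d == a))%:R.
Proof.
have dherm l : ga_deriv (enum_rank l) (gmx m' c d) =
    herm_entry (const isqrt2) (const 'i%C) (fun l' => (l == l')%:R) m' c d.
  have dZ z p : ga_deriv (enum_rank l) (const z * p) = const z * ga_deriv (enum_rank l) p.
    by rewrite ga_derivM ga_deriv_const mul0r add0r.
  have dN (p : P) : ga_deriv (enum_rank l) (- p) = - ga_deriv (enum_rank l) p.
    have -> : - p = const (-1) * p by rewrite rmorphN rmorph1 mulN1r.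
    by rewrite dZ rmorphN rmorph1 mulN1r.
  have dv l' : ga_deriv (enum_rank l) (gvar l') = (l == l')%:R.
    by rewrite ga_deriv_var (inj_eq enum_rank_inj).
  rewrite mxE /herm_entry; case: ifP => _; first exact: dv.
  by case: ifP => _; rewrite dZ ga_derivD ?dN dZ !dv.
rewrite /gderiv (eq_herm_entry _ _ _ _ _ dherm).
have ss : const isqrt2 * const isqrt2 * 2 = 1.
  by rewrite -[RHS](rmorph1 const) -isqrt2_sqr !rmorphM rmorph_nat.
have ii : const 'i%C * const 'i%C = -1.
  by rewrite -rmorphM -expr2 sqr_i rmorphN rmorph1.
move: (const isqrt2) (const 'i%C) ss ii => s i ss ii.
exact: herm_entry_dual.
Qed.

Variables (J : eqType) (inJ : I -> J) (z : J -> 'M[P]_k).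
Hypothesis inJ_inj : injective inJ.
Variable kappa : C.
Hypothesis kappa2 : kappa * kappa * k%:R = 1.
Hypothesis z_gauss : forall i, z (inJ i) = const kappa *: gmx i.
Hypothesis z_const : forall j, (forall i, j != inJ i) ->
  exists x : 'M[C]_k, z j = map_mx const x.

Definition wmx (w : seq J) : 'M[P]_k := \big[mulmx/1%:M]_(j <- w) z j.
Definition wtr (w : seq J) : P := const (k%:R^-1) * \tr (wmx w).
Definition wtrs (ws : seq (seq J)) : P := \prod_(w <- ws) wtr w.

Lemma wmx_cons j w : wmx (j :: w) = z j *m wmx w.
Proof. by rewrite /wmx big_cons. Qed.

Lemma wmx_cat u v : wmx (u ++ v) = wmx u *m wmx v.
Proof.
elim: u => [|j u IH]; first by rewrite /wmx big_nil mul1mx.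
by rewrite cat_cons !wmx_cons IH mulmxA.
Qed.

Lemma wtr_cat u v : wtr (u ++ v) = wtr (v ++ u).
Proof. by rewrite /wtr !wmx_cat mxtrace_mulC. Qed.

Lemma gderiv_constM m a b c p : gderiv m a b (const c * p) = const c * gderiv m a b p.
Proof. by rewrite gderivM gderiv_const mul0r add0r. Qed.

(** Leibniz rule: differentiating one occurrence of the letter replaces it by a matrix unit, which
    cuts the product in two. *)
Lemma gderiv_wmx m a b w p q : gderiv m a b (wmx w p q) =
  const kappa * \sum_(uv <- splits (inJ m) w) wmx uv.1 p b * wmx uv.2 a q.
Proof.
elim: w p q => [|j w IH] p q.
  rewrite /= big_nil mulr0 /wmx big_nil mxE.
  by rewrite -(rmorph_nat const) gderiv_const.
rewrite wmx_cons mxE gderiv_sum /=.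
under eq_bigr do rewrite gderivM IH.
rewrite big_split /= big_cat /= mulrDr; congr (_ + _); last first.
  rewrite big_map mulr_sumr.
  under [RHS]eq_bigr do rewrite wmx_cons mxE /= mulr_suml.
  under [LHS]eq_bigr do rewrite 2!mulr_sumr.
  rewrite exchange_big; apply: eq_bigr => uv _.
  by rewrite mulr_sumr; apply: eq_bigr => r _; ring.
case: eqP => [->|/eqP jm].
  rewrite big_seq1 /= z_gauss (bigD1 a)//= big1 => [|r ra].
    rewrite mxE gderiv_constM gderiv_gmx !eqxx andbT /wmx big_nil addr0 mxE.
    by rewrite mulrA.
  by rewrite mxE gderiv_constM gderiv_gmx (negPf ra) andbF mulr0 mul0r.
rewrite big_nil mulr0 big1// => r _.
have [[i ji]|ji] := pselect (exists i, j = inJ i).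
  rewrite ji z_gauss mxE gderiv_constM gderiv_gmx.
  have /negPf -> : m != i by apply: contraNneq jm => ->; rewrite ji.
  by rewrite mulr0 mul0r.
have [|x ->] := @z_const j.
  by move=> i; apply/eqP => jE; apply: ji; exists i.
by rewrite mxE gderiv_const mul0r.
Qed.

Lemma gderiv_wtr m a b w : gderiv m a b (wtr w) =
  const (kappa / k%:R) * \sum_(uv <- splits (inJ m) w) wmx (uv.2 ++ uv.1) a b.
Proof.
rewrite /wtr gderiv_constM /mxtrace gderiv_sum.
under eq_bigr do rewrite gderiv_wmx.
rewrite -mulr_sumr exchange_big /= mulrA -rmorphM [_^-1 * _]mulrC; congr (_ * _).
apply: eq_bigr => uv _; rewrite wmx_cat mxE.
by apply: eq_bigr => r _; rewrite mulrC.
Qed.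

Lemma mean_constM c p : mean (const c * p) = c * mean p.
Proof. exact: ga_meanZ. Qed.

Lemma mean_sum (T : Type) (s : seq T) (F : T -> P) :
  mean (\sum_(t <- s) F t) = \sum_(t <- s) mean (F t).
Proof.
apply: (big_morph _ (@ga_meanD _ _ ga)).
by rewrite -[0 in LHS](mulr0 (const 0)) ga_meanZ mul0r.
Qed.

(** A differentiated trace closes up with [w] into the single trace of the merged word. Two factors
    [kappa / k] against one normalization [k] leave [kappa ^ 2 / k = k ^ -2]. *)
Lemma trace_gderiv_wtrs m w ws : (0 < k)%N ->
  const (kappa / k%:R) * \sum_a \sum_b wmx w b a * gderiv m a b (wtrs ws) =
  const (k%:R ^- 2) * \sum_(us <- splices (inJ m) w ws) wtrs us.
Proof.
move=> k0; have kn0 : k%:R != 0 :> R[i]%C by rewrite pnatr_eq0 -lt0n.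
elim: ws => [|w' ws IH].
  rewrite /wtrs /= !big_nil mulr0 big1 ?mulr0// => a _; rewrite big1// => b _.
  by rewrite -[1](rmorph1 const) gderiv_const mulr0.
rewrite /= big_cat !big_map /= mulrDr.
have -> : \sum_(us <- splices (inJ m) w ws) wtrs (w' :: us) =
  wtr w' * \sum_(us <- splices (inJ m) w ws) wtrs us.
  by rewrite mulr_sumr; apply: eq_bigr => us _; rewrite /wtrs big_cons.
rewrite mulrCA -IH /wtrs.
under eq_bigr => a _ do under eq_bigr => b _ do rewrite big_cons gderivM mulrDr.
under eq_bigr => a _ do rewrite big_split.
rewrite big_split /= mulrDr; congr (_ + _); last first.
  rewrite mulrCA; congr (_ * _); rewrite mulr_sumr; apply: eq_bigr => a _.
  by rewrite mulr_sumr; apply: eq_bigr => b _; ring.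
under eq_bigr => a _ do under eq_bigr => b _ do rewrite gderiv_wtr.
transitivity (const (kappa / k%:R) * (const (kappa / k%:R) *
  \sum_(uv <- splits (inJ m) w') \tr (wmx (w ++ uv.2 ++ uv.1)) * wtrs ws)).
  congr (_ * _).
  under [in RHS]eq_bigr do rewrite wmx_cat mxtrace_mulC /mxtrace mulr_suml.
  rewrite [in RHS]exchange_big /= mulr_sumr; apply: eq_bigr => a _.
  under [in RHS]eq_bigr do rewrite mxE mulr_suml.
  rewrite [in RHS]exchange_big /= mulr_sumr; apply: eq_bigr => b _.
  rewrite -mulrA mulrCA; congr (_ * _); rewrite mulr_suml mulr_sumr.
  by apply: eq_bigr => uv _; rewrite /wtrs; ring.
rewrite mulrA -rmorphM.
under [in RHS]eq_bigr do rewrite big_cons /wtr -mulrA.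
rewrite -[in RHS]mulr_sumr [RHS]mulrA -rmorphM; congr (const _ * _).
transitivity (kappa * kappa * k%:R * (k%:R ^- 2 / k%:R) : R[i]%C).
  by field.
by rewrite kappa2 mul1r.
Qed.

(** Integration by parts on the leading letter: its derivative hits either the rest of its own word,
    which splits into two traces, or another trace, which merges. *)
Lemma schwinger_dyson m w ws : (0 < k)%N ->
  mean (wtrs ((inJ m :: w) :: ws)) =
  \sum_(uv <- splits (inJ m) w) mean (wtrs (uv.1 :: uv.2 :: ws)) +
  k%:R ^- 2 * \sum_(us <- splices (inJ m) w ws) mean (wtrs us).
Proof.
move=> k0; have kn0 : k%:R != 0 :> R[i]%C by rewrite pnatr_eq0 -lt0n.
rewrite -!mean_sum -mean_constM -trace_gderiv_wtrs// {1}/wtrs big_cons -/(wtrs ws).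
rewrite /wtr wmx_cons z_gauss -scalemxAl mxtraceZ mulrA -rmorphM.
rewrite -mulrA /mxtrace mulr_suml mean_constM [in LHS]mean_constM.
rewrite [in LHS]mean_sum; under [in LHS] eq_bigr do rewrite mxE mulr_suml mean_sum.
under eq_bigr => a _ do under eq_bigr => b _ do
  rewrite -mulrA mean_gmx gderivM gderiv_wmx ga_meanD.
under eq_bigr => a _ do rewrite big_split.
rewrite big_split mulrDr /=; congr (_ + _); last first.
  rewrite -mean_constM (mulrC _ kappa) !mean_constM mean_sum; congr (_ * _).
  by apply: eq_bigr => a _; rewrite mean_sum.
under eq_bigr do rewrite -mean_sum.
rewrite -mean_sum -mean_constM; congr mean.
have trE u : \tr (wmx u) = const k%:R * wtr u.
  by rewrite /wtr mulrA -rmorphM mulfV// rmorph1 mul1r.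
have -> : \sum_a \sum_b const kappa * (\sum_(uv <- splits (inJ m) w)
    wmx uv.1 b b * wmx uv.2 a a) * wtrs ws =
  const kappa * \sum_(uv <- splits (inJ m) w)
   (\tr (wmx uv.1) * \tr (wmx uv.2) * wtrs ws).
  under eq_bigr => a _ do under eq_bigr => b _ do rewrite mulr_sumr mulr_suml.
  under eq_bigr do rewrite exchange_big.
  rewrite exchange_big mulr_sumr; apply: eq_bigr => uv _ /=.
  rewrite /mxtrace big_distrlr /= exchange_big mulr_suml mulr_sumr.
  apply: eq_bigr => a _; rewrite mulr_suml mulr_sumr.
  by apply: eq_bigr => b _; rewrite -!mulrA.
under [in LHS]eq_bigr => uv _ do rewrite (trE uv.1) (trE uv.2).
rewrite mulr_sumr mulr_sumr; apply: eq_bigr => uv _.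
rewrite /wtrs !big_cons.
(* Each of the two new traces brings a factor [k]; the powers cancel exactly, so splitting terms
   survive in the limit. *)
transitivity (const (k%:R^-1 * kappa * kappa * k%:R * k%:R) * (wtr uv.1 * (wtr uv.2 * wtrs ws))).
  rewrite !rmorphM /wtrs; ring.
have -> : k%:R^-1 * kappa * kappa * k%:R * k%:R = 1 :> C.
  by rewrite -!mulrA (mulrA kappa) (mulrA _ _ k%:R) kappa2 mul1r mulVf.
by rewrite rmorph1 mul1r.
Qed.

End SchwingerDyson.

Lemma splits_count (L : eqType) (p : pred L) c w uv : uv \in splits c w ->
  count p w = (count p uv.1 + count p uv.2 + p c)%N.
Proof. by move=> /mem_splits ->; rewrite count_cat /= addnCA addnC. Qed.

(** A merger consumes one [c]. Counting Gaussian letters this way makes the induction of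
    [mixed_mean_bound] terminate, and counting all letters bounds the lengths. *)
Lemma splices_count (L : eqType) (p : pred L) c w ws us :
  us \in splices c w ws ->
  (\sum_(u <- us) count p u + p c = count p w + \sum_(u <- ws) count p u)%N.
Proof.
elim: ws us => //= w' ws IH us; rewrite mem_cat => /orP[|] /mapP[].
  move=> uv /(splits_count p) uvE ->; rewrite !big_cons uvE !count_cat.
  by rewrite (addnC (count p uv.2)) !addnA [RHS]addnAC.
move=> vs /IH vsE ->; rewrite !big_cons -addnA vsE.
by move: (\sum_(_ <- _) _)%N => *; lia.
Qed.

(** A product is Lipschitz near [f]; the restriction [d <= 1] makes the constant depend on [f]
    alone. *)
Lemma prod_dist_le (F : numFieldType) (T : eqType) (us : seq T) (f : T -> F) :
  exists2 K : F, 0 <= K & forall (t : T -> F) (d : F), 0 <= d <= 1 ->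
    (forall u, u \in us -> `|t u - f u| <= d) ->
    `|\prod_(u <- us) t u - \prod_(u <- us) f u| <= K * d.
Proof.
elim: us => [|u us [K K0 IH]].
  by exists 0 => // t d _ _; rewrite !big_nil subrr normr0 mul0r.
exists ((`|f u| + 1) * K + `|\prod_(u <- us) f u|) => [|t d d01 tf].
  by rewrite addr_ge0 ?mulr_ge0 ?addr_ge0.
have /andP[d0 d1] := d01; rewrite !big_cons.
have tu : `|t u - f u| <= d by apply: tf; rewrite mem_head.
have tus : `|\prod_(u <- us) t u - \prod_(u <- us) f u| <= K * d.
  by apply: IH => // v vus; apply: tf; rewrite inE vus orbT.
set T1 := \prod_(u <- us) t u in tus *; set F1 := \prod_(u <- us) f u in tus *.
have -> : t u * T1 - f u * F1 = t u * (T1 - F1) + (t u - f u) * F1 by ring.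
rewrite (le_trans (ler_normD _ _))// !normrM mulrDl -mulrA lerD//; last first.
  by rewrite mulrC ler_wpM2l.
apply: ler_pM => //.
have -> : t u = f u + (t u - f u) by ring.
by rewrite (le_trans (ler_normD _ _))// lerD// (le_trans tu).
Qed.

(** * Asymptotic freeness of Gaussian matrices and given matrices *)

Section MixedMoments.
Variables (R : realType) (X : eqType) (I : finType).
Let C : numClosedFieldType := R[i]%C.

Definition mixed_mx k (ga : gauss_algebra C #|{: I * 'I_k * 'I_k}|)
    (x : X -> 'M[C]_k) (j : X + I) : 'M[ga_ring ga]_k :=
  match j with
  | inl i => map_mx (ga_const ga) (x i)
  | inr i => ga_const ga ((Num.sqrt k%:R)^-1%:C)%C *: gmx ga i
  end.

Definition mixed_tr k (ga : gauss_algebra C #|{: I * 'I_k * 'I_k}|)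
    (x : X -> 'M[C]_k) (w : seq (X + I)) : ga_ring ga :=
  wtr (mixed_mx ga x) w.

Definition mixed_mean k (ga : gauss_algebra C #|{: I * 'I_k * 'I_k}|)
    (x : X -> 'M[C]_k) (ws : seq (seq (X + I))) : C :=
  ga_mean (\prod_(w <- ws) mixed_tr ga x w).

Variable phi : seq (X + I) -> C.
Hypothesis phi_cat : forall u v, phi (u ++ v) = phi (v ++ u).
Hypothesis phi_sd : forall m w,
  phi (inr m :: w) = \sum_(uv <- splits (inr m) w) phi uv.1 * phi uv.2.

Definition trace_close k (x : X -> 'M[C]_k) (N : nat) (d : C) : Prop :=
  forall u : seq X, (size u <= N)%N ->
    `|ntrace (\big[mulmx/1%:M]_(i <- u) x i) - phi (map inl u)| <= d.

Lemma trace_closeW k (x : X -> 'M[C]_k) N N' d : (N' <= N)%N ->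
  trace_close x N d -> trace_close x N' d.
Proof. by move=> NN xc u uN; apply: xc; apply: leq_trans NN. Qed.

Let isr (j : X + I) := if j is inr _ then true else false.

Let nog w : ~~ has isr w -> exists u : seq X, w = map inl u.
Proof.
elim: w => [|[i|i] w IH] //=; first by exists [::].
by move=> /IH[u ->]; exists (i :: u).
Qed.

Let bound ws (K : C) := forall k (ga : gauss_algebra C #|{: I * 'I_k * 'I_k}|) x d,
  (0 < k)%N -> 0 <= d <= 1 -> trace_close x (\sum_(w <- ws) size w) d ->
  `|mixed_mean ga x ws - \prod_(w <- ws) phi w| <= K * (d + k%:R ^- 2).

Let mixed_mean_const us :
  exists2 K, 0 <= K & bound [seq map inl u | u <- us] K.
Proof.
have [K K0 KP] := @prod_dist_le C _ us (fun u => phi (map inl u)).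
exists K => // k ga x d k0 d01 xc.
have wE u : mixed_tr ga x (map inl u) =
    ga_const ga (ntrace (\big[mulmx/1%:M]_(i <- u) x i)).
  rewrite /mixed_tr /wtr /ntrace rmorphM -trace_map_mx; congr (_ * \tr _).
  elim: u => [|i u IHu]; first by rewrite /wmx !big_nil map_mx1.
  by rewrite wmx_cons big_cons map_mxM IHu.
rewrite /mixed_mean !big_map; under eq_bigr do rewrite wE.
rewrite -rmorph_prod -[X in ga_mean X]mulr1 ga_meanZ ga_mean1 mulr1.
apply: le_trans (KP _ _ d01 _) _.
  move=> u uus; apply: xc; rewrite big_map (perm_big _ (perm_to_rem uus)) big_cons.
  by rewrite size_map leq_addr.
by rewrite ler_wpM2l// lerDl invr_ge0 exprn_ge0.
Qed.

(** Induction on the number of Gaussian letters. The means obey the same equation as the products of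
    [phi], up to mergers of weight [k ^ -2], and every term of it has fewer Gaussian letters. The
    constant depends neither on [k] nor on [x]. *)
Lemma mixed_mean_bound ws : exists2 K, 0 <= K & bound ws K.
Proof.
have [n] := ubnP (\sum_(w <- ws) count isr w).
elim: n ws => // n IH ws; rewrite ltnS => wsn.
case: (boolP (has (has isr) ws)) => [/hasP[w0 w0ws w0g]|wsx]; last first.
  have [us ->] : exists us, ws = [seq map inl u | u <- us].
    elim: ws wsx {wsn} => [|w ws IHw] /=; first by exists [::].
    rewrite negb_or => /andP[/nog[u ->] /IHw[us ->]].
    by exists (u :: us).
  exact: mixed_mean_const.
have [p [m [q w0E]]] : exists p m q, w0 = p ++ inr m :: q.
  have /hasP[[//|m] mw0 _] := w0g.
  by case/splitPr: mw0 => p q; exists p, m, q.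
have [ws' wsP] : exists ws', perm_eq ws (w0 :: ws').
  by exists (rem w0 ws); exact: perm_to_rem.
(* Traces and [phi] are cyclic, so [w0] may be read as [inr m :: w], to which the equation
   applies. *)
set w := q ++ p.
have wc a : count a w0 = (count a w + a (inr m))%N.
  by rewrite w0E /w !count_cat /=; lia.
have cnt a : (\sum_(w <- ws) count a w =
    count a w + a (inr m) + \sum_(w <- ws') count a w)%N.
  by rewrite (perm_big _ wsP) big_cons wc.
have szE (vs : seq (seq (X + I))) :
    (\sum_(w <- vs) size w = \sum_(w <- vs) count predT w)%N.
  by apply: eq_bigr => v _; rewrite count_predT.
have /choice[K1 K1P] : forall uv : seq (X + I) * seq (X + I), exists K,
    uv \in splits (inr m) w -> 0 <= K /\ bound (uv.1 :: uv.2 :: ws') K.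
  move=> uv; case: (boolP (uv \in _)) => [uvs|]; last by exists 0.
  have [|K K0 KP] := IH (uv.1 :: uv.2 :: ws'); last by exists K.
  apply: leq_trans wsn; rewrite cnt (splits_count _ uvs) !big_cons /=; lia.
have /choice[K2 K2P] : forall us : seq (seq (X + I)), exists K,
    us \in splices (inr m) w ws' -> 0 <= K /\ bound us K.
  move=> us; case: (boolP (us \in _)) => [uss|]; last by exists 0.
  have [|K K0 KP] := IH us; last by exists K.
  apply: leq_trans wsn; rewrite cnt -addnA addnCA -(splices_count _ uss) /=; lia.
(* Mergers already carry the factor [k ^ -2], so only a bound of their means is needed: the limit
   plus the error [K2 us * (d + k ^ -2)], at most [K2 us * 2]. *)
exists (\sum_(uv <- splits (inr m) w) K1 uv +
        \sum_(us <- splices (inr m) w ws') (`|\prod_(u <- us) phi u| + K2 us * 2)).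
  rewrite addr_ge0// big_seq sumr_ge0// => t /[dup] ts.
    by move=> /K1P[].
  by move=> /K2P[K20 _]; rewrite addr_ge0// mulr_ge0.
move=> k ga x d k0 d01 xc.
have kk : (k%:R ^- 2 : C) <= 1.
  by rewrite invf_le1 ?exprn_gt0 ?ltr0n// exprn_ege1// ler1n.
have k2 : 0 <= (k%:R ^- 2 : C) by rewrite invr_ge0 exprn_ge0.
have /andP[d0 d1] := d01.
have -> : mixed_mean ga x ws = mixed_mean ga x ((inr m :: w) :: ws').
  rewrite /mixed_mean (perm_big _ wsP) !big_cons; congr (ga_mean (_ * _)).
  by rewrite w0E /w /mixed_tr wtr_cat.
have -> : \prod_(w <- ws) phi w = \prod_(w <- (inr m :: w) :: ws') phi w.
  by rewrite (perm_big _ wsP) !big_cons w0E phi_cat.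
have kappaP : ((Num.sqrt k%:R)^-1%:C%C * (Num.sqrt k%:R)^-1%:C%C * k%:R = 1 :> C).
  have -> : k%:R = (k%:R : R)%:C%C :> C by rewrite rmorph_nat.
  rewrite -!rmorphM/= -invfM -expr2 sqr_sqrtr ?ler0n// mulVf ?rmorph1//.
  by rewrite pnatr_eq0 -lt0n.
have cstP j : (forall i : I, j != inr i) ->
    exists y : 'M[C]_k, mixed_mx ga x j = map_mx (ga_const ga) y.
  by case: j => [i _|i /(_ i)/eqP//]; exists (x i).
have SD := @schwinger_dyson R I k ga _ inr (mixed_mx ga x) _ kappaP (fun=> erefl) cstP.
rewrite /mixed_mean SD//.
rewrite big_cons phi_sd mulr_suml addrAC -sumrB mulrDl.
apply: le_trans (ler_normD _ _) _; apply: lerD.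
  rewrite (le_trans (ler_norm_sum _ _ _))// mulr_suml big_seq [leRHS]big_seq.
  apply: ler_sum => uv uvs; have [_ KP] := K1P _ uvs.
  have -> : phi uv.1 * phi uv.2 * \prod_(w1 <- ws') phi w1 =
      \prod_(w1 <- uv.1 :: uv.2 :: ws') phi w1 by rewrite !big_cons mulrA.
  apply: (KP k ga x d k0 d01).
  apply: trace_closeW xc.
  rewrite !szE cnt !big_cons (splits_count _ uvs) addnA leq_add2r.
  by rewrite -!addnA !leq_add2l leq_addr.
rewrite normrM ger0_norm// mulrC.
apply: (@le_trans _ _ ((\sum_(us <- splices (inr m) w ws')
    (`|\prod_(u <- us) phi u| + K2 us * 2)) * k%:R ^- 2)); last first.
  rewrite ler_wpM2l ?lerDr// big_seq sumr_ge0// => us /K2P[K20 _].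
  by rewrite addr_ge0// mulr_ge0.
rewrite ler_wpM2r// (le_trans (ler_norm_sum _ _ _))// big_seq [leRHS]big_seq.
apply: ler_sum => us uss; have [K20 KP] := K2P _ uss.
rewrite -[X in `|X|](subrK (\prod_(u <- us) phi u)) addrC.
rewrite (le_trans (ler_normD _ _))// lerD//.
apply: le_trans (KP k ga x d k0 d01 _) _; last first.
  by rewrite ler_wpM2l// lerD.
apply: trace_closeW xc.
by rewrite !szE cnt addnAC -(splices_count predT uss) -addnA leq_addr.
Qed.

End MixedMoments.

(** * Schwinger-Dyson equations from freeness *)

Section CenteredProducts.
Variables (C : comNzRingType) (L T : eqType) (ty : L -> T).
Variable phi : seq L -> C.
Implicit Types (F G : seq L -> C) (w u v b : seq L).

(* The linear extension of [F] evaluated at the product of the centered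
   blocks [b - phi b]. *)
Fixpoint cprod F bs : C :=
  if bs is b :: bs' then cprod (fun w => F (b ++ w)) bs' - phi b * cprod F bs'
  else F [::].

Lemma eq_cprod F G bs : F =1 G -> cprod F bs = cprod G bs.
Proof.
elim: bs F G => [|b bs IH] F G FG /=; first exact: FG.
by rewrite (IH F G)// (IH (fun w => F (b ++ w)) (fun w => G (b ++ w))).
Qed.

Lemma cprodD F G bs : cprod (fun w => F w + G w) bs = cprod F bs + cprod G bs.
Proof. by elim: bs F G => [|b bs IH] F G //=; rewrite !IH; ring. Qed.

Lemma cprodZ c F bs : cprod (fun w => c * F w) bs = c * cprod F bs.
Proof. by elim: bs F => [|b bs IH] F //=; rewrite !IH; ring. Qed.

Lemma cprodB F G bs : cprod (fun w => F w - G w) bs = cprod F bs - cprod G bs.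
Proof. by elim: bs F G => [|b bs IH] F G //=; rewrite !IH; ring. Qed.

Lemma cprod_sum (J : Type) (s : seq J) (F : J -> seq L -> C) bs :
  cprod (fun w => \sum_(j <- s) F j w) bs = \sum_(j <- s) cprod (F j) bs.
Proof.
elim: bs F => [|b bs IH] F //=.
by rewrite !IH mulr_sumr -sumrB.
Qed.

Lemma cprod_cat F bs cs :
  cprod F (bs ++ cs) = cprod (fun u => cprod (fun w => F (u ++ w)) cs) bs.
Proof.
elim: bs F => [|b bs IH] F /=; first exact: eq_cprod.
rewrite !IH; congr (_ - _); apply: eq_cprod => u; apply: eq_cprod => w.
by rewrite catA.
Qed.

(** Every term of the expansion other than the full product omits a nonempty block, hence evaluates
    [F] at a word shorter than [N]. *)
Lemma cprod_small F bs N : (forall w, (size w < N)%N -> F w = 0) ->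
  all (fun b => ~~ nilp b) bs -> (size (flatten bs) <= N)%N ->
  cprod F bs = F (flatten bs).
Proof.
elim: bs F N => [|b bs IH] F N F0 //= /andP[b0 bs0]; rewrite size_cat => bN.
have bp : (0 < size b)%N by rewrite lt0n.
rewrite (IH (fun w => F (b ++ w)) (N - size b)%N) //; last 2 first.
- by move=> w wN; apply: F0; rewrite size_cat; lia.
- by lia.
rewrite (IH F N)//; last by lia.
by rewrite (F0 (flatten bs)) ?mulr0 ?subr0//; lia.
Qed.

(** Blocks may be empty, since cutting a block at its first or last letter leaves an empty piece. *)
Definition blocks (bs : seq (T * seq L)) : bool :=
  sorted (fun b c : T * seq L => b.1 != c.1) bs &&
  all (fun b : T * seq L => all (fun l => ty l == b.1) b.2) bs.

Lemma blocks_cons t b bs : blocks ((t, b) :: bs) =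
  [&& all (fun l => ty l == t) b, blocks bs &
      (if bs is c :: _ then t != c.1 else true)].
Proof.
rewrite /blocks; case: bs => [|c bs] /=; first by rewrite !andbT.
rewrite -!andbA; case: (all _ b) => /=; last by rewrite !andbF.
by rewrite [LHS]andbC -!andbA.
Qed.

Lemma word_blocks w : exists bs : seq (T * seq L),
  [/\ w = flatten (unzip2 bs), blocks bs & all (fun b => ~~ nilp b) (unzip2 bs)].
Proof.
elim: w => [|l w [bs [wE bsP bs0]]]; first by exists [::].
case: bs wE bsP bs0 => [|[t b] bs] wE bsP bs0.
  by exists [:: (ty l, [:: l])]; rewrite /= wE/=; split => //; rewrite /blocks /= eqxx.
case: (eqVneq (ty l) t) => [lt|lt].
  exists ((t, l :: b) :: bs); split; rewrite ?wE//.
    by move: bsP; rewrite !blocks_cons /= lt eqxx.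
  by move: bs0 => /= /andP[_].
exists ((ty l, [:: l]) :: (t, b) :: bs); split; rewrite ?wE//.
by rewrite blocks_cons /= eqxx bsP lt.
Qed.

Hypothesis phi_free : forall bs, blocks bs -> bs != [::] -> cprod phi (unzip2 bs) = 0.

Variables (s : L).
Let S w := phi (s :: w) - \sum_(uv <- splits s w) phi uv.1 * phi uv.2.
Hypothesis S_mono : forall w, all (fun l => ty l == ty s) w -> S w = 0.

Let phi_s : phi [:: s] = 0.
Proof. by have := S_mono (w := [::]) isT; rewrite /S /= big_nil subr0. Qed.

Let splits_typed t b u v : all (fun l => ty l == t) b -> (u, v) \in splits s b ->
  [/\ t = ty s, all (fun l => ty l == t) u & all (fun l => ty l == t) v].
Proof.
move=> bt /mem_splits bE; move: bt; rewrite bE all_cat /= => /and3P[ut /eqP tE vt].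
by rewrite tE.
Qed.

(** Centering [b] changes the product by [phi b] times the centered product of [bs], and both
    centered products vanish. *)
Let left_mul t b bs : blocks ((t, b) :: bs) -> bs != [::] ->
  cprod (fun w => phi (b ++ w)) (unzip2 bs) = 0.
Proof.
move=> bP bs0; have := phi_free bP isT; rewrite /= => /eqP; rewrite subr_eq0 => /eqP ->.
by rewrite phi_free ?mulr0//; move: bP; rewrite blocks_cons => /and3P[].
Qed.

Let left_s bs : blocks bs -> (if bs is b :: _ then ty s != b.1 else true) ->
  cprod (fun w => phi (s :: w)) (unzip2 bs) = 0.
Proof.
case: bs => [|[t b] bs] bP st; first exact: phi_s.
by apply: (@left_mul (ty s) [:: s]) => //; rewrite blocks_cons bP st /= eqxx.
Qed.

(** If the first block has the type of [s], then [s] is absorbed into it; otherwise [s] is a block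
    of its own. *)
Let left_s1 bs : blocks bs -> (1 < size bs)%N || ~~ has (fun b : T * seq L => b.1 == ty s) bs ->
  cprod (fun w => phi (s :: w)) (unzip2 bs) = 0.
Proof.
case: bs => [|[t b] bs]; first by move=> *; exact: phi_s.
case: (eqVneq t (ty s)) => [tE|ts] bP sz; last first.
  by apply: left_s; rewrite // eq_sym.
have bs0 : bs != [::] by move: sz; rewrite /= tE eqxx orbF; case: (bs).
move: (bP); rewrite blocks_cons => /and3P[bt bsP tbs].
rewrite /= (@left_mul t (s :: b))//; last by rewrite blocks_cons /= bt bsP tE eqxx -tE.
by rewrite left_s ?mulr0 ?subr0// -tE.
Qed.

Let blocks_cat p q : blocks (p ++ q) -> blocks p /\ blocks q.
Proof.
by rewrite /blocks all_cat => /andP[/cat_sorted2[-> ->] /andP[-> ->]].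
Qed.

Let right_mul p t b : blocks (rcons p (t, b)) -> p != [::] ->
  cprod (fun w => phi (w ++ b)) (unzip2 p) = 0.
Proof.
move=> pbP p0; have [pP _] : blocks p /\ blocks [:: (t, b)].
  by apply: blocks_cat; rewrite cats1.
have := phi_free pbP; rewrite -cats1 /unzip2 map_cat cprod_cat /= => H.
have {H}/eqP := H ltac:(by case: (p)).
rewrite cats0 cprodB cprodZ subr_eq0 => /eqP ->.
by rewrite (eq_cprod (G := phi)) ?phi_free ?mulr0// => w; rewrite cats0.
Qed.

(** The prefix [p] collects the blocks already passed, all to the left of the cut; the induction
    moves the cut through [bs] block by block. *)
Let split_terms p bs : blocks (p ++ bs) ->
  [|| p != [::], (1 < size bs)%N | ~~ has (fun b : T * seq L => b.1 == ty s) bs] ->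
  cprod (fun w => \sum_(uv <- splits s w)
     cprod (fun x => phi (x ++ uv.1)) (unzip2 p) * phi uv.2) (unzip2 bs) = 0.
Proof.
elim: bs p => [|[t b] bs IH] p pbP cond; first by rewrite /= big_nil.
have alpha u : cprod (fun x => phi (x ++ u)) (unzip2 (rcons p (t, b))) =
    cprod (fun x => phi (x ++ b ++ u)) (unzip2 p) -
    phi b * cprod (fun x => phi (x ++ u)) (unzip2 p).
  rewrite -cats1 /unzip2 map_cat cprod_cat /= cprodB cprodZ.
  by congr (_ - _ * _); apply: eq_cprod => w; rewrite ?cats0 ?catA.
have := IH (rcons p (t, b)).
rewrite cat_rcons => /(_ pbP) IH'.
have {IH'} : cprod (fun w => \sum_(uv <- splits s w)
    cprod (fun x => phi (x ++ uv.1)) (unzip2 (rcons p (t, b))) * phi uv.2)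
    (unzip2 bs) = 0 by apply: IH'; case: (p).
rewrite [X in X = 0 -> _](@eq_cprod _ (fun w =>
  \sum_(uv <- splits s w)
     cprod (fun x => phi (x ++ b ++ uv.1)) (unzip2 p) * phi uv.2 -
  phi b * \sum_(uv <- splits s w)
     cprod (fun x => phi (x ++ uv.1)) (unzip2 p) * phi uv.2)); last first.
  move=> w; rewrite mulr_sumr -sumrB; apply: eq_bigr => uv _.
  by rewrite alpha; ring.
rewrite cprodB cprodZ /= => IH'.
rewrite (@eq_cprod _ (fun w =>
  \sum_(uv <- splits s b)
     cprod (fun x => phi (x ++ uv.1)) (unzip2 p) * phi (uv.2 ++ w) +
  \sum_(uv <- splits s w)
     cprod (fun x => phi (x ++ b ++ uv.1)) (unzip2 p) * phi uv.2)); last first.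
  by move=> w; rewrite splits_cat big_cat !big_map.
rewrite cprodD -addrA IH' addr0 cprod_sum big_seq big1// => -[u v] uvb.
rewrite cprodZ /=.
have [_ tbP] := blocks_cat pbP.
move: tbP; rewrite blocks_cons => /and3P[bt bsP tbs].
have [tE ut vt] := splits_typed bt uvb.
(* The cut is inside [b], leaving [u] and [v]. The left factor vanishes if [p] is nonempty, the
   right one if [bs] is nonempty; [cond] excludes the remaining case of a single block of the type
   of [s]. *)
case: (eqVneq p [::]) cond => [pE|p0] /= cond; last first.
  rewrite (@right_mul p t u) ?mul0r//.
  have [+ _] : blocks (p ++ [:: (t, b)]) /\ blocks bs by apply: blocks_cat; rewrite -catA.
  rewrite -cats1 /blocks !all_cat /= bt ut !andbT.
  by case: (p) => // c p'; rewrite /= !cat_path.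
rewrite [X in _ * X](@left_mul t v) ?mulr0//; first by rewrite blocks_cons vt bsP tbs.
by move: cond; rewrite /= tE eqxx /= orbF; case: (bs).
Qed.

(** Induction on the length. As the defect [S] vanishes on shorter words, its value at [w] equals
    its value at the product of the centered blocks of [w], where both sides of the equation are
    zero. *)
Lemma free_schwinger_dyson w :
  phi (s :: w) = \sum_(uv <- splits s w) phi uv.1 * phi uv.2.
Proof.
apply/eqP; rewrite -subr_eq0 -/(S w); apply/eqP.
have [N] := ubnP (size w); elim: N w => // N IH w; rewrite ltnS => wN.
have [bs [wE bsP bs0]] := word_blocks w.
have [mono|nmono] := boolP ((size bs <= 1)%N && has (fun b : T * seq L => b.1 == ty s) bs).
  apply: S_mono; rewrite wE; move: mono bsP {wE bs0}.
  case: bs => [|[t b] [|]]//= /orP[/eqP->|//].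
  by rewrite blocks_cons cats0 => /and3P[].
rewrite wE -(@cprod_small S _ N)//; last by rewrite -wE.
rewrite /S cprodB left_s1//; last by move: nmono; rewrite negb_and -ltnNge.
rewrite sub0r; apply/eqP; rewrite oppr_eq0; apply/eqP.
have := @split_terms [::] bs bsP; apply.
by move: nmono; rewrite negb_and -ltnNge.
Qed.

End CenteredProducts.

(** * Moments of words in a von Neumann algebra *)

Section OperatorWords.
Variables (R : realType) (N : tracial_vna R).
Local Notation M := (@vna_set R N).
Local Notation tau := (@vna_state R N).
Implicit Types (x y : N -> N).

(** The algebra is a bicommutant, so this and the closure properties that follow are those of any
    commutant. *)
Lemma vna_bounded x : M x -> bounded_operator x.
Proof. by case: (vna_setP N) => _ <- []. Qed.

Lemma vna_id : M id.
Proof.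
case: (vna_setP N) => _ <-; split; last by [].
by split; [move=> a u v|move=> u].
Qed.

Lemma vna_lin (c : R[i]%C) x y : M x -> M y -> M (c *: x + y).
Proof.
case: (vna_setP N) => _ <- [[xl xc] xP] [[yl yc] yP]; split.
  split.
    move=> a u v; rewrite /= !fctE xl yl !scalerDr !scalerA (mulrC c a).
    by rewrite addrACA.
  move=> u; apply: (@continuousD _ _ _ (fun u => c *: x u) y) => //; last exact: yc.
  by apply: continuousZl_tmp; exact: xc.
move=> z zM; have [[zl _] _] := zM.
apply/funext => u; have /(congr1 (@^~ u)) /= := xP z zM.
have /(congr1 (@^~ u)) /= := yP z zM.
by rewrite !fctE zl => -> ->.
Qed.

Lemma vna_comp x y : M x -> M y -> M (x \o y).
Proof.
case: (vna_setP N) => _ <- [[xl xc] xP] [[yl yc] yP]; split.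
  split; first by move=> a u v; rewrite /= yl xl.
  by move=> u; apply: continuous_comp; [exact: yc|exact: xc].
by move=> z zM; rewrite compA xP// -compA yP.
Qed.

Lemma op_prod_cat (s t : seq (N -> N)) : op_prod (s ++ t) = op_prod s \o op_prod t.
Proof. by elim: s => //= x s ->. Qed.

Section Words.
Variables (L : eqType) (z : L -> N -> N).
Hypothesis zM : forall l, M (z l).

Definition opw (w : seq L) : N -> N := op_prod (map z w).
Definition moment (w : seq L) : R[i]%C := tau (opw w).

Lemma opw_cat u v : opw (u ++ v) = opw u \o opw v.
Proof. by rewrite /opw map_cat op_prod_cat. Qed.

Lemma vna_opw w : M (opw w).
Proof. by elim: w => [|l w IH]; [exact: vna_id|exact: vna_comp]. Qed.

Lemma moment_nil : moment [::] = 1.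
Proof. exact: (state_unit (vna_stateP N)). Qed.

Lemma moment_cat u v : moment (u ++ v) = moment (v ++ u).
Proof.
by rewrite /moment !opw_cat (state_tracial (vna_stateP N))//; exact: vna_opw.
Qed.

Let cen b : N -> N := (- moment b) *: id + opw b.

Let vna_cen b : M (cen b).
Proof. by apply: vna_lin; [exact: vna_id|exact: vna_opw]. Qed.

Let tau_cen b : tau (cen b) = 0.
Proof.
rewrite /cen (state_linear (vna_stateP N) _ vna_id (vna_opw b)).
by rewrite (state_unit (vna_stateP N)) mulr1 addNr.
Qed.

Let vna_cens bs : M (op_prod (map cen bs)).
Proof. by elim: bs => [|b bs IH]; [exact: vna_id|exact: vna_comp]. Qed.

(** The left factor [x] accumulates the blocks already expanded. *)
Let tau_cens x bs : M x ->
  tau (x \o op_prod (map cen bs)) = cprod moment (fun w => tau (x \o opw w)) bs.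
Proof.
elim: bs x => [|b bs IH] x xM //.
have -> : x \o op_prod (map cen (b :: bs)) =
    (- moment b) *: (x \o op_prod (map cen bs)) +
    ((x \o opw b) \o op_prod (map cen bs)).
  have [xl _] := vna_bounded xM.
  by apply/funext => u; rewrite /= /cen !fctE xl.
rewrite (state_linear (vna_stateP N)); last 2 first.
- by apply: vna_comp => //; exact: vna_cens.
- by apply: vna_comp; [apply: vna_comp => //; exact: vna_opw|exact: vna_cens].
rewrite IH// IH; last by apply: vna_comp => //; exact: vna_opw.
rewrite /= mulNr addrC; congr (_ - _); apply: eq_cprod => w.
by rewrite opw_cat compA.
Qed.

(** Freeness of operators becomes the vanishing hypothesis on words used by
    [free_schwinger_dyson]. *)
Lemma free_cprod (T : eqType) (ty : L -> T) (S : T -> set (N -> N)) bs :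
  Defs.free tau S -> (forall l, S (ty l) (z l)) ->
  blocks ty bs -> bs != [::] -> cprod moment moment (unzip2 bs) = 0.
Proof.
move=> freeS zS bsP bs0.
have <- : tau (op_prod (map cen (unzip2 bs))) = cprod moment moment (unzip2 bs).
  exact: (tau_cens (unzip2 bs) vna_id).
case: bs bs0 bsP => // -[t0 b0] bs' _; set bs := _ :: bs' => /andP[bsS bsT].
have genP A b t : star_subalgebra A -> S t `<=` A ->
    all (fun l => ty l == t) b -> A (opw b).
  case=> Aid _ Acomp _ StA; elim: b => [|l b IHb] //= /andP[/eqP lt /IHb Ab].
  by apply: Acomp => //; apply: StA; rewrite -lt; exact: zS.
have -> : map cen (unzip2 bs) =
    mkseq (fun k => cen (nth (t0, b0) bs k).2) (size bs).
  apply: (@eq_from_nth _ id); first by rewrite size_mkseq !size_map.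
  move=> k; rewrite !size_map => kbs; rewrite nth_mkseq//.
  by rewrite (nth_map [::]) ?size_map// (nth_map (t0, b0)).
apply: (freeS (size bs) (fun k => (nth (t0, b0) bs k).1)) => //.
  move=> k kbs; split; last exact: tau_cen.
  (* The generated algebra is an intersection, so membership is checked in an arbitrary [A]. *)
  move=> A [AS SA]; have [Aid Alin _ _] := AS.
  apply: Alin => //; apply: (genP _ _ (nth (t0, b0) bs k).1) => //.
  by move/all_nthP : bsT => /(_ (t0, b0) k kbs).
move=> k kbs; apply/eqP.
by move/(sortedP (t0, b0)) : bsS => /(_ k kbs).
Qed.

End Words.

(** Freeness is used twice: among the [s i], with the index as type, to pass from powers of one
    letter to words in [s]; then between [a] and [s], with a boolean type. *)
Lemma free_family_schwinger_dyson n (a s : 'I_n -> N -> N) m w :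
  (forall i, M (a i)) -> free_semicircular_family a s ->
  (forall i p, moment s (i :: nseq p i) =
     \sum_(q < p) moment s (nseq q i) * moment s (nseq (p - q.+1) i)) ->
  moment (join_tuple a s) (inr m :: w) =
  \sum_(uv <- splits (inr m) w)
    moment (join_tuple a s) uv.1 * moment (join_tuple a s) uv.2.
Proof.
move=> aM [s_sa _ s_free as_free] sd1.
have sM i : M (s i) by have [] := s_sa i.
have jM l : M (join_tuple a s l) by case: l => i /=.
have splits_nseq i p : splits i (nseq p i) =
    [seq (nseq q i, nseq (p - q.+1) i) | q <- iota 0 p].
  elim: p => //= p IHp; rewrite eqxx subn1 /= IHp -map_comp; congr (_ :: _).
  by rewrite (iotaDl 1) -map_comp; apply: eq_map => q.
have inner i u : moment s (i :: u) =
    \sum_(uv <- splits i u) moment s uv.1 * moment s uv.2.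
  apply: (@free_schwinger_dyson R[i]%C _ _ id (moment s)).
    move=> bs bsP bs0.
    exact: (free_cprod sM s_free _ bsP bs0).
  move=> v /all_pred1P ->; rewrite sd1 splits_nseq big_map.
  have -> : iota 0 (size v) = index_iota 0 (size v) by rewrite /index_iota subn0.
  by rewrite big_mkord subrr.
apply: (@free_schwinger_dyson R[i]%C _ _
  (fun l => if l is inr _ then true else false) (moment (join_tuple a s))).
  move=> bs bsP bs0; apply: (free_cprod jM as_free _ bsP bs0).
  by case=> i; exists i.
move=> v vr.
have [u ->] : exists u, v = map inr u.
  elim: v vr => [|[i|i] v IHv] //=; first by exists [::].
  by move=> /IHv[u ->]; exists (i :: u).
have jE u' : moment (join_tuple a s) (map inr u') = moment s u'.
  by rewrite /moment /opw -map_comp.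
rewrite -map_cons jE inner splits_map; last by move=> ? ? [].
by rewrite big_map; under eq_bigr do rewrite !jE; rewrite subrr.
Qed.

End OperatorWords.

(** * Moments of the semicircle law *)

Section Semicircle.
Variable R : realType.
Local Notation mu := (@lebesgue_measure R).
Local Notation q t := (Num.sqrt (4 - t ^+ 2) : R).

Definition semicircle_moment (p : nat) : R :=
  \int[mu]_(t in `[(- 2 : R), 2]) (t ^+ p * ((2 * pi)^-1 * q t)).

Let cq : continuous (fun t : R => q t).
Proof.
move=> t; apply: continuous_comp; last exact: sqrt_continuous.
apply: cvgB; first exact: cvg_cst.
exact: exprn_continuous.
Qed.

Let cpq p : continuous (fun t : R => t ^+ p * q t).
Proof. by move=> t; apply: cvgM; [exact: exprn_continuous|exact: cq]. Qed.

Let I p : R := \int[mu]_(t in `[(- 2 : R), 2]) (t ^+ p * q t).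

Let integrable_pq p : mu.-integrable `[(- 2 : R), 2] (EFin \o (fun t : R => t ^+ p * q t)).
Proof.
apply: continuous_compact_integrable; first exact: segment_compact.
by apply: continuous_subspaceT; exact: cpq.
Qed.

Let integrable_cpq (c : R) p :
  mu.-integrable `[(- 2 : R), 2] (EFin \o (fun t : R => c * (t ^+ p * q t))).
Proof.
apply: continuous_compact_integrable; first exact: segment_compact.
apply: continuous_subspaceT => t; apply: cvgM; first exact: cvg_cst.
exact: cpq.
Qed.

Let eq_int (f g : R -> R) : f =1 g ->
  \int[mu]_(t in `[(- 2 : R), 2]) f t = \int[mu]_(t in `[(- 2 : R), 2]) g t.
Proof. by move=> fg; apply: eq_Rintegral => t _; exact: fg. Qed.

Let momentE p : semicircle_moment p = (2 * pi)^-1 * I p.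
Proof.
rewrite -RintegralZl//.
by apply: eq_Rintegral => t _; rewrite mulrCA.
Qed.

(* The derivative of [t ^+ p * (4 - t ^+ 2) ^ (3/2)], which vanishes at -2 and 2. *)
Let ibp (p : nat) : \int[mu]_(t in `[(- 2 : R), 2])
   (p%:R * t ^+ p.-1 * ((4 - t ^+ 2) * q t) - 3 * t ^+ p.+1 * q t) = 0.
Proof.
pose F (t : R) := t ^+ p * ((4 - t ^+ 2) * q t).
have cF : continuous F.
  move=> t; apply: cvgM; first exact: exprn_continuous.
  apply: cvgM; last exact: cq.
  by apply: cvgB; [exact: cvg_cst|exact: exprn_continuous].
have dF (t : R) : t \in `]-2, 2[ -> is_derive t 1 F
    (p%:R * t ^+ p.-1 * ((4 - t ^+ 2) * q t) - 3 * t ^+ p.+1 * q t).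
  rewrite in_itv/= => /andP[t1 t2].
  have q0 : 0 < 4 - t ^+ 2 by nra.
  have dq : is_derive t 1 (fun t : R => q t) ((2 * q t)^-1 * - (2 * t)).
    have := @is_derive1_comp _ Num.sqrt (fun t => 4 - t ^+ 2) t _ (- (2 * t))
      (is_derive1_sqrt q0).
    apply.
    by apply: is_derive_eq; rewrite /GRing.scale/=; ring.
  have qq : q t ^+ 2 = 4 - t ^+ 2 by rewrite sqr_sqrtr// ltW.
  have qn0 : q t != 0 by rewrite gt_eqF// sqrtr_gt0.
  have dp : is_derive t 1 (fun t : R => t ^+ p) (p%:R * t ^+ p.-1).
    have := @is_deriveX R R (@id R) p t 1 1 (is_derive_id _ _).
    by rewrite exprfctE /GRing.scale/= mulr1.
  have dr : is_derive t 1 (fun t : R => 4 - t ^+ 2) (- (2 * t)).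
    by apply: is_derive_eq; rewrite /GRing.scale/=; ring.
  apply: (is_derive_eq (is_deriveM dp (is_deriveM dr dq))).
  rewrite fctE /GRing.scale/=; move: (q t) qq qn0 => x xx x0; rewrite [t ^+ p.+1]exprS.
  by rewrite -xx; field.
have := @continuous_FTC2 R (fun t => p%:R * t ^+ p.-1 * ((4 - t ^+ 2) * q t) -
  3 * t ^+ p.+1 * q t) F (-2) 2.
rewrite /Rintegral => ->//.
- have q0 (x : R) : x ^+ 2 = 4 -> F x = 0.
    by move=> x2; rewrite /F x2 subrr mul0r mulr0.
  by rewrite (q0 2) ?(q0 (- 2)) -?EFinB /= ?subrr//; ring.
- by lra.
- apply: continuous_subspaceT => t; apply: cvgB.
    apply: cvgM; first by apply: cvgM; [exact: cvg_cst|exact: exprn_continuous].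
    apply: cvgM; last exact: cq.
    by apply: cvgB; [exact: cvg_cst|exact: exprn_continuous].
  apply: cvgM; last exact: cq.
  by apply: cvgM; [exact: cvg_cst|exact: exprn_continuous].
- split.
  + by move=> t /dF[].
  + by apply: cvg_at_right_filter; exact: cF.
  + by apply: cvg_at_left_filter; exact: cF.
- by move=> t /dF[? ?]; rewrite derive1E.
Qed.

Lemma semicircle_moment_odd1 : semicircle_moment 1 = 0.
Proof.
rewrite momentE; have := ibp 0.
rewrite (@eq_int _ (fun t : R => (- 3) * (t ^+ 1 * q t))); last first.
  by move=> t; ring.
rewrite RintegralZl//.
move=> /eqP; rewrite mulf_eq0 oppr_eq0 pnatr_eq0/= => /eqP I1.
have -> : I 1 = 0 by exact: I1.
by rewrite mulr0.
Qed.

(** The integrand of [ibp] at [p.+1] is [4 (p+1) t ^ p - (p+4) t ^ (p+2)] times the square root. *)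
Lemma semicircle_moment_rec p : (p.+4)%:R * semicircle_moment p.+2 =
  4 * p.+1%:R * semicircle_moment p.
Proof.
rewrite !momentE; have := ibp p.+1.
rewrite (@eq_int _ (fun t : R => (4 * p.+1%:R) * (t ^+ p * q t) -
   p.+4%:R * (t ^+ p.+2 * q t))); last first.
  move=> t /=; have -> : p.+4%:R = p.+1%:R + 3 :> R by rewrite -natrD addn3.
  rewrite [t ^+ p.+2]exprS [t ^+ p.+1]exprS.
  by move: (t ^+ p) (q t) (p.+1%:R) => x y z; ring.
rewrite RintegralB// !RintegralZl//.
move=> /eqP; rewrite subr_eq0 => /eqP E.
have E' : 4 * p.+1%:R * I p = p.+4%:R * I p.+2 by exact: E.
by rewrite mulrCA -E' mulrCA.
Qed.

End Semicircle.

(** The Catalan numbers interleaved with zeros. The convolution [S] obeys the same two-step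
    recurrence as the shifted sequence [M p.+2], because the sums weighted by the index reduce to
    [S] by the symmetry [q <-> p - q]. *)
Lemma catalan_convolution (F : numFieldType) (M : nat -> F) :
  M 0 = 1 -> M 1 = 0 ->
  (forall p, p.+4%:R * M p.+2 = 4 * p.+1%:R * M p) ->
  forall p, M p.+1 = \sum_(q < p) M q * M (p - q.+1)%N.
Proof.
move=> M0 M1 Mrec.
pose S p := \sum_(q < p.+1) M q * M (p - q)%N.
have symm p : 2 * (\sum_(q < p.+1) q%:R * (M q * M (p - q)%N)) = p%:R * S p.
  rewrite mulr2n mulrDl !mul1r {1}(reindex_inj rev_ord_inj) -big_split mulr_sumr /=.
  apply: eq_bigr => q _; rewrite subSS subKn ?leq_ord// (mulrC (M (p - q)%N)) -mulrDl.
  by rewrite -natrD subnK ?leq_ord.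
have Srec p : (p.+2.+4)%:R * S p.+2 = 4 * M p.+2 + 4 * p.+2%:R * S p.
  (* The weight [q + 2] is the one to which [Mrec] applies once the terms [q = 0, 1] are removed. *)
  have E : \sum_(q < p.+3) (q.+2)%:R * (M q * M (p.+2 - q)%N) =
      2 * M p.+2 + \sum_(q < p.+1) 4 * q.+1%:R * (M q * M (p - q)%N).
    rewrite 2!big_ord_recl /= M0 M1 subn0 mul0r mulr0 add0r mul1r; congr (_ + _).
    apply: eq_bigr => q _; rewrite /bump /= !add1n !subSS.
    by rewrite mulrA Mrec mulrA.
  have E1 : \sum_(q < p.+3) (q.+2)%:R * (M q * M (p.+2 - q)%N) =
      \sum_(q < p.+3) q%:R * (M q * M (p.+2 - q)%N) + 2 * S p.+2.
    rewrite mulr_sumr -big_split; apply: eq_bigr => q _ /=.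
    by rewrite -mulrDl -natrD addn2.
  have E2 : \sum_(q < p.+1) 4 * q.+1%:R * (M q * M (p - q)%N) =
      4 * \sum_(q < p.+1) q%:R * (M q * M (p - q)%N) + 4 * S p.
    rewrite !mulr_sumr -big_split; apply: eq_bigr => q _ /=.
    by rewrite -addn1 natrD; ring.
  have := symm p.+2; have := symm p; move: E; rewrite E1 E2.
  have -> : p.+2.+4%:R = p%:R + 6 :> F by rewrite -natrD; congr _%:R; lia.
  have -> : p.+2%:R = p%:R + 2 :> F by rewrite -natrD addn2.
  move: (\sum_(q < p.+1) _) (\sum_(q < p.+3) _) => A B EE A2 B2.
  have : 2 * (B + 2 * S p.+2) = 2 * (2 * M p.+2 + (4 * A + 4 * S p)) by rewrite EE.
  rewrite !mulrDr B2 !(mulrCA 2 4) A2 => EEE; apply/eqP; rewrite -subr_eq0.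
  move/eqP: EEE; rewrite -subr_eq0 => /eqP EEE; apply/eqP; rewrite -[RHS]EEE; ring.
have S_M p : S p = M p.+2.
  have [N] := ubnP p; elim: N p => // N IH [|[|p]] pN.
  - rewrite /S big_ord1 M0 mulr1; apply: (@mulfI _ 4%:R); first by rewrite pnatr_eq0.
    by rewrite Mrec M0 !mulr1.
  - have := Mrec 1; rewrite M1 mulr0 => /eqP; rewrite mulf_eq0 pnatr_eq0/= => /eqP ->.
    by rewrite /S 2!big_ord_recl big_ord0 /= M1 mul0r mulr0 !addr0.
  - apply: (@mulfI _ (p.+2.+4%:R)); first by rewrite pnatr_eq0.
    rewrite Srec IH; last by rewrite -ltnS (ltn_trans _ pN).
    rewrite Mrec -[p.+3]addn1 natrD; ring.
case=> [|p]; first by rewrite big_ord0 M1.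
by rewrite -S_M; apply: eq_bigr => q _; rewrite subSS.
Qed.

Lemma semicircular_schwinger_dyson (R : realType) (N : tracial_vna R) (I : eqType)
    (s : I -> N -> N) i p : semicircular (@vna_state R N) (s i) ->
  moment s (i :: nseq p i) =
  \sum_(q < p) moment s (nseq q i) * moment s (nseq (p - q.+1) i).
Proof.
move=> si.
have mE q : moment s (nseq q i) = ((semicircle_moment R q)%:C)%C.
  rewrite -si /moment; congr vna_state; apply/funext => u.
  by elim: q => //= q <-.
(* The total mass of the semicircle density is read off from the unit of the state instead of being
   integrated. *)
have M0 : semicircle_moment R 0 = 1.
  have := mE 0; rewrite /= moment_nil => E.
  by apply: complexI; rewrite -E rmorph1.
have -> : i :: nseq p i = nseq p.+1 i by [].
rewrite mE (@catalan_convolution R (semicircle_moment R))//.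
- by rewrite rmorph_sum; apply: eq_bigr => q _; rewrite !mE rmorphM.
- exact: semicircle_moment_odd1.
- exact: semicircle_moment_rec.
Qed.

(** * Gaussian integrals *)

Section GaussianIntegrals.
Variables (R : realType) (m s : R).
Hypothesis s0 : 0 < s.
Local Notation mu := (@lebesgue_measure R).
Local Notation z v := ((v - m) / s : R).

Lemma normal_pdf_expE (v : R) :
  normal_pdf m s v = normal_peak s * expR (- z v ^+ 2 / 2).
Proof.
rewrite normal_pdfE ?gt_eqF// /normal_fun; congr (_ * expR _).
by field; rewrite gt_eqF.
Qed.

Lemma normal_pdf_tilt (c v : R) : expR (c * z v) * normal_pdf m s v =
  expR (c ^+ 2 / 2) * normal_pdf (m + c * s) s v.
Proof.
rewrite !normal_pdfE ?gt_eqF// /normal_fun mulrCA [RHS]mulrCA -!expRD.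
by congr (_ * expR _); field; rewrite gt_eqF.
Qed.

Lemma integrable_expR_normal c :
  mu.-integrable [set: R] (EFin \o (fun v : R => expR (c * z v) * normal_pdf m s v)).
Proof.
rewrite (_ : _ \o _ = (fun v => (expR (c ^+ 2 / 2))%:E * (normal_pdf (m + c * s) s v)%:E)%E).
  by apply: integrableZl => //; exact: integrable_normal_pdf.
by apply/funext => v; rewrite /= normal_pdf_tilt EFinM.
Qed.

Lemma Rintegral_expR_normal c :
  \int[mu]_v (expR (c * z v) * normal_pdf m s v) = expR (c ^+ 2 / 2).
Proof.
rewrite (_ : (fun v => _) =
    (fun v : R => expR (c ^+ 2 / 2) * normal_pdf (m + c * s) s v)); last first.
  by apply/funext => v; rewrite normal_pdf_tilt.
rewrite RintegralZl//; last exact: integrable_normal_pdf.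
by rewrite /Rintegral integral_normal_pdf /= mulr1.
Qed.

Lemma normr_exp_le (p : nat) (x : R) :
  `|x| ^+ p <= p`!%:R * (expR x + expR (- x)).
Proof.
have pos (y : R) : 0 <= y -> y ^+ p <= p`!%:R * expR y.
  case: p => [|p] y0; first by rewrite fact0 mul1r expr0 -[leLHS]expR0 ler_expR.
  have := expR_ge1Dxn p y0; rewrite -ler_pdivrMl ?ltr0n ?fact_gt0//.
  by rewrite mulrC; apply: le_trans; rewrite lerDr.
have [x0|x0] := leP 0 x.
  by rewrite ger0_norm// (le_trans (pos _ x0))// ler_wpM2l// lerDl expR_ge0.
have nx : 0 <= - x by lra.
by rewrite ltr0_norm// (le_trans (pos _ nx))// ler_wpM2l// lerDr expR_ge0.
Qed.

Lemma continuous_pow_normal p : continuous (fun v : R => z v ^+ p * normal_pdf m s v).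
Proof.
move=> v; apply: cvgM; last by apply: continuous_normal_pdf; rewrite gt_eqF.
apply: (cvg_comp (fun v => z v) (fun x => x ^+ p)); last exact: exprn_continuous.
apply: cvgM; last exact: cvg_cst.
by apply: cvgB; [exact: cvg_id|exact: cvg_cst].
Qed.

Lemma integrable_pow_normal p :
  mu.-integrable [set: R] (EFin \o (fun v : R => z v ^+ p * normal_pdf m s v)).
Proof.
apply: (@le_integrable _ _ _ mu _ measurableT _ (fun v => (p`!%:R)%:E *
  ((expR (1 * z v) * normal_pdf m s v)%:E + (expR ((-1) * z v) * normal_pdf m s v)%:E))%E).
- apply/measurable_EFinP; apply: continuous_measurable_fun.
  exact: continuous_pow_normal.
- move=> v _ /=; rewrite lee_fin [leRHS]ger0_norm; last first.
    by rewrite mulr_ge0// addr_ge0// mulr_ge0 ?expR_ge0 ?normal_pdf_ge0.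
  rewrite normrM normrX (ger0_norm (normal_pdf_ge0 _ _ _)) -mulrDl [leRHS]mulrA.
  by rewrite ler_wpM2r ?normal_pdf_ge0// mul1r mulN1r normr_exp_le.
- apply: integrableZl => //; apply: integrableD => //; exact: integrable_expR_normal.
Qed.

Definition pow_normal_mean p : R := \int[mu]_v (z v ^+ p * normal_pdf m s v).

Let f p (v : R) : R := p%:R * (z v ^+ p.-1 * normal_pdf m s v) -
  z v ^+ p.+1 * normal_pdf m s v.
Let F p (v : R) : R := s * (z v ^+ p * normal_pdf m s v).

Let dF p (v : R) : is_derive v 1 (F p) (f p v).
Proof.
have dz : is_derive v 1 (fun v : R => z v) s^-1.
  by apply: is_derive_eq; rewrite /GRing.scale/=; ring.
have dzp : is_derive v 1 (fun v : R => z v ^+ p) (p%:R * z v ^+ p.-1 * s^-1).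
  by have := @is_deriveX R R (fun v : R => z v) p v 1 _ dz; rewrite exprfctE.
have dq : is_derive v 1 (fun v : R => - z v ^+ 2 / 2) (- z v / s).
  rewrite (_ : (fun v : R => _) = (- 2^-1) *: (fun v : R => z v ^+ 2)); last first.
    by apply/funext => u; rewrite fctE /GRing.scale/= mulNr mulNr mulrC.
  have dz2 := @is_deriveX R R (fun v : R => z v) 2 v 1 _ dz.
  rewrite exprfctE in dz2; apply: (is_derive_eq (is_deriveZ (- 2^-1) dz2)).
  by rewrite /GRing.scale/= expr1; field; rewrite gt_eqF.
have dn : is_derive v 1 (normal_pdf m s) (- z v / s * normal_pdf m s v).
  have -> : normal_pdf m s = (fun v : R => normal_peak s * expR (- z v ^+ 2 / 2)).
    by apply/funext => u; rewrite normal_pdf_expE.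
  have de := @is_derive1_comp _ expR (fun v : R => - z v ^+ 2 / 2) v _ _
    (is_derive_expR _) dq.
  have H := is_deriveZ (normal_peak s) de; apply: (is_derive_eq H).
  by rewrite /GRing.scale/=; ring.
have := is_deriveZ s (is_deriveM dzp dn).
move=> H; apply: (is_derive_eq H).
rewrite /f /GRing.scale/= exprS; field.
by rewrite gt_eqF.
Qed.

Let integrable_f p : mu.-integrable [set: R] (EFin \o f p).
Proof.
rewrite (_ : _ \o _ = (fun v => p%:R%:E * (z v ^+ p.-1 * normal_pdf m s v)%:E -
   (z v ^+ p.+1 * normal_pdf m s v)%:E)%E)//.
apply: integrableB => //; last exact: integrable_pow_normal.
by apply: integrableZl => //; exact: integrable_pow_normal.
Qed.

Let itv (n : nat) : set R := `[m - s * n.+1%:R, m + s * n.+1%:R].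

(** The integral is a difference of boundary values of [F p] at [z = n+1] and [z = - (n+1)]. One
    extra power of [n+1] gives the decay, from [x ^ (p+1) <= (p+1)! (exp x + exp (-x))] and
    [x - x ^ 2 / 2 <= 1/2]. *)
Let F_bound : forall p, exists K : R, forall n : nat,
  `|\int[mu]_(v in itv n) f p v| <= K * n.+1%:R^-1.
Proof.
move=> p; exists (2 * s * normal_peak s * (p.+1)`!%:R * (2 * expR (2^-1))) => n.
have n0 : 0 < n.+1%:R :> R by rewrite ltr0n.
have sn0 : 0 < s * n.+1%:R by rewrite mulr_gt0.
rewrite /itv /Rintegral (@continuous_FTC2 _ (f p) (F p)); last 4 first.
- by lra.
- apply: continuous_subspaceT => v; apply: cvgB; last exact: continuous_pow_normal.
  by apply: cvgM; [exact: cvg_cst|exact: continuous_pow_normal].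
- have cF : continuous (F p).
    by move=> v; apply: cvgM; [exact: cvg_cst|exact: continuous_pow_normal].
  split.
  + by move=> v _; have [] := dF p v.
  + by apply: cvg_at_right_filter; exact: cF.
  + by apply: cvg_at_left_filter; exact: cF.
- by move=> v _; rewrite derive1E; have [] := dF p v.
rewrite -EFinB /=.
have B (e : R) : `|e| = 1 -> `|F p (m + e * (s * n.+1%:R))| <=
    s * normal_peak s * (p.+1)`!%:R * (2 * expR (2^-1)) * n.+1%:R^-1.
  move=> e1; rewrite /F.
  have zE : z (m + e * (s * n.+1%:R)) = e * n.+1%:R by field; rewrite gt_eqF.
  rewrite normal_pdf_expE zE !normrM (gtr0_norm s0) -!mulrA; apply: (ler_wpM2l (ltW s0)).
  rewrite mulrCA (ger0_norm (normal_peak_ge0 _)); apply: (ler_wpM2l (normal_peak_ge0 _)).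
  rewrite normrX normrM e1 mul1r (gtr0_norm n0) (gtr0_norm (expR_gt0 _)).
  rewrite exprMn (_ : e ^+ 2 = 1) ?mul1r; last by rewrite -real_normK ?num_real// e1 expr1n.
  rewrite !mulrA ler_pdivlMr//.
  have -> : n.+1%:R ^+ p * expR (- n.+1%:R ^+ 2 / 2) * n.+1%:R =
     n.+1%:R ^+ p.+1 * expR (- n.+1%:R ^+ 2 / 2) :> R
    by rewrite [_ ^+ p.+1]exprSr; move: (_ ^+ p) (expR _) => *; ring.
  have := normr_exp_le p.+1 (n.+1%:R); rewrite (gtr0_norm n0) => H.
  apply: (le_trans (ler_wpM2r (expR_ge0 _) H)).
  rewrite -!mulrA ler_wpM2l// mulrDl mulrDl mul1r -!expRD lerD// ler_expR.
    by have := sqr_ge0 (n.+1%:R - 1 : R); nra.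
  by have := sqr_ge0 (n.+1%:R + 1 : R); nra.
have := B 1; rewrite normr1 mul1r => /(_ erefl) B1.
have := B (-1); rewrite normrN normr1 mulN1r => /(_ erefl) B2.
apply: (le_trans (ler_normB _ _)); apply: le_trans (lerD B1 B2) _.
move: (_`!%:R) (expR _) (n.+1%:R^-1) (normal_peak s) => a b c e.
by rewrite le_eqVlt; apply/orP; left; apply/eqP; ring.
Qed.

(** Integration by parts on the line: the integrals of the derivative [f p] over growing intervals
    converge to its full integral by domination, and to 0 by [F_bound]. *)
Lemma pow_normal_mean_rec p : pow_normal_mean p.+1 = p%:R * pow_normal_mean p.-1.
Proof.
have If : \int[mu]_v f p v = p%:R * pow_normal_mean p.-1 - pow_normal_mean p.+1.
  rewrite /f RintegralB//; last 2 first.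
  - rewrite (_ : _ \o _ = (fun v => p%:R%:E * (z v ^+ p.-1 * normal_pdf m s v)%:E)%E)//.
    by apply: integrableZl => //; exact: integrable_pow_normal.
  - exact: integrable_pow_normal.
  by rewrite RintegralZl//; exact: integrable_pow_normal.
apply/eqP; rewrite eq_sym -subr_eq0 -If; apply/eqP.
pose fn n := (EFin \o f p) \_ (itv n).
have /integrableP[mf _] := integrable_f p.
have cvg1 : (\int[mu]_v fn n v @[n --> \oo] --> \int[mu]_v (EFin \o f p) v)%E.
  apply: (@dominated_cvg _ _ _ mu setT measurableT fn (EFin \o f p)
    (fun v => `|(EFin \o f p) v|)%E).
  - move=> n; apply/(measurable_restrictT _ _).1; first exact: measurable_itv.
    exact: (measurable_funS measurableT _ mf).
  - move=> v _; apply: cvg_near_cst; near=> n.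
    rewrite /fn /patch mem_set// /itv/= in_itv/=.
    have nv : `|v - m| / s <= n.+1%:R.
      have : `|v - m| / s <= n%:R by near: n; exact: nbhs_infty_ger.
      by move=> /le_trans; apply; rewrite ler_nat.
    by move: nv; rewrite ler_pdivrMr// ler_norml => /andP[? ?]; lra.
  - by [].
  - exact: integrable_abse.
  - move=> n v _; rewrite /fn /patch; case: ifP => // _; rewrite abse0//.
have [K KP] := F_bound p.
have cvg2 : (\int[mu]_v fn n v @[n --> \oo] --> 0)%E.
  rewrite (_ : (fun n => _) = EFin \o (fun n => \int[mu]_(v in itv n) f p v)); last first.
    apply/funext => n; rewrite -integral_mkcond /= fineK//.
    have fi := @integrableS _ _ _ mu setT (itv n) (EFin \o f p) measurableT
      (measurable_itv _) (@subsetT _ _) (integrable_f p).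
    by apply: integrable_fin_num fi; exact: measurable_itv.
  apply: cvg_EFin; first by near=> n.
  apply/norm_cvg0P; apply: (@squeeze_cvgr _ _ _ _ (fun=> 0) (fun n => K * n.+1%:R^-1)).
  - by near=> n; rewrite KP andbT.
  - exact: cvg_cst.
  - rewrite -[X in _ --> X](mulr0 K); apply: cvgM; first exact: cvg_cst.
    exact: cvg_harmonic.
have : (\int[mu]_v (EFin \o f p) v = 0)%E.
  by apply: cvg_unique cvg1 cvg2.
by rewrite /Rintegral => ->.
Unshelve. all: by end_near. Qed.

Lemma pow_normal_meanE p : pow_normal_mean p = (gauss_moment p)%:R.
Proof.
have [N] := ubnP p; elim: N p => // N IH [|[|p]] pN.
- rewrite /pow_normal_mean (_ : (fun v => _) = normal_pdf m s).
    by rewrite /Rintegral integral_normal_pdf.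
  by apply/funext => v; rewrite expr0 mul1r.
- by rewrite pow_normal_mean_rec mul0r.
- by rewrite pow_normal_mean_rec /= IH ?natrM//; lia.
Qed.

End GaussianIntegrals.

(** * Iterated integrals compared with sums of tensors *)

Section Tensors.
Variable R : realType.
Local Notation mu := (@lebesgue_measure R).

(* The integral of a nonnegative function, measurable or not, is a supremum over
   the simple functions below it. *)
Lemma ge0_le_integralT (f g : R -> \bar R) :
  (forall x, (0 <= f x)%E) -> (forall x, (f x <= g x)%E) ->
  (\int[mu]_x f x <= \int[mu]_x g x)%E.
Proof.
move=> f0 fg; have g0 x : (0 <= g x)%E by exact: le_trans (f0 x) (fg x).
rewrite !ge0_integralTE//; apply: ereal_sup_le => _ [h hf <-].
by exists h => // x; exact: le_trans (hf x) (fg x).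
Qed.

Lemma lebesgue_tuple_ge0 d (S : set (d.-tuple R)) : (0 <= lebesgue_tuple S)%E.
Proof.
elim: d S => [|d IH] S /=; first by rewrite diracE; case: (_ \in _).
exact: integral_ge0.
Qed.

Variables (J : Type).
Implicit Types (s : seq J) (c : J -> R) (h : J -> nat -> R -> R).

Let rint (h : R -> R) : R := \int[mu]_x h x.

Let sum_integrable s c (h : J -> R -> R) :
  (forall j, mu.-integrable [set: R] (EFin \o h j)) ->
  mu.-integrable [set: R] (EFin \o (fun t => \sum_(j <- s) c j * h j t)).
Proof.
move=> hi; rewrite (_ : _ \o _ = (fun t => (\sum_(j <- s) (c j)%:E * (h j t)%:E)%E)).
  by apply: integrable_sum => // j _; exact: (integrableZl measurableT (c j) (hi j)).
by apply/funext => t /=; rewrite -sumEFin.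
Qed.

Let sum_rint s c (h : J -> R -> R) :
  (forall j, mu.-integrable [set: R] (EFin \o h j)) ->
  (\int[mu]_t (\sum_(j <- s) c j * h j t)%:E = (\sum_(j <- s) c j * rint (h j))%:E)%E.
Proof.
move=> hi; elim: s => [|j s IH].
  under eq_integral do rewrite big_nil.
  by rewrite integral0 big_nil.
under eq_integral do rewrite big_cons EFinD.
rewrite integralD//; last 2 first.
- exact: (integrableZl measurableT (c j) (hi j)).
- exact: sum_integrable.
rewrite IH big_cons EFinD; congr (_ + _)%E.
under eq_integral do rewrite EFinM.
rewrite integralZl//; last exact: hi.
by rewrite EFinM /rint /Rintegral fineK//; apply: integrable_fin_num; last exact: hi.
Qed.

Let tensorS d s c h (t : R) (v : d.-tuple R) :
  \sum_(j <- s) c j * \prod_(i < d.+1) h j i (tnth [tuple of t :: v] i) =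
  \sum_(j <- s) (c j * h j 0 t) * \prod_(i < d) h j i.+1 (tnth v i).
Proof.
apply: eq_bigr => j _; rewrite big_ord_recl mulrA tnth0; congr (_ * _).
by apply: eq_bigr => i _; rewrite tnthS.
Qed.

Let tensor_intS d s c h :
  \sum_(j <- s) (c j * \prod_(i < d) rint (h j i.+1)) * rint (h j 0) =
  \sum_(j <- s) c j * \prod_(i < d.+1) rint (h j i).
Proof. by apply: eq_bigr => j _; rewrite big_ord_recl -mulrA [X in _ * X]mulrC. Qed.


(** For a fixed first coordinate [t], the factor [h j 0 t] joins the coefficient; coefficients of
    any sign are allowed, so the induction hypothesis applies to the slice. *)
Lemma lebesgue_tuple_le d (S : set (d.-tuple R)) s c h :
  (forall j i, mu.-integrable [set: R] (EFin \o h j i)) ->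
  (forall v, \1_S v <= \sum_(j <- s) c j * \prod_(i < d) h j i (tnth v i)) ->
  (lebesgue_tuple S <= (\sum_(j <- s) c j * \prod_(i < d) \int[mu]_x h j i x)%:E)%E.
Proof.
elim: d S c h => [|d IH] S c h hi Sh /=.
  rewrite diracE lee_fin; apply: le_trans (Sh [tuple]) _.
  by apply/ler_sum => j _; rewrite !big_ord0.
rewrite -(tensor_intS d s c h) -(@sum_rint _ _ (fun j => h j 0)); last by move=> j; exact: hi.
apply: ge0_le_integralT => t; first exact: lebesgue_tuple_ge0.
apply: le_trans (IH _ (fun j => c j * h j 0 t) (fun j i => h j i.+1) _ _) _.
- by move=> j i; exact: hi.
- move=> v; rewrite -tensorS; apply: le_trans (Sh [tuple of t :: v]).
  by rewrite !indicE; case: (boolP (v \in _)) => // /[!inE] Sv; rewrite mem_set.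
- by rewrite lee_fin; apply/ler_sum => j _; rewrite mulrAC.
Qed.

Lemma lebesgue_tuple_ge d (S : set (d.-tuple R)) s c h :
  (forall j i, mu.-integrable [set: R] (EFin \o h j i)) ->
  (forall v, \sum_(j <- s) c j * \prod_(i < d) h j i (tnth v i) <= \1_S v) ->
  ((\sum_(j <- s) c j * \prod_(i < d) \int[mu]_x h j i x)%:E <= lebesgue_tuple S)%E.
Proof.
elim: d S c h => [|d IH] S c h hi Sh /=.
  rewrite diracE lee_fin; apply: le_trans (Sh [tuple]).
  by apply/ler_sum => j _; rewrite !big_ord0.
pose F t := \sum_(j <- s) (c j * \prod_(i < d) rint (h j i.+1)) * h j 0 t.
have h0i j : mu.-integrable [set: R] (EFin \o h j 0) by exact: hi.
rewrite -(tensor_intS d s c h) -(@sum_rint _ _ (fun j => h j 0))//.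
rewrite -/(F _) integralE.
(* [F] may be negative, while monotonicity without measurability is available for nonnegative
   functions; its positive part still lies below the volume of the slice. *)
apply: (@le_trans _ _ (\int[mu]_x (EFin \o F)^\+ x)%E).
  rewrite -[leRHS]sube0; apply: leeB => //.
  by apply: integral_ge0 => t _; exact: funeneg_ge0.
apply: ge0_le_integralT => t; first exact: funepos_ge0.
rewrite funeposE ge_max lebesgue_tuple_ge0 andbT.
apply: le_trans (IH _ (fun j => c j * h j 0 t) (fun j i => h j i.+1) _ _).
- by rewrite lee_fin; apply/ler_sum => j _; rewrite mulrAC.
- by move=> j i; exact: hi.
- move=> v; rewrite -tensorS; apply: le_trans (Sh [tuple of t :: v]) _.
  by rewrite !indicE; case: (boolP (_ \in S)) => // /[!inE] Sv; rewrite mem_set.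
Qed.

End Tensors.

(** * Norms of matrices *)

Section EuclideanNorm.
Variables (R : rcfType) (I : finType).
Implicit Types (a b : I -> R).

Definition enorm a : R := Num.sqrt (\sum_i a i ^+ 2).

Lemma sum_sqr_ge0 a : 0 <= \sum_i a i ^+ 2.
Proof. by apply: sumr_ge0 => i _; exact: sqr_ge0. Qed.

Lemma enorm_ge0 a : 0 <= enorm a.
Proof. exact: sqrtr_ge0. Qed.

Lemma enorm_sqr a : enorm a ^+ 2 = \sum_i a i ^+ 2.
Proof. by rewrite sqr_sqrtr// sum_sqr_ge0. Qed.

Lemma eq_enorm a b : a =1 b -> enorm a = enorm b.
Proof. by move=> ab; congr Num.sqrt; apply: eq_bigr => i _; rewrite ab. Qed.

Lemma cauchy_schwarz a b : \sum_i a i * b i <= enorm a * enorm b.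
Proof.
rewrite -sqrtrM ?sum_sqr_ge0//; set A := \sum_i a i ^+ 2; set B := \sum_i b i ^+ 2.
set S := \sum_i _; suff SAB : S ^+ 2 <= A * B.
  by rewrite (le_trans (ler_norm _))// -sqrtr_sqr ler_wsqrtr.
have A0 : 0 <= A by exact: sum_sqr_ge0.
have := A0; rewrite le_eqVlt => /predU1P[A0'|Agt0].
  have -> : S = 0; last by rewrite -A0' expr0n mul0r.
  apply: big1 => i _; have : a i ^+ 2 == 0.
    move/eqP: (esym A0'); rewrite psumr_eq0; last by move=> j _; exact: sqr_ge0.
    by move=> /allP/(_ i); rewrite mem_index_enum => /(_ isT).
  by rewrite sqrf_eq0 => /eqP ->; rewrite mul0r.
have : 0 <= \sum_i (A * b i - S * a i) ^+ 2 by apply: sumr_ge0 => i _; exact: sqr_ge0.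
have E (A' S' : R) : \sum_i (A' * b i - S' * a i) ^+ 2 =
    A' ^+ 2 * \sum_i b i ^+ 2 - 2 * A' * S' * \sum_i a i * b i + S' ^+ 2 * \sum_i a i ^+ 2.
  by rewrite !mulr_sumr -sumrB -big_split/=; apply: eq_bigr => i _; ring.
rewrite E -/A -/B -/S (_ : _ + _ = A * (A * B - S ^+ 2)); last by ring.
by rewrite pmulr_rge0// subr_ge0.
Qed.

Lemma enormD a b : enorm (fun i => a i + b i) <= enorm a + enorm b.
Proof.
rewrite -(@ler_pXn2r _ 2)// ?nnegrE ?addr_ge0 ?enorm_ge0//.
rewrite sqrrD !enorm_sqr (eq_bigr (fun i => a i ^+ 2 + a i * b i *+ 2 + b i ^+ 2)).
  rewrite 2!big_split/= lerD2r lerD2l sumrMnl lerMn2r orFb; exact: cauchy_schwarz.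
by move=> i _; rewrite sqrrD.
Qed.

Lemma enormZ c a : enorm (fun i => c * a i) = `|c| * enorm a.
Proof.
rewrite /enorm (eq_bigr (fun i => c ^+ 2 * a i ^+ 2)).
  by rewrite -mulr_sumr sqrtrM ?sqr_ge0// sqrtr_sqr.
by move=> i _; rewrite exprMn.
Qed.

Lemma enormN a : enorm (fun i => - a i) = enorm a.
Proof. by congr Num.sqrt; apply: eq_bigr => i _; rewrite sqrrN. Qed.

End EuclideanNorm.

Section ComplexVectors.
Variables (R : realType) (k : nat).
Implicit Types (u v w : 'cV[R[i]%C]_k) (x y : 'M[R[i]%C]_k).

(** Complex vectors are treated as real ones of twice the dimension; [vdot] is then the real part of
    the Hermitian product. *)
Definition rcoord v (p : 'I_k * bool) : R :=
  if p.2 then complex.Im (v p.1 0) else complex.Re (v p.1 0).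

Definition vdot u v : R := \sum_p rcoord u p * rcoord v p.

Lemma vec_normE v : vec_norm v = enorm (rcoord v).
Proof.
rewrite /vec_norm /enorm; congr Num.sqrt.
transitivity (\sum_i \sum_b rcoord v (i, b) ^+ 2).
  by apply: eq_bigr => i _; rewrite big_bool /= addrC.
by rewrite pair_bigA; apply: eq_bigr => -[].
Qed.

Lemma rcoordD u v p : rcoord (u + v) p = rcoord u p + rcoord v p.
Proof.
by rewrite /rcoord !mxE; case: p => i [] /=; case: (u i 0); case: (v i 0).
Qed.

Lemma rcoordB u v p : rcoord (u - v) p = rcoord u p - rcoord v p.
Proof.
by rewrite /rcoord !mxE; case: p => i [] /=; case: (u i 0); case: (v i 0).
Qed.

Lemma rcoordZ (c : R) u p : rcoord (c%:C%C *: u) p = c * rcoord u p.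
Proof.
rewrite /rcoord !mxE; case: p => i [] /=; case: (u i 0) => a b /=; ring.
Qed.

Lemma vec_norm_ge0 v : 0 <= vec_norm v.
Proof. exact: sqrtr_ge0. Qed.

Lemma vec_normD u v : vec_norm (u + v) <= vec_norm u + vec_norm v.
Proof. by rewrite !vec_normE (eq_enorm (rcoordD u v)) enormD. Qed.

Lemma vec_normZ (c : R) u : vec_norm (c%:C%C *: u) = `|c| * vec_norm u.
Proof. by rewrite !vec_normE (eq_enorm (rcoordZ c u)) enormZ. Qed.

Lemma vdot_le u v : vdot u v <= vec_norm u * vec_norm v.
Proof. by rewrite !vec_normE cauchy_schwarz. Qed.

Lemma vdotvv v : vdot v v = vec_norm v ^+ 2.
Proof.
by rewrite vec_normE enorm_sqr; apply: eq_bigr => p _; rewrite expr2.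
Qed.

Lemma vdotDr u v w : vdot u (v + w) = vdot u v + vdot u w.
Proof.
by rewrite -big_split; apply: eq_bigr => p _; rewrite rcoordD mulrDr.
Qed.

Lemma vdotDl u v w : vdot (u + v) w = vdot u w + vdot v w.
Proof.
by rewrite -big_split; apply: eq_bigr => p _; rewrite rcoordD mulrDl.
Qed.

Lemma vdotZr c u v : vdot u (c%:C%C *: v) = c * vdot u v.
Proof.
by rewrite mulr_sumr; apply: eq_bigr => p _; rewrite rcoordZ mulrCA.
Qed.

Lemma vdotZl c u v : vdot (c%:C%C *: u) v = c * vdot u v.
Proof.
by rewrite mulr_sumr; apply: eq_bigr => p _; rewrite rcoordZ mulrA.
Qed.

Definition frob x : R := enorm (fun p : 'I_k * 'I_k => Normc.normc (x p.1 p.2)).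

Lemma vdotE u v : vdot u v = complex.Re (\sum_i (u i 0)^* * v i 0)%C.
Proof.
rewrite (big_morph (@complex.Re R) (id1 := 0) (op1 := +%R))//; last by case=> ? ? [].
rewrite /vdot (eq_bigr (fun p => rcoord u (p.1, p.2) * rcoord v (p.1, p.2))).
  rewrite -(pair_bigA _ (fun i b => rcoord u (i, b) * rcoord v (i, b))) /=.
  apply: eq_bigr => i _; rewrite big_bool /rcoord /=.
  by case: (u i 0) => a b; case: (v i 0) => c d /=; ring.
by case.
Qed.

Lemma Re_le_normc (z : R[i]%C) : complex.Re z <= Normc.normc z.
Proof.
case: z => a b /=; rewrite (le_trans (ler_norm _))// -sqrtr_sqr ler_wsqrtr//.
by rewrite lerDl sqr_ge0.
Qed.

Lemma vdot_mulmx_le x u v : vdot u (x *m v) <= frob x * (vec_norm u * vec_norm v).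
Proof.
have nE w : vec_norm w = enorm (fun i => Normc.normc (w i 0)).
  congr Num.sqrt; apply: eq_bigr => i _; case: (w i 0) => a b /=.
  by rewrite sqr_sqrtr// addr_ge0 ?sqr_ge0.
rewrite vdotE.
have -> : \sum_i (u i 0)^*%C * (x *m v) i 0 =
    \sum_(p : 'I_k * 'I_k) (u p.1 0)^*%C * (x p.1 p.2 * v p.2 0).
  rewrite -(pair_bigA _ (fun i j => (u i 0)^*%C * (x i j * v j 0))) /=.
  by apply: eq_bigr => i _; rewrite mxE mulr_sumr.
rewrite (big_morph (@complex.Re R) (id1 := 0) (op1 := +%R))//; last by case=> ? ? [].
have nuv : enorm (fun p : 'I_k * 'I_k => Normc.normc (u p.1 0) * Normc.normc (v p.2 0)) =
    vec_norm u * vec_norm v.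
  rewrite !nE /enorm -sqrtrM ?sum_sqr_ge0//; congr Num.sqrt.
  rewrite big_distrlr/= pair_bigA/=.
  by apply: eq_bigr => p _; rewrite exprMn.
rewrite -nuv; apply: le_trans (cauchy_schwarz _ _); apply: ler_sum => p _.
apply: le_trans (Re_le_normc _) _.
rewrite !Normc.normcM mulrCA.
by case: (u p.1 0) => a b /=; rewrite sqrrN.
Qed.

Lemma vec_norm_mulmx_le x v : vec_norm (x *m v) <= frob x * vec_norm v.
Proof.
have := vdot_mulmx_le x (x *m v) v; rewrite vdotvv expr2 mulrCA.
have := vec_norm_ge0 (x *m v); rewrite le_eqVlt => /predU1P[<- _|n0].
  by rewrite mulr_ge0 ?vec_norm_ge0// enorm_ge0.
by rewrite ler_pM2l.
Qed.

Lemma vec_norm0 : vec_norm (0 : 'cV[R[i]%C]_k) = 0.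
Proof.
by rewrite /vec_norm big1 ?sqrtr0// => i _; rewrite mxE /= expr0n addr0.
Qed.

Lemma op_norm_le x r : 0 <= r -> (forall v, vec_norm v <= 1 -> vec_norm (x *m v) <= r) ->
  op_norm x <= r.
Proof.
move=> r0 xr; apply: ge_sup; first by exists (vec_norm (x *m 0)), 0 => //=; rewrite vec_norm0.
by move=> _ [v /= v1 <-]; exact: xr.
Qed.

Lemma has_sup_op_norm x :
  has_sup [set vec_norm (x *m v) | v in [set v | vec_norm v <= 1]].
Proof.
split; first by exists (vec_norm (x *m 0)), 0 => //=; rewrite vec_norm0.
exists (frob x) => _ [v /= v1 <-]; apply: le_trans (vec_norm_mulmx_le _ _) _.
by rewrite ler_piMr ?enorm_ge0.
Qed.

Lemma op_norm_ub x v : vec_norm v <= 1 -> vec_norm (x *m v) <= op_norm x.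
Proof. by move=> v1; apply: ub_le_sup; [case: (has_sup_op_norm x)|exists v]. Qed.

Lemma op_norm_ge0 x : 0 <= op_norm x.
Proof.
apply: le_trans (@op_norm_ub x 0 _); first exact: vec_norm_ge0.
by rewrite vec_norm0.
Qed.

Lemma op_norm_lin x y (c : R) : op_norm (x + c%:C%C *: y) <= op_norm x + `|c| * op_norm y.
Proof.
apply: op_norm_le => [|v v1].
  by rewrite addr_ge0 ?mulr_ge0 ?op_norm_ge0.
rewrite mulmxDl -scalemxAl (le_trans (vec_normD _ _))// vec_normZ lerD ?op_norm_ub//.
by rewrite ler_wpM2l ?op_norm_ub.
Qed.

(** Replacing both unit vectors by points of the net at distance at most 1/4 costs at most half of
    [op_norm x], which is finite and can be absorbed. *)
Lemma op_norm_net x (N : set 'cV[R[i]%C]_k) (T : R) : 0 <= T ->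
  (forall v, vec_norm v <= 1 -> exists2 v', N v' &
     vec_norm v' <= 1 /\ vec_norm (v - v') <= 4^-1) ->
  (forall u v, N u -> N v -> vdot u (x *m v) <= T) ->
  op_norm x <= 2 * T.
Proof.
move=> T0 net xT; suff H v : vec_norm v <= 1 -> vec_norm (x *m v) <= T + 2^-1 * op_norm x.
  have : op_norm x <= T + 2^-1 * op_norm x.
    by apply: op_norm_le => //; rewrite addr_ge0// mulr_ge0// op_norm_ge0.
  lra.
move=> v1; set y := x *m v; have := vec_norm_ge0 y; rewrite le_eqVlt => /predU1P[<-|y0].
  by rewrite addr_ge0// mulr_ge0// op_norm_ge0.
have [v' Nv' [v'1 vv']] := net v v1.
pose u := (vec_norm y)^-1%:C%C *: y.
have u1 : vec_norm u = 1 by rewrite vec_normZ ger0_norm ?invr_ge0 ?ltW// mulVf// gt_eqF.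
have [|u' Nu' [u'1 uu']] := net u; first by rewrite u1.
have -> : vec_norm y = vdot u y by rewrite vdotZl vdotvv expr2 mulKf// gt_eqF.
have -> : u = u' + (u - u') by rewrite addrC subrK.
have op4 w : vec_norm w <= 4^-1 -> vec_norm (x *m w) <= 4^-1 * op_norm x.
  move=> w4; have -> : w = (4^-1)%:C%C *: (4%:C%C *: w).
    by rewrite scalerA -rmorphM/= mulVf ?pnatr_eq0// scale1r.
  rewrite -scalemxAr vec_normZ ger0_norm// ler_wpM2l// op_norm_ub//.
  by rewrite vec_normZ ger0_norm//; lra.
rewrite vdotDl.
have B1 : vdot (u - u') y <= 4^-1 * op_norm x.
  apply: le_trans (vdot_le _ _) _; apply: ler_pM; rewrite ?vec_norm_ge0//.
  exact: op_norm_ub.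
have -> : vdot u' y = vdot u' (x *m v') + vdot u' (x *m (v - v')).
  by rewrite -vdotDr -mulmxDr addrC subrK.
have B2 : vdot u' (x *m (v - v')) <= 4^-1 * op_norm x.
  apply: le_trans (vdot_le _ _) _.
  by apply: le_trans (op4 _ vv'); rewrite ler_piMl// vec_norm_ge0.
have B3 := xT _ _ Nu' Nv'.
by move: B1 B2 B3; rewrite -/y; lra.
Qed.

End ComplexVectors.

Section HermitianMatrices.
Variables (R : realType) (I : finType) (k : nat).
Local Notation L := (I * 'I_k * 'I_k)%type.
Local Notation C := R[i]%C.
Implicit Types (t : L -> R) (x y : I -> 'M[C]_k).

Definition hmx t (m : I) : 'M[C]_k :=
  \matrix_(a, b) herm_entry (isqrt2 R) 'i%C (fun l => (t l)%:C%C) m a b.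

Let s2 : Num.sqrt 2 != 0 :> R.
Proof. by rewrite gt_eqF// sqrtr_gt0 ltr0n. Qed.

Lemma hmx_sa t m : selfadjoint_mx (hmx t m).
Proof.
move=> a b; rewrite !mxE /herm_entry /isqrt2; case: (eqVneq a b) => [->|ab].
  by rewrite /= oppr0.
case: (ltngtP a b) => [ab'|ab'|/val_inj E]; last first.
- by rewrite E eqxx in ab.
- by apply/eqP; rewrite eq_complex /=; apply/andP; split; apply/eqP; ring.
- by apply/eqP; rewrite eq_complex /=; apply/andP; split; apply/eqP; ring.
Qed.

Lemma hs_coord_hmx t l : hs_coord (hmx t) l = t l.
Proof.
case: l => [[m a] b] /=; rewrite !mxE /herm_entry /isqrt2.
case: (eqVneq a b) => [->|ab]; first by rewrite eqxx.
case: (ltngtP a b) => [ab'|ab'|/val_inj E]; last by rewrite E eqxx in ab.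
- by rewrite /=; field.
- by rewrite /=; field.
Qed.

Lemma hmx_hs_coord x m : (forall i, selfadjoint_mx (x i)) -> hmx (hs_coord x) m = x m.
Proof.
move=> xsa; apply/matrixP => a b; rewrite mxE /herm_entry /isqrt2 /=.
have im a' : complex.Im (x m a' a') = 0.
  by have := xsa m a' a'; case: (x m a' a') => u v [] vv /=; lra.
case: (eqVneq a b) => [->|ab].
  by rewrite eqxx; have := im b; case: (x m b b) => u v /= ->.
case: (ltngtP a b) => [ab'|ab'|/val_inj E]; last first.
- by rewrite E eqxx in ab.
- have := xsa m a b; case: (x m b a) => u v; case: (x m a b) => u' v' [-> ->].
  by apply/eqP; rewrite eq_complex /=; apply/andP; split; apply/eqP; field.
- have := xsa m a b; case: (x m b a) => u v; case: (x m a b) => u' v' [-> ->].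
  by apply/eqP; rewrite eq_complex /=; apply/andP; split; apply/eqP; field.
Qed.

Lemma hmxD t u m : hmx (fun l => t l + u l) m = hmx t m + hmx u m.
Proof.
apply/matrixP => a b; rewrite !mxE -herm_entryD; apply: eq_herm_entry => l.
by rewrite rmorphD.
Qed.

Lemma hmxZ (c : R) t m : hmx (fun l => c * t l) m = c%:C%C *: hmx t m.
Proof.
apply/matrixP => a b; rewrite !mxE -herm_entryZ; apply: eq_herm_entry => l.
by rewrite rmorphM.
Qed.

Lemma hs_coordB x y l : hs_coord (fun i => x i - y i) l = hs_coord x l - hs_coord y l.
Proof.
case: l => [[m a] b] /=; rewrite !mxE; case: ifP => _; last case: ifP => _.
- by case: (x m a a); case: (y m a a).
- by rewrite -mulrBr; case: (x m a b); case: (y m a b).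
- by rewrite -mulrBr; case: (x m a b); case: (y m a b).
Qed.

Lemma hs_normE x : (forall i, selfadjoint_mx (x i)) -> hs_norm x = enorm (hs_coord x).
Proof.
move=> xsa; rewrite /enorm hs_coordP// sqrtr_sqr ger0_norm//; exact: sqrtr_ge0.
Qed.

Lemma selfadjointB (x y : 'M[C]_k) : selfadjoint_mx x -> selfadjoint_mx y ->
  selfadjoint_mx (x - y).
Proof. by move=> xs ys a b; rewrite !mxE xs ys rmorphB. Qed.

Lemma selfadjoint_lin (x y : 'M[C]_k) (c : R) : selfadjoint_mx x -> selfadjoint_mx y ->
  selfadjoint_mx (x + c%:C%C *: y).
Proof.
move=> xs ys a b; rewrite !mxE xs ys rmorphD rmorphM; congr (_ + _ * _).
by apply/eqP; rewrite eq_complex /= oppr0 !eqxx.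
Qed.

Lemma rhoE x y : (forall i, selfadjoint_mx (x i)) -> (forall i, selfadjoint_mx (y i)) ->
  rho x y = (Num.sqrt k%:R)^-1 * enorm (fun l => hs_coord x l - hs_coord y l).
Proof.
move=> xs ys; rewrite /rho hs_normE; last by move=> i; exact: selfadjointB.
by congr (_ * _); apply: eq_enorm => l; rewrite hs_coordB.
Qed.

Lemma rho_sym x y : (forall i, selfadjoint_mx (x i)) -> (forall i, selfadjoint_mx (y i)) ->
  rho x y = rho y x.
Proof.
move=> xs ys; rewrite !rhoE//; congr (_ * _); rewrite -enormN.
by apply: eq_enorm => l; rewrite opprB.
Qed.

Lemma rho_triangle x y w : (forall i, selfadjoint_mx (x i)) ->
  (forall i, selfadjoint_mx (y i)) -> (forall i, selfadjoint_mx (w i)) ->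
  rho x w <= rho x y + rho y w.
Proof.
move=> xs ys ws; rewrite !rhoE// -mulrDr ler_wpM2l ?invr_ge0 ?sqrtr_ge0//.
apply: le_trans (enormD _ _); rewrite le_eqVlt; apply/orP; left; apply/eqP.
by apply: eq_enorm => l; rewrite addrA subrK.
Qed.

Lemma rho_xx x : (forall i, selfadjoint_mx (x i)) -> rho x x = 0.
Proof.
move=> xs; rewrite rhoE// /enorm big1 ?sqrtr0 ?mulr0// => l _.
by rewrite subrr expr0n.
Qed.

Lemma frob_hmx t m : frob (hmx t m) <= enorm t.
Proof.
rewrite /frob /enorm ler_wsqrtr//.
rewrite -(pair_bigA _ (fun a b => Normc.normc (hmx t m a b) ^+ 2)) /=.
have nE a b : Normc.normc (hmx t m a b) ^+ 2 =
    2^-1 * (t (m, a, b) ^+ 2 + t (m, b, a) ^+ 2).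
  have cc : (Num.sqrt 2)^-1 ^+ 2 = 2^-1 :> R by rewrite exprVn sqr_sqrtr.
  have normc2 (z : C) : Normc.normc z ^+ 2 = complex.Re z ^+ 2 + complex.Im z ^+ 2.
    by case: z => u v /=; rewrite sqr_sqrtr// addr_ge0 ?sqr_ge0.
  rewrite normc2 mxE /herm_entry /isqrt2; case: (eqVneq a b) => [->|_].
    by rewrite /= expr0n addr0; field.
  by case: ifP => _ /=; rewrite -cc; ring.
have -> : \sum_a \sum_b Normc.normc (hmx t m a b) ^+ 2 =
    \sum_(p : 'I_k * 'I_k) t (m, p.1, p.2) ^+ 2.
  under eq_bigr => a _ do under eq_bigr => b _ do rewrite nE.
  rewrite -(pair_bigA _ (fun a b => t (m, a, b) ^+ 2)) /=.
  have two : (2 : R) != 0 by rewrite pnatr_eq0.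
  apply: (mulfI two); rewrite [RHS]mulr_natl [RHS]mulr2n.
  rewrite [X in _ = X + _]exchange_big -big_split /= mulr_sumr.
  apply: eq_bigr => a _; rewrite mulr_sumr -big_split /=.
  by apply: eq_bigr => b _; field.
rewrite [leRHS](eq_bigr (fun l : L => t (l.1.1, l.1.2, l.2) ^+ 2)); last by case=> [[? ?] ?].
rewrite -(pair_bigA _ (fun p b => t (p.1, p.2, b) ^+ 2)) /=.
rewrite -(pair_bigA _ (fun i a => \sum_b t (i, a, b) ^+ 2)) /=.
rewrite (bigD1 m)//= -(pair_bigA _ (fun a b => t (m, a, b) ^+ 2)) /= lerDl.
by apply: sumr_ge0 => i _; apply: sumr_ge0 => a _; exact: sum_sqr_ge0.
Qed.

Lemma hmx_sum (J : Type) (s : seq J) (c : J -> R) (T : J -> L -> R) m :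
  hmx (fun l => \sum_(j <- s) c j * T j l) m = \sum_(j <- s) (c j)%:C%C *: hmx (T j) m.
Proof.
elim: s => [|j s IH].
  rewrite big_nil (_ : (fun l => _) = (fun l => 0 * (fun=> 0 : R) l)).
    by rewrite hmxZ scale0r.
  by apply/funext => l; rewrite big_nil mul0r.
rewrite big_cons -IH -hmxZ -hmxD; congr (hmx _ m).
by apply/funext => l; rewrite big_cons.
Qed.

(** For vectors of the unit ball this says that a matrix coefficient is a linear form of norm at
    most 1 in the coordinates, hence of variance at most 1 under the standard normal law. *)
Lemma vdot_hmx_linear (u v : 'cV[C]_k) m : exists A : L -> R,
  (forall t, vdot u (hmx t m *m v) = \sum_l A l * t l) /\
  \sum_l A l ^+ 2 <= (vec_norm u * vec_norm v) ^+ 2.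
Proof.
pose A l := vdot u (hmx (fun l' => (l == l')%:R) m *m v).
have AE t : vdot u (hmx t m *m v) = \sum_l A l * t l.
  have -> : hmx t m = \sum_l (t l)%:C%C *: hmx (fun l' => (l == l')%:R) m.
    rewrite -hmx_sum; congr (hmx _ m); apply/funext => l'.
    rewrite (bigD1 l')//= eqxx mulr1 big1 ?addr0// => l /negPf ->.
    by rewrite mulr0.
  rewrite mulmx_suml.
  have vdot0 : vdot u 0 = 0 by rewrite /vdot big1// => p _; rewrite /rcoord !mxE /= if_same mulr0.
  rewrite (big_morph (vdot u) (vdotDr u) vdot0); apply: eq_bigr => l _.
  by rewrite -scalemxAl vdotZr mulrC.
exists A; split => //.
rewrite -enorm_sqr ler_pXn2r ?nnegrE ?enorm_ge0 ?mulr_ge0 ?vec_norm_ge0//.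
(* Duality: the form evaluated at its own coefficient vector is the square of the norm to be
   bounded. *)
have := AE A; under eq_bigr do rewrite -expr2; rewrite -enorm_sqr => E.
have := enorm_ge0 A; rewrite le_eqVlt => /predU1P[<-|A0].
  by rewrite mulr_ge0 ?vec_norm_ge0.
have := vdot_mulmx_le (hmx A m) u v; rewrite E expr2.
have := frob_hmx A m; set F := frob _; set N := vec_norm u * vec_norm v => FA EA.
have N0 : 0 <= N by rewrite mulr_ge0 ?vec_norm_ge0.
by rewrite -(ler_pM2l A0); apply: le_trans EA _; rewrite ler_wpM2r.
Qed.

End HermitianMatrices.

(** * A finite net of the complex unit ball *)

Section Net.
Variables (R : realType) (k : nat).
Hypothesis k0 : (0 < k)%N.
(** With this mesh the squared rounding error over [2 k] real coordinates is at most
    [2 k h ^ 2 = 1/18 < (1/4) ^ 2], and multiples of [h] up to [1 / h = 6 sqrt k <= B] suffice. *)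
Let B := (6 * k)%N.
Let h : R := (6 * Num.sqrt k%:R)^-1.

Definition grid : finType := {ffun 'I_k * bool -> bool * 'I_B.+1}.

Let zval (e : bool * 'I_B.+1) : R := (-1) ^+ e.1 * (e.2 : nat)%:R.

Definition gridv (z : grid) : 'cV[R[i]%C]_k :=
  \col_i (Complex (h * zval (z (i, false))) (h * zval (z (i, true)))).

Let sk0 : 0 < Num.sqrt k%:R :> R. Proof. by rewrite sqrtr_gt0 ltr0n. Qed.

Let h0 : 0 < h. Proof. by rewrite invr_gt0 mulr_gt0. Qed.

Let hk : h ^+ 2 * (36 * k%:R) = 1.
Proof.
rewrite /h exprVn exprMn sqr_sqrtr ?ler0n//; have : k%:R != 0 :> R by rewrite pnatr_eq0 -lt0n.
by move=> kn; field.
Qed.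

Let rcoord_gridv z p : rcoord (gridv z) p = h * zval (z p).
Proof. by case: p => i [] /=; rewrite /rcoord mxE. Qed.

Let vec_norm_gridv z : vec_norm (gridv z) ^+ 2 = h ^+ 2 * \sum_p zval (z p) ^+ 2.
Proof.
rewrite vec_normE enorm_sqr mulr_sumr; apply: eq_bigr => p _.
by rewrite rcoord_gridv exprMn.
Qed.

Definition grid_ball : {set grid} := [set z | vec_norm (gridv z) <= 1].

(** Rounding is towards zero, so that the rounded vector stays in the unit ball. *)
Let round (a : R) : `|a| <= 1 -> exists e : bool * 'I_B.+1,
  `|h * zval e| <= `|a| /\ `|a - h * zval e| <= h.
Proof.
move=> a1; pose n := Num.truncn (`|a| / h).
have /andP[n1 n2] : n%:R <= `|a| / h < n.+1%:R.
  by apply: truncn_itv; rewrite divr_ge0// ltW.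
have nB : (n < B.+1)%N.
  rewrite ltnS -(ler_nat R) (le_trans n1)// ler_pdivrMr//.
  have : 1 <= B%:R * h.
    have -> : B%:R * h = Num.sqrt k%:R.
      rewrite /B /h natrM -{1}[k%:R]sqr_sqrtr ?ler0n//; field.
      by rewrite gt_eqF.
    have k1 : 1 <= k%:R :> R by rewrite ler1n.
    by rewrite -[leLHS]sqrtr1; exact: ler_wsqrtr.
  exact: le_trans.
exists ((a < 0), Ordinal nB).
have n1' : h * n%:R <= `|a| by rewrite mulrC -ler_pdivlMr.
have n2' : `|a| <= h * n%:R + h.
  by move: n2; rewrite ltr_pdivrMr// -addn1 natrD mulrDl mul1r (mulrC n%:R) => /ltW.
rewrite /zval /=; split.
  by rewrite normrM (gtr0_norm h0) normrM normrX normrN1 expr1n mul1r normr_nat.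
have [a0|a0] := ltP a 0.
  move: n1' n2'; rewrite ltr0_norm// expr1 mulN1r mulrN opprK => B1 B2.
  by rewrite ler_norml; apply/andP; split; lra.
move: n1' n2'; rewrite ger0_norm// expr0 mul1r => B1 B2.
by rewrite ler_norml; apply/andP; split; lra.
Qed.

Lemma gridP (v : 'cV[R[i]%C]_k) : vec_norm v <= 1 -> exists2 z, z \in grid_ball &
  vec_norm (v - gridv z) <= 4^-1.
Proof.
move=> v1.
have coord1 p : `|rcoord v p| <= 1.
  apply: le_trans v1; rewrite vec_normE -sqrtr_sqr ler_wsqrtr//.
  by rewrite (bigD1 p)//= lerDl sumr_ge0// => q _; exact: sqr_ge0.
have /choice[e eP] : forall p, exists e, `|h * zval e| <= `|rcoord v p| /\
    `|rcoord v p - h * zval e| <= h by move=> p; exact: round.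
exists [ffun p => e p].
  rewrite inE -(@ler_pXn2r _ 2)// ?nnegrE ?vec_norm_ge0// expr1n.
  apply: le_trans (_ : vec_norm v ^+ 2 <= 1); last first.
    by rewrite expr_le1// vec_norm_ge0.
  rewrite !vec_normE !enorm_sqr; apply: ler_sum => p _.
  rewrite rcoord_gridv ffunE -real_normK ?num_real// -[leRHS]real_normK ?num_real//.
  by rewrite ler_pXn2r ?nnegrE//; case: (eP p).
rewrite -(@ler_pXn2r _ 2)// ?nnegrE ?vec_norm_ge0// vec_normE enorm_sqr.
apply: (@le_trans _ _ (\sum_(p : 'I_k * bool) h ^+ 2)).
  apply: ler_sum => p _; rewrite rcoordB rcoord_gridv ffunE -real_normK ?num_real//.
  by rewrite ler_pXn2r ?nnegrE ?(ltW h0)//; case: (eP p).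
have -> : \sum_(p : 'I_k * bool) h ^+ 2 = h ^+ 2 * (k%:R * 2).
  by rewrite sumr_const card_prod card_ord card_bool -[LHS]mulr_natr natrM.
by move: hk; move: (h ^+ 2) (k%:R) => x y; lra.
Qed.

(** For integers, a squared norm at most [36 k] bounds the sum of the absolute values by [36 k]. So
    each point of the ball is counted by [2 ^ (36 k)] times the product of the weights
    [2 ^ - |z_p|], whose sum over the whole grid factors and is at most [4 ^ (2 k)]. *)
Lemma card_grid_ball : #|grid_ball|%:R <= 2 ^+ (40 * k) :> R.
Proof.
rewrite -sum1_card natr_sum.
pose f (e : bool * 'I_B.+1) : R := 2^-1 ^+ e.2.
apply: (@le_trans _ _ (\sum_(z : grid) 2 ^+ (36 * k) * \prod_p f (z p))).
  rewrite big_mkcond /=; apply: ler_sum => z _; case: ifP => [|_]; last first.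
    by rewrite mulr_ge0// prodr_ge0// => p _; rewrite exprn_ge0.
  rewrite inE => z1.
  have : vec_norm (gridv z) ^+ 2 <= 1 by rewrite expr_le1// vec_norm_ge0.
  rewrite vec_norm_gridv => zk1.
  have {zk1}zk : \sum_p zval (z p) ^+ 2 <= 36 * k%:R.
    by rewrite -(ler_pM2l (exprn_gt0 2 h0)) hk.
  have Sk : (\sum_p (z p).2 <= 36 * k)%N.
    rewrite -(ler_nat R) natrM natr_sum; apply: le_trans zk; apply: ler_sum => p _.
    rewrite /zval exprMn -exprM mulnC exprM sqrrN !expr1n mul1r -natrX ler_nat.
    by case: (nat_of_ord _) => // n; rewrite -mulnn leq_pmulr.
  rewrite /f -(expr_sum (2^-1 : R)) -[leLHS](@divff _ (2 ^+ (36 * k))); last first.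
    by rewrite expf_neq0// pnatr_eq0.
  by rewrite -exprVn ler_wpM2l ?exprn_ge0// ler_wiXn2l// ?invf_le1// ler1n.
rewrite -mulr_sumr -(bigA_distr_bigA (fun p e => f e)) prodr_const.
have sf : \sum_e f e <= 4.
  rewrite -(pair_bigA _ (fun (b : bool) (n : 'I_B.+1) => 2^-1 ^+ n)) /= big_bool /=.
  have gs n : \sum_(i < n) 2^-1 ^+ i = 2 - 2 * 2^-1 ^+ n :> R.
    elim: n => [|n IHn]; first by rewrite big_ord0 expr0 mulr1 subrr.
    by rewrite big_ord_recr /= IHn exprS; field.
  rewrite gs; have : 0 <= 2^-1 ^+ B.+1 :> R by rewrite exprn_ge0.
  lra.
rewrite card_prod card_ord card_bool.
apply: (@le_trans _ _ (2 ^+ (36 * k) * 4 ^+ (k * 2))).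
  rewrite ler_wpM2l ?exprn_ge0// lerXn2r ?nnegrE// sumr_ge0// => e _.
  by rewrite exprn_ge0.
rewrite (_ : 4 = 2 ^+ 2); last by rewrite expr2 -natrM.
by rewrite -exprM -exprD ler_weXn2l// ?ler1n//; lia.
Qed.

End Net.

(** * Volume and Gaussian means *)

Section GaussianMeans.
Variable R : realType.
Local Notation mu := (@lebesgue_measure R).

(* Quantifying over all normal laws, after standardization, avoids changes of
   variables. *)
Definition normal_mean (g : R -> R) (e : R) : Prop := forall m s : R, 0 < s ->
  mu.-integrable [set: R] (EFin \o (fun v : R => g ((v - m) / s) * normal_pdf m s v)) /\
  \int[mu]_v (g ((v - m) / s) * normal_pdf m s v) = e.

Lemma normal_mean_pow p : normal_mean (fun x => x ^+ p) (gauss_moment p)%:R.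
Proof.
move=> m s s0; split; first exact: integrable_pow_normal.
exact: pow_normal_meanE.
Qed.

Lemma normal_mean_expR c : normal_mean (fun x => expR (c * x)) (expR (c ^+ 2 / 2)).
Proof.
move=> m s s0; split; first exact: integrable_expR_normal.
exact: Rintegral_expR_normal.
Qed.

Section Mean.
Variable I : finType.

(* Means under the standard normal law of [R ^ I] are restricted to finite sums
   of tensors, so that only one-dimensional integrals occur. *)
Definition gauss_mean (q : (I -> R) -> R) (e : R) : Prop :=
  exists ts : seq (R * (I -> {h : (R -> R) * R | normal_mean h.1 h.2})),
    (forall z, q z = \sum_(t <- ts) t.1 * \prod_i (sval (t.2 i)).1 (z i)) /\
    e = \sum_(t <- ts) t.1 * \prod_i (sval (t.2 i)).2.

Lemma gauss_mean_ext q q' e : q =1 q' -> gauss_mean q e -> gauss_mean q' e.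
Proof. by move=> qq [ts [qE eE]]; exists ts; split => // z; rewrite -qq. Qed.

Lemma gauss_meanD q q' e e' : gauss_mean q e -> gauss_mean q' e' ->
  gauss_mean (fun z => q z + q' z) (e + e').
Proof.
move=> [ts [qE eE]] [ts' [qE' eE']]; exists (ts ++ ts').
by split=> [z|]; rewrite big_cat ?qE ?qE' ?eE ?eE'.
Qed.

Lemma gauss_meanZ a q e : gauss_mean q e -> gauss_mean (fun z => a * q z) (a * e).
Proof.
move=> [ts [qE eE]]; exists [seq (a * t.1, t.2) | t <- ts]; split=> [z|].
  by rewrite big_map qE mulr_sumr; apply: eq_bigr => t _; rewrite mulrA.
by rewrite big_map eE mulr_sumr; apply: eq_bigr => t _; rewrite mulrA.
Qed.

Lemma gauss_mean_prod (g : I -> R -> R) m : (forall i, normal_mean (g i) (m i)) ->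
  gauss_mean (fun z => \prod_i g i (z i)) (\prod_i m i).
Proof.
move=> gm; exists [:: (1, fun i =>
  exist (fun h : (R -> R) * R => normal_mean h.1 h.2) (g i, m i) (gm i))].
by split=> [z|]; rewrite big_seq1 mul1r.
Qed.

Lemma gauss_mean1 : gauss_mean (fun=> 1) 1.
Proof.
have := @gauss_mean_prod (fun _ x => x ^+ 0) (fun=> 1) (fun _ => normal_mean_pow 0).
by rewrite big1//; apply: gauss_mean_ext => z.
Qed.

Lemma gauss_mean_cst a : gauss_mean (fun=> a) a.
Proof.
by have := gauss_meanZ a gauss_mean1; rewrite mulr1.
Qed.

Lemma gauss_mean_sum (J : Type) (s : seq J) (q : J -> (I -> R) -> R) (e : J -> R) :
  (forall j, gauss_mean (q j) (e j)) ->
  gauss_mean (fun z => \sum_(j <- s) q j z) (\sum_(j <- s) e j).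
Proof.
move=> qe; elim: s => [|j s IH].
  rewrite big_nil; apply: (gauss_mean_ext _ (gauss_mean_cst 0)) => z.
  by rewrite big_nil.
rewrite big_cons; apply: (gauss_mean_ext _ (gauss_meanD (qe j) IH)) => z.
by rewrite big_cons.
Qed.

Lemma gauss_mean_expR (a : I -> R) :
  gauss_mean (fun z => expR (\sum_i a i * z i)) (expR ((\sum_i a i ^+ 2) / 2)).
Proof.
have := gauss_mean_prod (fun i => normal_mean_expR (a i)).
rewrite -expR_sum -mulr_suml; apply: gauss_mean_ext => z.
by rewrite expR_sum.
Qed.

End Mean.

(** Here the algebraic mean meets the integrals, monomial by monomial; at real points the real part
    acts on the coefficients only. *)
Lemma gauss_mean_poly d (ga : gauss_algebra R[i]%C d) (p : ga_ring ga) :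
  gauss_mean (fun z : 'I_d -> R => complex.Re (ga_eval ga (fun i => (z i)%:C%C) p))
    (complex.Re (ga_mean p)).
Proof.
have ReM (c : R[i]%C) (r : R) : complex.Re (c * r%:C%C) = complex.Re c * r.
  by case: c => a b /=; rewrite mulr0 subr0.
have ReS (J : Type) (s : seq J) (F : J -> R[i]%C) :
    complex.Re (\sum_(j <- s) F j) = \sum_(j <- s) complex.Re (F j).
  by rewrite (big_morph (@complex.Re R) (id1 := 0) (op1 := +%R))//; case=> ? ? [].
have [s [sE ->]] := ga_expand p.
have := @gauss_mean_sum 'I_d _ s
  (fun t z => complex.Re t.1 * \prod_l z l ^+ t.2 l)
  (fun t => complex.Re t.1 * \prod_l (gauss_moment (t.2 l))%:R).
move=> /(_ (fun t => gauss_meanZ _ (gauss_mean_prod (fun l => normal_mean_pow (t.2 l))))).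
rewrite ReS (eq_bigr (fun t => complex.Re (t.1 * \prod_l (gauss_moment (t.2 l))%:R))).
  apply: gauss_mean_ext => z; rewrite sE ReS; apply: eq_bigr => t _.
  rewrite -ReM rmorph_prod; congr complex.Re; congr (_ * _).
  by apply: eq_bigr => l _; rewrite rmorphXn.
move=> t _; rewrite -ReM rmorph_prod; congr complex.Re; congr (_ * _).
by apply: eq_bigr => l _; rewrite rmorph_nat.
Qed.

(** The test function is the sum of the [q j], recentered at [X j] and multiplied by the normal
    density divided by its peak. At each point at most one term is positive, and it is at most 1, so
    the sum lies below the indicator. *)
Lemma lebesgue_tuple_gauss_ge d (S : set (d.-tuple R)) N (X : 'I_N -> 'I_d -> R)
    (s : R) (q : 'I_N -> ('I_d -> R) -> R) (e : 'I_N -> R) : 0 < s ->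
  (forall j, gauss_mean (q j) (e j)) ->
  (forall j z, q j z <= 1) ->
  (forall j v, 0 < q j (fun i => (tnth v i - X j i) / s) -> S v) ->
  (forall j j' v, 0 < q j (fun i => (tnth v i - X j i) / s) ->
     0 < q j' (fun i => (tnth v i - X j' i) / s) -> j = j') ->
  (((\sum_j e j) * (normal_peak s)^-1 ^+ d)%:E <= lebesgue_tuple S)%E.
Proof.
move=> s0 qe q1 qS qq.
have /choice[ts tsP] := qe.
pose J := (R * ('I_d -> {h : (R -> R) * R | normal_mean h.1 h.2}) * 'I_N)%type.
(* Tensors are indexed by all natural numbers; beyond [d] any integrable default will do. *)
pose h (p : J) (i : nat) : R -> R := match insub i : option 'I_d with
  | Some i' => fun v => (sval (p.1.2 i')).1 ((v - X p.2 i') / s) * normal_pdf (X p.2 i') s v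
  | None => fun v => v ^+ 0 * normal_pdf 0 1 v end.
pose pk := normal_peak s.
have pk0 : 0 < pk by rewrite normal_peak_gt0// gt_eqF.
have hE (p : J) (i : 'I_d) : h p i = fun v =>
    (sval (p.1.2 i)).1 ((v - X p.2 i) / s) * normal_pdf (X p.2 i) s v.
  by rewrite /h valK.
have := @lebesgue_tuple_ge R J d S [seq (t, j) | j <- index_enum 'I_N, t <- ts j]
  (fun p => pk^-1 ^+ d * p.1.1) h.
rewrite !big_allpairs_dep /=.
have -> : \sum_j \sum_(t <- ts j) pk^-1 ^+ d * t.1 * \prod_(i < d) \int[mu]_x h (t, j) i x =
    (\sum_j e j) * pk^-1 ^+ d.
  rewrite mulr_suml; apply: eq_bigr => j _; have [_ ->] := tsP j.
  rewrite mulr_suml; apply: eq_bigr => t _.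
  have -> : \prod_(i < d) \int[mu]_x h (t, j) i x = \prod_(i < d) (sval (t.2 i)).2.
    apply: eq_bigr => i _; rewrite hE /=.
    by have [_ ->] := svalP (t.2 i) (X j i) s s0.
  by rewrite -mulrA mulrC.
apply=> [p i|v].
  rewrite /h; case: insubP => [i' _ _|_]; last first.
    have [+ _] := normal_mean_pow 0 0 (@ltr01 R).
    by under [X in EFin \o X]eq_fun do rewrite !expr0.
  by have [] := svalP (p.1.2 i') (X p.2 i') s s0.
rewrite big_allpairs_dep /=.
pose W j := \prod_(i < d) expR (- ((tnth v i - X j i) / s) ^+ 2 / 2).
have W01 j : 0 <= W j <= 1.
  rewrite prodr_ge0 /=; last by move=> i _; exact: expR_ge0.
  apply: prodr_ile1 => i; rewrite expR_ge0 /= -expR0 ler_expR mulNr oppr_le0.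
  by rewrite mulr_ge0 ?sqr_ge0.
have -> : \sum_j \sum_(t <- ts j) pk^-1 ^+ d * t.1 * \prod_(i < d) h (t, j) i (tnth v i) =
    \sum_j q j (fun i => (tnth v i - X j i) / s) * W j.
  apply: eq_bigr => j _; have [-> _] := tsP j; rewrite mulr_suml; apply: eq_bigr => t _.
  rewrite (mulrC _ t.1) -!mulrA; congr (_ * _).
  have -> : \prod_(i < d) h (t, j) i (tnth v i) = \prod_(i < d) (pk *
      ((sval (t.2 i)).1 ((tnth v i - X j i) / s) *
       expR (- ((tnth v i - X j i) / s) ^+ 2 / 2))).
    by apply: eq_bigr => i _; rewrite hE /= normal_pdf_expE// mulrCA.
  rewrite big_split prodr_const card_ord /= mulrA -exprMn mulVf ?gt_eqF//.
  by rewrite expr1n mul1r big_split.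
have [[j0 j0P]|] := pselect (exists j, 0 < q j (fun i => (tnth v i - X j i) / s)).
  rewrite indicE mem_set; last exact: qS j0P.
  rewrite (bigD1 j0)//= -[leRHS]addr0 lerD//.
    have /andP[W0 W1] := W01 j0.
    by rewrite mulr_ile1// ltW.
  apply: sumr_le0 => j jj0; rewrite mulr_le0_ge0//; last by case/andP: (W01 j).
  by rewrite leNgt; apply/negP => /qq/(_ j0P) jE; rewrite jE eqxx in jj0.
move=> /forallNP nq; apply: (@le_trans _ _ 0) => //.
apply: sumr_le0 => j _; rewrite mulr_le0_ge0//; last by case/andP: (W01 j).
by rewrite leNgt; apply/negP => /nq.
Qed.

Lemma lebesgue_tuple_gauss_le d (S : set (d.-tuple R)) N (X : 'I_N -> 'I_d -> R)
    (s A : R) : 0 < s -> 0 <= A ->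
  (forall v, S v -> exists j,
     1 <= A * expR (- (\sum_i ((tnth v i - X j i) / s) ^+ 2) / 2)) ->
  (lebesgue_tuple S <= (N%:R * A * (normal_peak s)^-1 ^+ d)%:E)%E.
Proof.
move=> s0 A0 SA; pose pk := normal_peak s.
have pk0 : 0 < pk by rewrite normal_peak_gt0// gt_eqF.
pose h (j : 'I_N) (i : nat) : R -> R := match insub i : option 'I_d with
  | Some i' => normal_pdf (X j i') s | None => normal_pdf 0 1 end.
have hE j (i : 'I_d) : h j i = normal_pdf (X j i) s by rewrite /h valK.
have := @lebesgue_tuple_le R 'I_N d S (index_enum 'I_N) (fun=> A * pk^-1 ^+ d) h.
under eq_bigr => j _.
  under eq_bigr => i _ do rewrite hE /Rintegral integral_normal_pdf /=.
  rewrite big1// mulr1; over.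
rewrite sumr_const card_ord -[_ *+ N]mulr_natl mulrA; apply=> [j i|v].
  by rewrite /h; case: insubP => *; exact: integrable_normal_pdf.
have E j : A * pk^-1 ^+ d * \prod_(i < d) h j i (tnth v i) =
    A * expR (- (\sum_i ((tnth v i - X j i) / s) ^+ 2) / 2).
  under eq_bigr => i _ do rewrite hE normal_pdf_expE//.
  rewrite big_split prodr_const card_ord /= -!mulrA; congr (_ * _).
  rewrite mulrA -exprMn mulVf ?gt_eqF// expr1n mul1r -expR_sum; congr expR.
  by rewrite mulNr mulr_suml -sumrN; apply: eq_bigr => i _; rewrite mulNr.
have nn j : 0 <= A * pk^-1 ^+ d * \prod_(i < d) h j i (tnth v i).
  by rewrite E mulr_ge0// expR_ge0.
rewrite indicE; case: (boolP (v \in S)) => [|_]; last exact: sumr_ge0.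
rewrite inE => /SA[j jP]; rewrite (bigD1 j)//= E.
by apply: le_trans jP _; rewrite lerDl sumr_ge0.
Qed.

End GaussianMeans.

(** * Upper bound for the volume of microstates *)

Section Volume.
Variables (R : realType) (I : finType) (k : nat).
Hypothesis k0 : (0 < k)%N.
Local Notation L := (I * 'I_k * 'I_k)%type.
Local Notation C := R[i]%C.
Local Notation coords x := [tuple hs_coord x (enum_val l) | l < #|{: L}|].

Let sk0 : 0 < Num.sqrt k%:R :> R. Proof. by rewrite sqrtr_gt0 ltr0n. Qed.

Lemma sum_coordsB (x y : I -> 'M[C]_k) (s : R) :
  (forall i, selfadjoint_mx (x i)) -> (forall i, selfadjoint_mx (y i)) ->
  \sum_(l < #|{: L}|) ((tnth (coords x) l - hs_coord y (enum_val l)) / s) ^+ 2 =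
  k%:R * (rho x y / s) ^+ 2.
Proof.
move=> xs ys; rewrite rhoE//.
under eq_bigr do rewrite tnth_mktuple.
rewrite -(big_enum_val (fun l => ((hs_coord x l - hs_coord y l) / s) ^+ 2)) /=.
under eq_bigr do rewrite exprMn.
rewrite -mulr_suml -[X in X * _]enorm_sqr !exprMn exprVn sqr_sqrtr ?sum_sqr_ge0//.
by rewrite exprVn sqr_sqrtr// !mulrA mulfV ?mul1r// gt_eqF// ltr0n.
Qed.

(** Chernoff bound: on a [rho]-ball of radius [D] the squared coordinate distance is at most
    [k D ^ 2], so the indicator lies below this exponential times a rescaled normal density. *)
Lemma vol_cover_le (S : set (I -> 'M[C]_k)) N (c : 'I_N -> I -> 'M[C]_k) (D s : R) :
  0 < s -> 0 <= D ->
  (forall j i, selfadjoint_mx (c j i)) ->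
  (forall x, S x -> (forall i, selfadjoint_mx (x i)) /\ exists j, rho x (c j) <= D) ->
  (vol S <= (N%:R * expR (k%:R * (D / s) ^+ 2 / 2) * (normal_peak s)^-1 ^+ #|{: L}|)%:E)%E.
Proof.
move=> s0 D0 cs SD; apply: (lebesgue_tuple_gauss_le (X := fun j l => hs_coord (c j) (enum_val l))) => //.
move=> _ [x Sx <-]; have [xs [j jD]] := SD x Sx; exists j.
rewrite sum_coordsB// -expRD -[leLHS]expR0 ler_expR -mulrDl mulr_ge0// subr_ge0.
have r0 : 0 <= rho x (c j) by rewrite mulr_ge0 ?invr_ge0 ?sqrtr_ge0.
by rewrite ler_wpM2l// ler_sqr ?nnegrE ?divr_ge0 ?(ltW s0)// ler_pM2r ?invr_gt0.
Qed.

Lemma rho_shift_le (x g : I -> 'M[C]_k) (e b : R) :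
  (forall i, complex.Re (ntrace (g i *m g i)) <= b) ->
  rho x (fun i => x i + e%:C%C *: g i) <= `|e| * Num.sqrt (#|I|%:R * b).
Proof.
move=> gb; rewrite /rho /hs_norm.
have -> : \sum_i k%:R * complex.Re (ntrace
     ((x i - (x i + e%:C%C *: g i)) *m (x i - (x i + e%:C%C *: g i)))) =
    k%:R * (e ^+ 2 * \sum_i complex.Re (ntrace (g i *m g i))).
  rewrite -mulr_sumr; congr *%R; rewrite mulr_sumr; apply: eq_bigr => i _.
  rewrite opprD addNKr mulNmx mulmxN opprK -scalemxAl -scalemxAr scalerA.
  rewrite /ntrace mxtraceZ mulrCA -rmorphM -expr2.
  by case: (_ * \tr _) => u v /=; rewrite mul0r subr0.
rewrite sqrtrM// mulrA mulVf ?gt_eqF// mul1r sqrtrM ?sqr_ge0// sqrtr_sqr.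
rewrite ler_wpM2l// ler_wsqrtr// (le_trans (ler_sum _ (fun i _ => gb i)))//.
by rewrite sumr_const mulr_natl.
Qed.

End Volume.

Section LinearChange.
Variables (R : realType) (N : tracial_vna R) (L : finType) (z : L -> N -> N).
Local Notation C := R[i]%C.
Local Notation tau := (@vna_state R N).
Hypothesis zM : forall l, vna_set (z l).
Variables (c : L -> R) (f : L -> L) (d : R).
Hypothesis cd : forall l, `|c l| <= d.

Lemma ntraceD k (x y : 'M[C]_k) : ntrace (x + y) = ntrace x + ntrace y.
Proof. by rewrite /ntrace mxtraceD mulrDr. Qed.

Lemma ntraceZ k a (x : 'M[C]_k) : ntrace (a *: x) = a * ntrace x.
Proof. by rewrite /ntrace mxtraceZ mulrCA. Qed.

Let z' l := z l + (c l)%:C%C *: z (f l).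

Let z'M l : vna_set (z' l).
Proof. by rewrite /z' addrC; exact: vna_lin. Qed.

Let normC (a : R) : `|a%:C%C| = `|a|%:C%C.
Proof. by rewrite normc_def /= expr0n addr0 sqrtr_sqr. Qed.

(** One substitution serves both directions, from [(a, s)] to [(a + e s, s)] and back: [f] sends the
    letter of [a_i] to that of [s_i], and [c] is [e] or [- e] there and 0 on [s]. *)
Lemma microstates_lin r m k (g : R) (x : L -> 'M[C]_k) : microstates tau z r m g x ->
  microstates tau z' (r * (1 + d)) m ((1 + d) ^+ m * g)
    (fun l => x l + (c l)%:C%C *: x (f l)).
Proof.
move=> [xs xr xm]; set x' := fun l => _.
have d0 (l : L) : 0 <= d by apply: le_trans (cd l).
split=> [l|l|w /andP[w0 wm]].
- exact: selfadjoint_lin.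
- apply: le_trans (op_norm_lin _ _ _) _; rewrite mulrDr mulr1 mulrC lerD//.
  by rewrite ler_pM// ?op_norm_ge0.
have g0 : 0 < g.
  case: w w0 wm => // l w _ wm; rewrite -ltcR.
  apply: le_lt_trans (normr_ge0 _) (xm [:: l] _).
  by rewrite (leq_trans _ wm).
(* [p] is the part of the word already expanded in the old letters; each new letter in [v]
   multiplies the error by at most [1 + d]. *)
have main p v : (0 < size p + size v <= m)%N ->
    `|ntrace ((\big[mulmx/1%:M]_(i <- p) x i) *m \big[mulmx/1%:M]_(i <- v) x' i) -
      tau (opw z p \o opw z' v)| < ((1 + d) ^+ size v * g)%:C%C.
  elim: v p => [|l v IH] p.
    rewrite addn0 => pm; rewrite big_nil mulmx1 expr0 mul1r; exact: xm.
  rewrite /= addnS => pm; rewrite big_cons.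
  have -> : opw z p \o opw z' (l :: v) =
      (c l)%:C%C *: (opw z (rcons p (f l)) \o opw z' v) + (opw z (rcons p l) \o opw z' v).
    rewrite -!cats1 !opw_cat; apply/funext => u.
    have [lp _] := vna_bounded (vna_opw zM p).
    transitivity (opw z p ((c l)%:C%C *: z (f l) (opw z' v u) + z l (opw z' v u))).
      by congr (opw z p _); rewrite [RHS]addrC.
    by rewrite lp.
  rewrite (state_linear (vna_stateP N)); try (apply: vna_comp; exact: vna_opw).
  have -> : (\big[mulmx/1%:M]_(i <- p) x i) *m (x' l *m \big[mulmx/1%:M]_(i <- v) x' i) =
    (c l)%:C%C *: ((\big[mulmx/1%:M]_(i <- rcons p (f l)) x i) *m \big[mulmx/1%:M]_(i <- v) x' i)
    + ((\big[mulmx/1%:M]_(i <- rcons p l) x i) *m \big[mulmx/1%:M]_(i <- v) x' i).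
    have rc q : \big[mulmx/1%:M]_(i <- rcons p q) x i = (\big[mulmx/1%:M]_(i <- p) x i) *m x q.
      elim: p {pm} => [|b p' IHp]; first by rewrite /= big_cons !big_nil mulmx1 mul1mx.
      by rewrite rcons_cons !big_cons IHp mulmxA.
    by rewrite !rc !mulmxA /x' mulmxDr mulmxDl -scalemxAr -scalemxAl addrC.
  rewrite ntraceD ntraceZ opprD addrACA -mulrBr.
  apply: le_lt_trans (ler_normD _ _) _.
  rewrite normrM normC exprS -mulrA mulrDl mul1r rmorphD [ltRHS]addrC.
  have p1 q : (0 < size (rcons p q) + size v <= m)%N by rewrite size_rcons; lia.
  apply: ler_ltD; last exact: IH.
  rewrite [leRHS]rmorphM; apply: ler_pM => //; first by rewrite -normC normr_ge0.
    by rewrite lecR.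
  by apply: ltW; exact: IH.
have := main [::] w; rewrite big_nil mul1mx add0n w0 wm => /(_ isT).
move=> /lt_le_trans; apply; rewrite lecR; apply: ler_wpM2r; first exact: ltW.
rewrite ler_weXn2l// lerDl.
by case: w w0 wm => // l *; exact: d0 l.
Qed.

End LinearChange.

Section LogVolume.
Variable R : realType.
Local Open Scope ereal_scope.

Lemma le_lne (x y : \bar R) : x <= y -> lne x <= lne y.
Proof.
move=> xy; have [x0|x0] := leP x 0; first by rewrite le0_lneNy// leNye.
by rewrite lee_lne// in_itv/= leey andbT ltW// (lt_le_trans x0).
Qed.

Lemma lne_mul_expR (x : \bar R) (b : R) : lne (x * (expR b)%:E) = lne x + b%:E.
Proof.
have [x0|x0] := leP x 0.
  by rewrite !le0_lneNy// mule_le0_ge0// lee_fin expR_ge0.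
rewrite lneM; try by rewrite in_itv/= leey ?x0 ?lte_fin ?expR_gt0.
by rewrite [X in _ + X]lne_EFin ?expR_gt0// expRK.
Qed.

(** The inverse peak is [sqrt (2 pi) e / sqrt k], raised to the dimension [n k ^ 2]; the term in
    [ln k] is the one compensated in [chi_Rmg]. *)
Lemma normal_peak_powE (n k : nat) (e : R) : (0 < e)%R -> (0 < k)%N ->
  ((normal_peak (e / Num.sqrt k%:R))^-1 ^+ #|{: 'I_n * 'I_k * 'I_k}| =
   expR (k%:R ^+ 2 * (n%:R * (ln e + ln (2 * pi) / 2) - n%:R / 2 * ln k%:R)))%R.
Proof.
move=> e0 k0; have k0' : (0 < k%:R :> R)%R by rewrite ltr0n.
rewrite /normal_peak invrK exprMn exprVn sqr_sqrtr ?ltW//.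
have a0 : (0 < e ^+ 2 / k%:R * pi *+ 2)%R.
  by rewrite pmulrn_lgt0// mulr_gt0 ?pi_gt0// divr_gt0// exprn_gt0.
rewrite !card_prod !card_ord; apply: (@ln_inj R); rewrite ?posrE ?expR_gt0//.
  by rewrite exprn_gt0// sqrtr_gt0.
rewrite expRK lnXn ?sqrtr_gt0//.
have -> : (ln (Num.sqrt (e ^+ 2 / k%:R * pi *+ 2)) = ln e + ln (2 * pi) / 2 - ln k%:R / 2)%R.
  have -> : (ln (Num.sqrt (e ^+ 2 / k%:R * pi *+ 2)) = ln (e ^+ 2 / k%:R * pi *+ 2) / 2)%R.
    move: (_ *+ 2)%R a0 => t t0.
    have : (ln (Num.sqrt t ^+ 2) = ln t)%R by rewrite sqr_sqrtr// ltW.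
    by rewrite lnXn ?sqrtr_gt0// => <-; field.
  have -> : (e ^+ 2 / k%:R * pi *+ 2 = (e ^+ 2 / k%:R) * (2 * pi))%R by ring.
  rewrite lnM ?posrE ?mulr_gt0 ?pi_gt0 ?invr_gt0 ?exprn_gt0//.
  by rewrite ln_div ?posrE ?exprn_gt0// lnXn// -mulr_natr; field.
by rewrite -[LHS]mulr_natl !natrM; field.
Qed.

End LogVolume.

Lemma semicircular_moment2 (R : realType) (N : tracial_vna R) (I : eqType)
    (s : I -> N -> N) i : semicircular (@vna_state R N) (s i) -> moment s [:: i; i] = 1.
Proof.
move=> si; have := @semicircular_schwinger_dyson R N I s i 1 si.
by rewrite /= => ->; rewrite big_ord1 /= !moment_nil mulr1.
Qed.

Lemma Re_ntrace_sqr_le (R : realType) (N : tracial_vna R) (I J : finType)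
    (b : J -> N -> N) (s : I -> N -> N) r m k g (x : J + I -> 'M[R[i]%C]_k) i :
  moment s [:: i; i] = 1 -> (1 < m)%N -> g <= 1 ->
  microstates (@vna_state R N) (join_tuple b s) r m g x ->
  complex.Re (ntrace (x (inr i) *m x (inr i))) <= 2.
Proof.
move=> s2 m1 g1 [_ _ xm].
have := xm [:: inr i; inr i]; rewrite /= big_cons big_cons big_nil mulmx1 => /(_ m1).
rewrite -[vna_state _]/(moment s [:: i; i]) s2.
move: (ntrace _) => w w1; have -> : w = (w - 1) + 1 by rewrite subrK.
case: (w - 1) w1 => u v; rewrite normc_def /= => /ltW; rewrite lecR => uv.
have := Re_le_normc (u +i* v)%C; rewrite /= => /le_trans/(_ uv); lra.
Qed.

Section UpperBound.
Variables (R : realType) (N : tracial_vna R) (n : nat) (a s : 'I_n -> N -> N).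
Local Notation C := R[i]%C.
Local Notation tau := (@vna_state R N).
Hypothesis aM : forall i, vna_set (a i).
Hypothesis sM : forall i, vna_set (s i).
Hypothesis s2 : forall i, moment s [:: i; i] = 1.
Variables (e : R) (e0 : 0 < e).
Let ae i := a i + e%:C%C *: s i.
(** The first term is the Chernoff exponent per [k ^ 2], the second comes from the peak of the
    normal density. *)
Let c1 : R := (1 + Num.sqrt (n%:R * 2)) ^+ 2 / 2 + n%:R * (ln (2 * pi) / 2).

Lemma microstatesW (J : finType) (c : J -> N -> N) r r' m m' k g g' (x : J -> 'M[C]_k) :
  r' <= r -> (m <= m')%N -> g' <= g ->
  microstates tau c r' m' g' x -> microstates tau c r m g x.
Proof.
move=> rr mm gg [xs xr xm]; split=> // [i|w /andP[w0 wm]].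
  exact: le_trans (xr i) rr.
apply: lt_le_trans (xm w _) _; last by rewrite lecR.
by rewrite w0 (leq_trans wm).
Qed.

Lemma microstates_proj (I J : finType) (c : I -> N -> N) (b : J -> N -> N) r m k g
    (x : I + J -> 'M[C]_k) : microstates tau (join_tuple c b) r m g x ->
  microstates tau c r m g (fun i => x (inl i)).
Proof.
move=> [xs xr xm]; split=> // w wm.
by have := xm (map inl w); rewrite size_map big_map -map_comp => /(_ wm).
Qed.

Let aeM i : vna_set (ae i).
Proof. by rewrite /ae addrC; apply: vna_lin. Qed.

Lemma rel_microstates_shift r m k g (x' : 'I_n -> 'M[C]_k) : (0 < k)%N -> (1 < m)%N -> g <= 1 ->
  rel_microstates tau ae s r m g x' ->
  exists2 y, microstates tau a (r * (1 + e)) m ((1 + e) ^+ m * g) y &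
    rho x' y <= e * Num.sqrt (n%:R * 2).
Proof.
move=> k0 m1 g1 [x xP <-]; have [xs _ xm] := xP.
pose c (l : 'I_n + 'I_n) : R := if l is inl _ then - e else 0.
pose f (l : 'I_n + 'I_n) : 'I_n + 'I_n := if l is inl i then inr i else l.
have ce l : `|c l| <= e by case: l => i /=; [rewrite normrN gtr0_norm|rewrite normr0 ltW].
have zM l : vna_set (join_tuple ae s l) by case: l.
have := microstates_lin zM f ce xP.
have -> : (fun l => join_tuple ae s l + (c l)%:C%C *: join_tuple ae s (f l)) = join_tuple a s.
  apply/funext => -[i|i] /=; last by rewrite scale0r addr0.
  by rewrite /ae rmorphN scaleNr addrK.
move=> /microstates_proj yP; exists (fun i => x (inl i) + (- e)%:C%C *: x (inr i)) => //.
have := @rho_shift_le R 'I_n k k0 (fun i => x (inl i)) (fun i => x (inr i)) (- e) 2.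
rewrite normrN gtr0_norm// card_ord; apply=> i.
exact: Re_ntrace_sqr_le (s2 i) m1 g1 xP.
Qed.

Lemma log_vol_le r m m' k g (g' : R) : (0 < k)%N -> (1 < m)%N -> g <= 1 ->
  (m' <= m)%N -> (1 + e) ^+ m * g <= g' ->
  ((k%:R ^- 2)%:E * lne (vol (@rel_microstates _ _ tau _ _ ae s r m k g)) +
    (n%:R / 2 * ln k%:R)%:E <=
  (k%:R ^- 2)%:E * lne (covering_number (@rho R _ k)
     (@microstates _ _ tau _ a (r * (1 + e))%R m' k g') e) +
    (n%:R * ln e + c1)%:E)%E.
Proof.
move=> k0 m1 g1 mm gg; set V := vol _; set Y := microstates _ _ _ _ _.
have k2 : (0 < k%:R ^- 2 :> R) by rewrite invr_gt0 exprn_gt0// ltr0n.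
have sk0 : 0 < Num.sqrt k%:R :> R by rewrite sqrtr_gt0 ltr0n.
pose X : R := n%:R * ln e + c1 - n%:R / 2 * ln k%:R.
suff H : (V <= covering_number (@rho R _ k) Y e * (expR (k%:R ^+ 2 * X))%:E)%E.
  have k2' : (0 <= (k%:R ^- 2)%:E :> \bar R)%E by rewrite lee_fin ltW.
  have := le_lne H; rewrite lne_mul_expR => /(lee_wpmul2l k2').
  rewrite muleDr ?fin_num_adde_defl// -EFinM mulrA mulVf ?mul1r; last first.
    by rewrite expf_neq0// pnatr_eq0 -lt0n.
  move=> H'.
  have := leeD2r (n%:R / 2 * ln k%:R)%:E H'.
  by rewrite -addeA -EFinD /X subrK.
rewrite -lee_pdivrMr ?expR_gt0//.
apply: le_ereal_inf_tmp => _ [M [x [xY xc]] <-]; rewrite lee_pdivrMr ?expR_gt0//.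
(* Radius [e] of the cover plus the shift [e sqrt (2 n)], where 2 bounds the normalized trace of the
   square of each microstate of [s i]. *)
have := @vol_cover_le R 'I_n k k0 (@rel_microstates _ _ tau _ _ ae s r m k g) M x
  (e * (1 + Num.sqrt (n%:R * 2))) (e / Num.sqrt k%:R).
rewrite divr_gt0// mulr_ge0 ?addr_ge0 ?(ltW e0)// => /(_ isT isT _ _)/le_trans; apply.
- by move=> j i; have [] := xY j.
- move=> x' x'P; have [y /(microstatesW (lexx _) mm gg) yY yr] :=
    rel_microstates_shift k0 m1 g1 x'P.
  have x's i : selfadjoint_mx (x' i) by case: x'P => z [zs _ _] <-.
  split=> //; have [j _ [_ jy]] := xc y yY; exists j.
  have ys i : selfadjoint_mx (y i) by case: yY.
  have xs i : selfadjoint_mx (x j i) by case: (xY j).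
  apply: le_trans (rho_triangle x's ys xs) _.
  rewrite (rho_sym ys xs) mulrDr mulr1 [leRHS]addrC.
  exact: lerD yr (ltW jy).
rewrite normal_peak_powE// -mulrA -expRD EFinM lee_fin ler_wpM2l// ler_expR.
rewrite le_eqVlt; apply/orP; left; apply/eqP.
have -> : e * (1 + Num.sqrt (n%:R * 2)) / (e / Num.sqrt k%:R) =
    (1 + Num.sqrt (n%:R * 2)) * Num.sqrt k%:R by field; rewrite !gt_eqF.
by rewrite exprMn sqr_sqrtr// /X /c1; field.
Qed.

End UpperBound.

(** * Lower bound for the volume of microstates *)

Section WordVariance.
Variables (R : realType) (X I : finType).
Local Notation C := R[i]%C.
Local Notation Lk k := (I * 'I_k * 'I_k)%type.

Definition wigner k (t : Lk k -> R) (i : I) : 'M[C]_k :=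
  (Num.sqrt k%:R)^-1%:C%C *: hmx t i.

Lemma mulmx_big_rcons (T : Type) k (y : T -> 'M[C]_k) w l :
  \big[mulmx/1%:M]_(j <- rcons w l) y j = (\big[mulmx/1%:M]_(j <- w) y j) *m y l.
Proof.
elim: w => [|b w IH]; first by rewrite /= big_cons !big_nil mulmx1 mul1mx.
by rewrite rcons_cons !big_cons IH mulmxA.
Qed.

Lemma ntrace_rev (T : Type) k (y : T -> 'M[C]_k) w : (forall j, selfadjoint_mx (y j)) ->
  ((ntrace (\big[mulmx/1%:M]_(j <- w) y j))^*)%C = ntrace (\big[mulmx/1%:M]_(j <- rev w) y j).
Proof.
move=> ys; rewrite /ntrace rmorphM fmorphV rmorph_nat; congr (_ * _).
rewrite -[RHS]mxtrace_tr -[LHS](trace_map_mx (@conjc R)); congr (\tr _).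
elim: w => [|b w IH]; first by rewrite !big_nil map_mx1 trmx1.
rewrite rev_cons mulmx_big_rcons big_cons map_mxM IH trmx_mul; congr (_ *m _).
by apply/matrixP => p q; rewrite !mxE; apply/esym; exact: ys.
Qed.

Lemma ga_eval_mixed_tr k (ga : gauss_algebra C #|{: Lk k}|) (x : X -> 'M[C]_k)
    (t : Lk k -> R) (w : seq (X + I)) :
  ga_eval ga (fun l => (t (enum_val l))%:C%C) (mixed_tr ga x w) =
  ntrace (\big[mulmx/1%:M]_(j <- w) join_tuple x (wigner t) j).
Proof.
rewrite /mixed_tr /wtr rmorphM ga_eval_const -trace_map_mx; congr (_ * \tr _).
elim: w => [|j w IH]; first by rewrite /wmx !big_nil map_mx1.
rewrite wmx_cons map_mxM IH big_cons; congr (_ *m _).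
apply/matrixP => a b; case: j => j; rewrite !mxE; first by rewrite ga_eval_const.
rewrite rmorphM ga_eval_const; congr (_ * _).
rewrite /herm_entry /gvar.
by do 2?case: ifP => _; rewrite ?rmorphM ?rmorphB ?rmorphD ?rmorphM ?ga_eval_const
  ?ga_eval_var ?enum_rankK.
Qed.

Variable phi : seq (X + I) -> C.
Hypothesis phi_cat : forall u v, phi (u ++ v) = phi (v ++ u).
Hypothesis phi_sd : forall m w,
  phi (inr m :: w) = \sum_(uv <- splits (inr m) w) phi uv.1 * phi uv.2.

(** A polynomial whose value is the squared modulus of the trace error: reversing a word of
    self-adjoint matrices conjugates its trace. *)
Definition word_dev k (ga : gauss_algebra C #|{: Lk k}|) (x : X -> 'M[C]_k) w : ga_ring ga :=
  (mixed_tr ga x w - ga_const ga (phi w)) *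
  (mixed_tr ga x (rev w) - ga_const ga ((phi w)^*)%C).

Lemma ga_eval_word_dev k (ga : gauss_algebra C #|{: Lk k}|) (x : X -> 'M[C]_k)
    (t : Lk k -> R) w : (forall i, selfadjoint_mx (x i)) ->
  ga_eval ga (fun l => (t (enum_val l))%:C%C) (word_dev ga x w) =
  `|ntrace (\big[mulmx/1%:M]_(j <- w) join_tuple x (wigner t) j) - phi w| ^+ 2.
Proof.
move=> xs; rewrite rmorphM !rmorphB !ga_eval_mixed_tr !ga_eval_const.
rewrite -ntrace_rev -?rmorphB -?sqr_normc//.
case=> i; first exact: xs.
move=> a b; have := @selfadjoint_lin R k 0 (hmx t i) (Num.sqrt k%:R)^-1.
rewrite add0r; apply=> [p q|]; last exact: hmx_sa.
by rewrite !mxE rmorph0.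
Qed.

(** The second moment involves the product of the traces of [w] and [rev w], hence trace control up
    to twice the length. *)
Lemma mean_word_dev w : exists2 K : R, 0 <= K &
  forall k (ga : gauss_algebra C #|{: Lk k}|) (x : X -> 'M[C]_k) (d : R),
    (0 < k)%N -> 0 <= d <= 1 -> trace_close phi x (2 * size w) d%:C%C ->
    complex.Re (ga_mean (word_dev ga x w)) <= K * (d + k%:R ^- 2).
Proof.
have [K1 K10 K1P] := mixed_mean_bound phi_cat phi_sd [:: w; rev w].
have [K2 K20 K2P] := mixed_mean_bound phi_cat phi_sd [:: w].
have [K3 K30 K3P] := mixed_mean_bound phi_cat phi_sd [:: rev w].
pose K : C := K1 + `|phi w| * K2 + `|phi w| * K3.
have K0 : 0 <= K by rewrite !addr_ge0 ?mulr_ge0.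
have KE : K = (complex.Re K)%:C%C.
  by move: K0; case: (K) => u v; rewrite lecE /= => /andP[/eqP -> _].
exists (complex.Re K); first by move: K0; rewrite KE lecR.
move=> k ga x d k0 d01 xc.
suff H : `|ga_mean (word_dev ga x w)| <= K * (d%:C%C + k%:R ^- 2).
  have -> : complex.Re K * (d + k%:R ^- 2) = complex.Re (K * (d%:C%C + k%:R ^- 2)).
    rewrite KE.
    have -> : k%:R ^- 2 = (k%:R ^- 2 : R)%:C%C :> C by rewrite fmorphV rmorphXn rmorph_nat.
    by rewrite -rmorphD -rmorphM.
  move: H; case: (K * _) => u v; rewrite normc_def lecE /= => /andP[_ uP].
  by apply: le_trans (Re_le_normc _) _; move: uP; case: (ga_mean _).
have d01C : (0 : C) <= d%:C%C <= (1 : C).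
  by case/andP: d01 => d0 d1; rewrite !lecE /= !eqxx d0.
have E1 := K1P k ga x _ k0 d01C; have E2 := K2P k ga x _ k0 d01C.
have E3 := K3P k ga x _ k0 d01C.
move: E1 E2 E3; rewrite !big_cons !big_nil size_rev !addn0 !mulr1 addnn -mul2n => E1 E2 E3.
have {}E1 := E1 xc; have wle : (size w <= 2 * size w)%N by rewrite leq_pmull.
have {}E2 := E2 (trace_closeW wle xc); have {}E3 := E3 (trace_closeW wle xc).
(* The limits subtracted in the three brackets add up to the constant term [phi w] times its
   conjugate. *)
have -> : ga_mean (word_dev ga x w) =
    (mixed_mean ga x [:: w; rev w] - phi w * phi (rev w)) +
    (- (phi w)^*%C) * (mixed_mean ga x [:: w] - phi w) +
    (- phi w) * (mixed_mean ga x [:: rev w] - phi (rev w)).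
  rewrite /word_dev /mixed_mean !big_cons !big_nil !mulr1.
  move: (mixed_tr ga x w) (mixed_tr ga x (rev w)) (phi w) => W W' c.
  have -> : (W - ga_const ga c) * (W' - ga_const ga (c^*)%C) =
      W * W' + ga_const ga (- (c^*)%C) * W + ga_const ga (- c) * W' +
      ga_const ga (c * (c^*)%C) * 1 by rewrite rmorphM !rmorphN; ring.
  by rewrite !ga_meanD !ga_meanZ ga_mean1; ring.
apply: le_trans (ler_normD _ _) _; rewrite mulrDl lerD//.
  apply: le_trans (ler_normD _ _) _; rewrite mulrDl lerD//.
  by rewrite normrM normrN norm_conjC -mulrA ler_wpM2l.
by rewrite normrM normrN -mulrA ler_wpM2l.
Qed.
End WordVariance.

(** * Exponential control of the operator norm *)

Section NetPenalty.
Variables (R : realType) (I : finType) (k : nat).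
Hypothesis k0 : (0 < k)%N.
Local Notation L := (I * 'I_k * 'I_k)%type.
Local Notation C := R[i]%C.

Definition net_index : {set I * grid k * grid k} :=
  finset.setX (finset.setX (finset.setTfor I) (grid_ball R k)) (grid_ball R k).

(* Exponential moments of the matrix coefficients along a net of the unit ball:
   they dominate the indicator of the tuples of large operator norm. *)
Definition net_penalty (T : R) (t : L -> R) : R := \sum_(p <- enum net_index)
  expR (k%:R * T * (vdot (gridv R p.1.2) (wigner t p.1.1 *m gridv R p.2) - T)).

Lemma net_penalty_ge0 T t : 0 <= net_penalty T t.
Proof. by apply: sumr_ge0 => p _; exact: expR_ge0. Qed.

(** A single coefficient above [T] would already contribute a term larger than 1. *)
Lemma net_penalty_op_norm T t i : 0 < T -> net_penalty T t <= 1 ->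
  op_norm (wigner t i) <= 2 * T.
Proof.
move=> T0 p1.
apply: (op_norm_net (N := [set gridv R z | z in [set z | z \in grid_ball R k]])).
- exact: ltW.
- move=> v /(gridP k0)[z zB vz]; exists (gridv R z); first by exists z.
  by split=> //; move: zB; rewrite inE.
- move=> _ _ [u uB <-] [v vB <-]; rewrite leNgt; apply/negP => Tuv.
  move: p1; rewrite leNgt => /negP; apply.
  have iuv : (i, u, v) \in enum net_index.
    by rewrite mem_enum !finset.in_setX finset.in_setT /=; apply/andP.
  rewrite /net_penalty (perm_big _ (perm_to_rem iuv)) big_cons /=.
  apply: ltr_wpDr; first by apply: sumr_ge0 => p _; exact: expR_ge0.
  by rewrite -[ltLHS]expR0 ltr_expR !mulr_gt0 ?ltr0n ?subr_gt0.
Qed.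

(** Each term has mean at most [exp (- k T ^ 2 / 2)]; for each [i] there are at most
    [2 ^ (80 k) <= exp (80 k)] pairs of net points. *)
Lemma gauss_mean_net_penalty T : exists2 e,
  gauss_mean (fun z : 'I_#|{: L}| -> R => net_penalty T (fun l => z (enum_rank l))) e &
  e <= #|I|%:R * expR (k%:R * (80 - T ^+ 2 / 2)).
Proof.
have k0' : (0 : R) < k%:R by rewrite ltr0n.
have H (p : I * grid k * grid k) : exists e, p \in net_index ->
    gauss_mean (fun z : 'I_#|{: L}| -> R => expR (k%:R * T *
       (vdot (gridv R p.1.2) (wigner (fun l => z (enum_rank l)) p.1.1 *m gridv R p.2) - T))) e /\
    e <= expR (- k%:R * (T ^+ 2 / 2)).
  have [A [AE A2]] := vdot_hmx_linear (gridv R p.1.2) (gridv R p.2) p.1.1.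
  (* Apart from the factor [exp (- k T ^ 2)], the term is the exponential of a centered normal
     variable of variance at most [c ^ 2 = k T ^ 2]. *)
  pose c := k%:R * T * (Num.sqrt k%:R)^-1.
  exists (expR (- (k%:R * T * T)) *
          expR ((\sum_(l < #|{: L}|) (c * A (enum_val l)) ^+ 2) / 2)).
  rewrite !inE /= => /andP[u1 v1]; split.
    apply: gauss_mean_ext (gauss_meanZ _ (gauss_mean_expR _)) => z.
    rewrite -expRD; congr expR; rewrite -scalemxAl vdotZr AE mulrBr mulrA -/c addrC.
    congr (_ - _); rewrite mulr_sumr (reindex (@enum_rank {: L})) /=; last first.
      by apply: onW_bij; exact: enum_rank_bij.
    by apply: eq_bigr => l _; rewrite enum_rankK mulrA.
  rewrite -expRD ler_expR.
  have -> : \sum_(l < #|{: L}|) (c * A (enum_val l)) ^+ 2 = c ^+ 2 * \sum_l A l ^+ 2.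
    rewrite mulr_sumr (reindex (@enum_rank {: L})) /=; last first.
      by apply: onW_bij; exact: enum_rank_bij.
    by apply: eq_bigr => l _; rewrite enum_rankK exprMn.
  have A1 : \sum_l A l ^+ 2 <= 1.
    by apply: le_trans A2 _; rewrite exprn_ile1 ?mulr_ge0 ?mulr_ile1 ?vec_norm_ge0.
  have cE : c ^+ 2 = k%:R * T ^+ 2.
    by rewrite /c !exprMn exprVn sqr_sqrtr ?ltW//; field; rewrite gt_eqF.
  have : c ^+ 2 * \sum_l A l ^+ 2 <= c ^+ 2 by rewrite ler_piMr ?sqr_ge0.
  rewrite cE => h; nra.
have /choice[e eP] := H.
exists (\sum_(p <- enum net_index) e p).
  (* [gauss_mean_sum] wants a mean at every index; outside the net the constant [e p] is
     inserted. *)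
  apply: gauss_mean_ext (gauss_mean_sum (enum net_index)
    (q := fun p z => if p \in net_index then expR (k%:R * T *
       (vdot (gridv R p.1.2) (wigner (fun l => z (enum_rank l)) p.1.1 *m gridv R p.2) - T))
       else e p) _).
    move=> z; rewrite /net_penalty; apply: eq_big_seq => p; rewrite mem_enum => pn.
    by rewrite pn.
  move=> p /=; have [pn|pn] := boolP (p \in net_index); first by have [] := eP p pn.
  exact: gauss_mean_cst.
apply: (@le_trans _ _ (\sum_(p <- enum net_index) expR (- k%:R * (T ^+ 2 / 2)))).
  by rewrite !big_enum; apply: ler_sum => p pn; have [] := eP p pn.
have -> : expR (k%:R * (80 - T ^+ 2 / 2)) = expR (k%:R * 80) * expR (- k%:R * (T ^+ 2 / 2)).
  by rewrite -expRD; congr expR; ring.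
rewrite big_enum sumr_const -[leLHS]mulr_natl mulrA; apply: ler_wpM2r.
  exact: expR_ge0.
rewrite !cardsX cardsT !natrM -mulrA ler_wpM2l//.
have two : (2 : R) <= expR 1 by apply: le_trans (expR_ge1Dx _).
have g2 : #|grid_ball R k|%:R <= expR (k%:R * 40) :> R.
  apply: le_trans (card_grid_ball R k0) _.
  have -> : k%:R * 40 = (40 * k)%:R * 1 :> R by rewrite mulr1 natrM mulrC.
  by rewrite expRM_natl lerXn2r// nnegrE ?expR_ge0.
apply: le_trans (ler_pM _ _ g2 g2) _; rewrite ?ler0n//.
by rewrite -expRD ler_expR; lra.
Qed.

End NetPenalty.

Fixpoint words (L : finType) (m : nat) : seq (seq L) :=
  if m is m'.+1 then [::] :: [seq l :: w | l <- enum L, w <- words L m'] else [:: [::]].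

Lemma mem_words (L : finType) m (w : seq L) : (w \in words L m) = (size w <= m)%N.
Proof.
elim: m w => [|m IH] [|l w] //=.
rewrite inE /=; apply/allpairsP/idP => [[[l' w'] /= [_ w'm [_ ->]]]|wm].
  by rewrite ltnS -IH.
by exists (l, w); rewrite /= mem_enum IH.
Qed.

(** * Gaussian partners of a microstate *)

Section Density.
Variables (R : realType) (N : tracial_vna R) (n : nat) (a s : 'I_n -> N -> N).
Local Notation C := R[i]%C.
Local Notation tau := (@vna_state R N).
Local Notation Lk k := ('I_n * 'I_k * 'I_k)%type.
Hypothesis aM : forall i, vna_set (a i).
Hypothesis free_as : free_semicircular_family a s.
Let z := join_tuple a s.

Let sM i : vna_set (s i).
Proof. by case: free_as => sM _ _ _; have [] := sM i. Qed.

Let zM l : vna_set (z l).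
Proof. by case: l. Qed.

Let sd m w : moment z (inr m :: w) = \sum_(uv <- splits (inr m) w) moment z uv.1 * moment z uv.2.
Proof.
apply: free_family_schwinger_dyson => // i p; apply: semicircular_schwinger_dyson.
by case: free_as.
Qed.

Lemma mean_word_dev_sum (ws : seq (seq ('I_n + 'I_n))) m :
  {in ws, forall w, size w <= m}%N -> exists2 K : R, 0 <= K &
  forall k (ga : gauss_algebra C #|{: Lk k}|) (x : 'I_n -> 'M[C]_k) (d : R),
    (0 < k)%N -> 0 <= d <= 1 -> trace_close (moment z) x (2 * m) d%:C%C ->
    \sum_(w <- ws) complex.Re (ga_mean (word_dev (moment z) ga x w)) <= K * (d + k%:R ^- 2).
Proof.
elim: ws => [|w ws IH] wsm.
  by exists 0 => // *; rewrite big_nil mul0r.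
have [K K0 KP] := IH (fun w' w'ws => wsm w' (mem_behead (s := w :: ws) w'ws)).
have [K' K'0 K'P] := mean_word_dev (moment_cat zM) sd w.
exists (K' + K); first exact: addr_ge0.
move=> k ga x d k0 d01 xc; rewrite big_cons mulrDl lerD ?KP//.
apply: K'P => //; apply: trace_closeW xc; rewrite leq_mul2l /=.
by apply: wsm; rewrite mem_head.
Qed.

Lemma microstates_trace_close r m k d (x : 'I_n -> 'M[C]_k) : (0 < k)%N -> 0 <= d ->
  microstates tau a r m d x -> trace_close (moment z) x m d%:C%C.
Proof.
move=> k0 d0 [_ _ xm] [|i u] um.
  rewrite /= moment_nil big_nil /ntrace mxtrace1 mulVf ?pnatr_eq0 -?lt0n//.
  by rewrite subrr normr0 lecR.
have -> : moment z (map inl (i :: u)) = tau (op_prod (map a (i :: u))).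
  by rewrite /moment /opw -map_comp.
by apply: ltW; apply: xm.
Qed.

(** Large enough for [n exp (k (80 - T ^ 2 / 2)) <= 1/4] at every [k >= 1]. *)
Let T : R := 16 + 4 * n%:R.

Lemma microstate_density m (g : R) : 0 < g -> exists d : R, [/\ 0 < d, d <= 1 &
  exists k1 : nat, forall k r (x : 'I_n -> 'M[C]_k), (k1 <= k)%N -> (0 < k)%N ->
  microstates tau a r (2 * m) d x ->
  exists (q : ('I_#|{: Lk k}| -> R) -> R) (e : R),
    [/\ gauss_mean q e, 2^-1 <= e, forall v, q v <= 1 &
        forall v, 0 < q v -> microstates tau z (Num.max r (2 * T)) m g
           (join_tuple x (wigner (fun l => v (enum_rank l))))]].
Proof.
move=> g0; have [|K K0 KP] := @mean_word_dev_sum (words _ m) m.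
  by move=> w; rewrite mem_words.
(* Once [k >= 1 / d'], both [d] and [k ^ -2] are at most [d'], and [2 K d' <= g ^ 2 / 4] bounds the
   mean of the trace errors. *)
pose d' := g ^+ 2 / (8 * (K + 1)); have K1 : 0 < K + 1 by rewrite ltr_wpDl.
have d'0 : 0 < d' by rewrite divr_gt0 ?exprn_gt0// mulr_gt0.
exists (Num.min 1 d'); split; [by rewrite lt_min ltr01|by rewrite ge_min lexx|].
set d := Num.min 1 d'.
have d01 : 0 <= d <= 1 by rewrite ge_min lexx le_min ler01 ltW.
have dd' : d <= d' by rewrite ge_min lexx orbT.
exists (Num.bound d'^-1) => k r x k1 k0 xP.
have [xs xr xm] := xP.
have k2 : k%:R ^- 2 <= d'.
  have kd : d'^-1 <= k%:R.
    apply: (@le_trans _ _ (Num.bound d'^-1)%:R); last by rewrite ler_nat.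
    by apply/ltW/archi_boundP; rewrite invr_ge0 ltW.
  have k1' : 1 <= k%:R :> R by rewrite ler1n.
  rewrite -[leRHS]invrK lef_pV2 ?posrE ?exprn_gt0 ?invr_gt0 ?ltr0n//.
  by apply: le_trans kd _; rewrite expr2 ler_peMr.
have [ga] := @GaussPoly.exists_gauss_algebra C #|{: Lk k}|.
have [e' e'P e'le] := @gauss_mean_net_penalty R 'I_n k k0 T.
have xc : trace_close (moment z) x (2 * m) d%:C%C.
  by apply: microstates_trace_close xP => //; case/andP: d01.
have sumK := KP k ga x d k0 d01 xc.
pose dev v w := complex.Re (ga_eval ga (fun l => (v l)%:C%C) (word_dev (moment z) ga x w)).
(* Where [q] is positive, every trace error is below [g] and the penalty below 1, as in Chebyshev's
   inequality; each subtracted term has mean at most 1/4. *)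
pose q v := 1 + ((- g ^- 2) * (\sum_(w <- words _ m) dev v w) +
  (-1) * net_penalty T (fun l => v (enum_rank l))).
have devE v w : dev v w = complex.Re (`|ntrace (\big[mulmx/1%:M]_(j <- w)
    join_tuple x (wigner (fun l => v (enum_rank l))) j) - moment z w| ^+ 2).
  rewrite /dev -(ga_eval_word_dev _ ga)//; congr (complex.Re (ga_eval ga _ _)).
  by apply/funext => l; rewrite enum_valK.
have normE (c : C) : `|c| = (Normc.normc c)%:C%C by case: c.
have dev0 v w : 0 <= dev v w.
  by rewrite devE normE -rmorphXn /= sqr_ge0.
exists q, (1 + ((- g ^- 2) * (\sum_(w <- words _ m)
    complex.Re (ga_mean (word_dev (moment z) ga x w))) + (-1) * e')); split.
- apply: gauss_meanD; first exact: gauss_mean_cst.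
  apply: gauss_meanD; last exact: gauss_meanZ.
  apply: gauss_meanZ; apply: gauss_mean_sum => w; exact: gauss_mean_poly.
- have e'4 : e' <= 4^-1.
    apply: le_trans e'le _.
    pose Y := k%:R * (T ^+ 2 / 2 - 80); have k1' : 1 <= k%:R :> R by rewrite ler1n.
    have -> : k%:R * (80 - T ^+ 2 / 2) = - Y by rewrite /Y; ring.
    rewrite expRN ler_pdivrMr ?expR_gt0// card_ord.
    have n0 : 0 <= n%:R :> R by [].
    have YT : T ^+ 2 / 2 - 80 <= Y by rewrite ler_peMl// /T; nra.
    have := expR_ge1Dx Y; rewrite /T in YT; nra.
  have s4 : g ^- 2 * \sum_(w <- words _ m)
      complex.Re (ga_mean (word_dev (moment z) ga x w)) <= 4^-1.
    have g20 : 0 < g ^+ 2 by rewrite exprn_gt0.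
    rewrite mulrC ler_pdivrMr//; apply: le_trans sumK _.
    apply: (@le_trans _ _ (K * (d' + d'))); first by rewrite ler_wpM2l// lerD.
    have -> : K * (d' + d') = 4^-1 * g ^+ 2 * (K / (K + 1)).
      by rewrite /d'; field; rewrite gt_eqF.
    by rewrite ler_piMr ?ler_pdivrMr ?mul1r ?lerDl// mulr_ge0// ltW.
  by rewrite mulN1r mulNr; lra.
- move=> v; rewrite /q mulN1r mulNr -opprD gerBl addr_ge0 ?net_penalty_ge0//.
  by rewrite mulr_ge0 ?invr_ge0 ?exprn_ge0 ?sumr_ge0// ltW.
move=> v; rewrite /q mulN1r mulNr -opprD subr_gt0 => qv.
have pen1 : net_penalty T (fun l => v (enum_rank l)) <= 1.
  apply/ltW/(le_lt_trans _ qv); rewrite lerDr mulr_ge0 ?sumr_ge0//.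
  by rewrite invr_ge0 exprn_ge0// ltW.
split.
- case=> i /=; first exact: xs.
  move=> b c; have := @selfadjoint_lin R k 0 (hmx (fun l => v (enum_rank l)) i) (Num.sqrt k%:R)^-1.
  rewrite add0r; apply=> [p p'|]; last exact: hmx_sa.
  by rewrite !mxE rmorph0.
- case=> i /=; rewrite le_max; apply/orP; [by left; exact: xr|right].
  by apply: net_penalty_op_norm pen1 => //; rewrite ltr_wpDr// mulr_ge0.
move=> w /andP[w0 wm].
have : dev v w < g ^+ 2.
  have wws : w \in words _ m by rewrite mem_words.
  suff : g ^- 2 * dev v w < 1 by rewrite ltr_pdivrMl ?exprn_gt0// mulr1.
  apply: le_lt_trans qv; apply: ler_wpDr; first exact: net_penalty_ge0.
  rewrite ler_wpM2l ?invr_ge0 ?exprn_ge0 ?(ltW g0)//.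
  by rewrite (perm_big _ (perm_to_rem wws)) big_cons lerDl sumr_ge0.
rewrite devE normE -rmorphXn /= ltr_sqr ?nnegrE ?(ltW g0)//; last first.
  by case: (_ - _) => *; exact: sqrtr_ge0.
by rewrite ltcR.
Qed.

Variables (e : R) (e0 : 0 < e).
Let ae i := a i + e%:C%C *: s i.
Let D : R := Num.sqrt (n%:R * 2).
(** The summand [- ln 2] pays for the mean 1/2. *)
Let c2 : R := n%:R * (ln (2 * pi) / 2) - ln 2.

Let s2 i : moment s [:: i; i] = 1.
Proof.
by apply: semicircular_moment2; case: free_as.
Qed.

Lemma microstates_translate r m k g (x : 'I_n -> 'M[C]_k) (b : 'I_n -> 'M[C]_k) :
  (0 < k)%N -> (1 < m)%N -> g <= 1 -> microstates tau z r m g (join_tuple x b) ->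
  rel_microstates tau ae s (r * (1 + e)) m ((1 + e) ^+ m * g)
    (fun i => x i + e%:C%C *: b i) /\
  rho x (fun i => x i + e%:C%C *: b i) <= e * D.
Proof.
move=> k0 m1 g1 xP; split.
  pose c (l : 'I_n + 'I_n) : R := if l is inl _ then e else 0.
  pose f (l : 'I_n + 'I_n) : 'I_n + 'I_n := if l is inl i then inr i else l.
  have ce l : `|c l| <= e by case: l => i /=; [rewrite gtr0_norm|rewrite normr0 ltW].
  have := microstates_lin zM f ce xP.
  have -> : (fun l => z l + (c l)%:C%C *: z (f l)) = join_tuple ae s.
    by apply/funext => -[i|i] //=; rewrite scale0r addr0.
  by move=> yP; exists (fun l => join_tuple x b l + (c l)%:C%C *: join_tuple x b (f l)).
rewrite -[e in leRHS]gtr0_norm// /D -[n in n%:R]card_ord; apply: rho_shift_le => // i.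
exact: (Re_ntrace_sqr_le (s2 i) m1 g1 xP).
Qed.

Lemma log_vol_ge (r : R) m (g : R) : 0 < g -> exists m' (d : R) k1, 0 < d /\
  forall k, (k1 <= k)%N -> (0 < k)%N ->
  ((k%:R ^- 2)%:E * lne (packing_number (@rho R _ k)
     (@microstates _ _ tau _ a r m' k d) ((1 + 2 * D) * e)%R) + (n%:R * ln e + c2)%:E <=
   (k%:R ^- 2)%:E * lne (vol (@rel_microstates _ _ tau _ _ ae s
      (Num.max r (2 * T) * (1 + e))%R m k g)) + (n%:R / 2 * ln k%:R)%:E)%E.
Proof.
(* Degree 2 and tolerance 1 control the second moments of the [s i]; the quotient absorbs the loss
   in the change of variables. *)
move=> g0; pose m1 := maxn m 2; pose g1 := Num.min 1 (g / (1 + e) ^+ m1).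
have e1 : 0 < (1 + e) ^+ m1 by rewrite exprn_gt0// addr_gt0.
have g10 : 0 < g1 by rewrite lt_min ltr01 divr_gt0.
have [d [d0 d1 [k1 dP]]] := microstate_density m1 g10.
exists (2 * m1)%N, d, k1; split=> // k kk1 k0.
set V := vol _; set Y := microstates _ _ _ _ _.
have k2' : (0 <= (k%:R ^- 2)%:E :> \bar R)%E by rewrite lee_fin invr_ge0 exprn_ge0.
have sk0 : 0 < Num.sqrt k%:R :> R by rewrite sqrtr_gt0 ltr0n.
pose X : R := n%:R * ln e + c2 - n%:R / 2 * ln k%:R.
suff H : (packing_number (@rho R _ k) Y ((1 + 2 * D) * e)%R * (expR (k%:R ^+ 2 * X))%:E <= V)%E.
  have := le_lne H; rewrite lne_mul_expR => /(lee_wpmul2l k2').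
  rewrite muleDr ?fin_num_adde_defl// -EFinM mulrA mulVf ?mul1r; last first.
    by rewrite expf_neq0// pnatr_eq0 -lt0n.
  move=> H'.
  have := leeD2r (n%:R / 2 * ln k%:R)%:E H'.
  by rewrite -addeA -EFinD /X subrK.
rewrite -lee_pdivlMr ?expR_gt0//.
apply: ge_ereal_sup => _ [M [y [yY yt]] <-]; rewrite lee_pdivlMr ?expR_gt0//.
have ys j i : selfadjoint_mx (y j i) by case: (yY j).
have /choice[q qP] := fun j => dP k r (y j) kk1 k0 (yY j).
have /choice[e' eP] := qP.
pose se := e / Num.sqrt k%:R.
have se0 : 0 < se by rewrite divr_gt0.
pose H (v : #|{: Lk k}|.-tuple R) := hmx (fun l : Lk k => tnth v (enum_rank l)).
have main j v : 0 < q j (fun i => (tnth v i - hs_coord (y j) (enum_val i)) / se) ->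
    rel_microstates tau ae s (Num.max r (2 * T) * (1 + e)) m g (H v) /\
    rho (y j) (H v) <= e * D.
  have [_ _ _ qj] := eP j => qv.
  have m11 : (1 < m1)%N by rewrite leq_max orbT.
  have g11 : g1 <= 1 by rewrite ge_min lexx.
  have [] := microstates_translate k0 m11 g11 (qj _ qv).
  (* [se] is chosen so that standardizing [v] around [y j] makes [H v] the translate of [y j] by [e]
     times the normalized Gaussian matrix. *)
  have -> : (fun i => y j i + e%:C%C *: wigner (fun l => (tnth v (enum_rank l) -
      hs_coord (y j) (enum_val (enum_rank l))) / se) i) = H v.
    apply/funext => i; rewrite /wigner scalerA -rmorphM -hmxZ.
    rewrite -[X in X + _](hmx_hs_coord i (ys j)) -hmxD; congr (hmx _ i).
    apply/funext => l; rewrite enum_rankK /se; field.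
    by rewrite !gt_eqF.
  move=> [x xP xE] xr; split=> //; exists x => //; apply: microstatesW xP => //.
    by rewrite leq_max leqnn.
  by rewrite /g1 mulrC -ler_pdivlMr// ge_min lexx orbT.
have := @lebesgue_tuple_gauss_ge R #|{: Lk k}| [set [tuple hs_coord x (enum_val l) | l < _] | x in
   @rel_microstates _ _ tau _ _ ae s (Num.max r (2 * T) * (1 + e)) m k g] M
   (fun j i => hs_coord (y j) (enum_val i)) se q e' se0.
rewrite -/V => /(_ _ _ _ _)/(le_trans _); apply.
- have half : expR (- ln 2) = 2^-1 :> R by rewrite expRN lnK// posrE.
  rewrite -EFinM lee_fin normal_peak_powE//.
  apply: (@le_trans _ _ (\sum_(j < M) expR (- ln 2) * expR (k%:R ^+ 2 *
    (n%:R * (ln e + ln (2 * pi) / 2) - n%:R / 2 * ln k%:R)))); last first.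
    by rewrite mulr_suml; apply: ler_sum => j _; rewrite ler_wpM2r ?expR_ge0// half; have [] := eP j.
  (* The factor 1/2 is weakened to [exp (- k ^ 2 ln 2)], so that it fits into [c2]. *)
  rewrite sumr_const card_ord -[leRHS]mulr_natl ler_wpM2l//.
  rewrite -expRD ler_expR /X /c2.
  have k21 : 1 <= k%:R ^+ 2 :> R by rewrite exprn_ege1// ler1n.
  have l2 : 0 <= ln 2 :> R by rewrite ln_ge0// ler1n.
  have : ln 2 <= k%:R ^+ 2 * ln 2 :> R by rewrite ler_peMl.
  lra.
- by move=> j; have [] := eP j.
- by move=> j; have [] := eP j.
- move=> j v /main[Hv _]; exists (H v) => //.
  by apply: eq_from_tnth => l; rewrite tnth_mktuple hs_coord_hmx enum_valK.
(* A common point puts [y j] and [y j'] at distance at most [2 e D]; then [y j'] lies in both balls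
   of radius [(1 + 2 D) e], which are disjoint unless [j = j']. *)
- move=> j j' v /main[_ jr] /main[_ j'r].
  have De : e * D + e * D < (1 + 2 * D) * e.
    have -> : (1 + 2 * D) * e = e * D + e * D + e by ring.
    by rewrite ltrDl.
  have D0 : 0 <= D by exact: sqrtr_ge0.
  apply: (yt j j') => //; exists (y j'); split; split => //.
    have Hs i : selfadjoint_mx (H v i) by exact: hmx_sa.
    apply: le_lt_trans De; apply: le_trans (rho_triangle (ys j) Hs (ys j')) _.
    by rewrite (rho_sym Hs (ys j')); exact: lerD jr j'r.
  by rewrite rho_xx// mulr_gt0// ltr_wpDr// mulr_ge0.
Qed.

End Density.

(** * Packing, covering and upper limits *)

Section LimitSuperior.
Variable R : realType.
Local Open Scope ereal_scope.

Lemma limf_esup_near_le (T : choiceType) (X : filteredType T) (F : set_system X) {FF : Filter F}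
    (f : X -> \bar R) y : (\forall x \near F, f x <= y) -> limf_esup f F <= y.
Proof.
move=> fy; apply: ge_ereal_inf; exists (ereal_sup (f @` [set x | f x <= y])).
  by exists [set x | f x <= y].
by apply: ge_ereal_sup => _ [x xy <-].
Qed.

Lemma limf_esup_lt_near (T : choiceType) (X : filteredType T) (F : set_system X) {FF : Filter F}
    (f : X -> \bar R) y : limf_esup f F < y -> \forall x \near F, f x <= y.
Proof.
move=> /ereal_inf_lt[_ [V FV <-] Vy]; apply: filterS FV => x Vx.
apply: le_trans (ltW Vy); apply: ereal_sup_ubound; by exists x.
Qed.

Lemma limf_esup_leD (T : choiceType) (X : filteredType T) (F : set_system X) {FF : Filter F}
    (f h : X -> \bar R) (c : R) : (\forall x \near F, f x + c%:E <= h x) ->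
  limf_esup f F + c%:E <= limf_esup h F.
Proof.
move=> fh; apply: le_ereal_inf_tmp => _ [V FV <-]; rewrite -leeBrDr//.
apply: limf_esup_near_le; apply: filterS2 FV fh => x Vx fhx; rewrite leeBrDr//.
by apply: le_trans fhx _; apply: ereal_sup_ubound; exists x.
Qed.

Lemma limf_esupD (T : choiceType) (X : filteredType T) (F : set_system X) {FF : Filter F}
    (f : X -> \bar R) (c : R) :
  limf_esup (fun x => f x + c%:E) F = limf_esup f F + c%:E.
Proof.
apply/eqP; rewrite eq_le; apply/andP; split; last first.
  by apply: limf_esup_leD; apply: nearW.
rewrite -leeBlDr//; apply: (@limf_esup_leD _ _ _ _ _ _ (- c)).
by apply: nearW => x; rewrite -addeA -EFinD subrr adde0.
Qed.

Lemma near_right0P (P : R -> Prop) :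
  (\forall e \near (0%R : R)^'+, P e) <-> exists2 d : R, (0 < d)%R & forall e, (0 < e < d)%R -> P e.
Proof.
split=> [|[d d0 dP]]; last first.
  near=> e; apply: dP; apply/andP; split; near: e; first exact: nbhs_right_gt.
  exact: nbhs_right_lt.
rewrite /at_right /within /= => /nbhs_ballP[d /= d0 dP]; exists d => // e /andP[e0 ed].
by apply: dP => //=; rewrite /ball /= sub0r normrN gtr0_norm.
Unshelve. all: by end_near. Qed.

(** Rescaling [e] by [C] shifts [ln e] by a constant, and a bounded shift of the ratio's terms is
    negligible against [|ln e|]. *)
Lemma limf_esup_log_le (f h : R -> \bar R) (C b : R) : (0 < C)%R ->
  (forall e, (0 < e < 1)%R -> f (C * e)%R <= h e + b%:E) ->
  limf_esup (fun e : R => f e / `|ln e|%R%:E) (0%R : R)^'+ <=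
  limf_esup (fun e : R => h e / `|ln e|%R%:E) (0%R : R)^'+.
Proof.
move=> C0 fh; set L := limf_esup (fun e => h e / _) _.
have lnE (e : R) : (0 < e < 1)%R -> (0 < - ln e)%R /\ `|ln e|%R = (- ln e)%R.
  by move=> e01; have ln0 := ln_lt0 e01; rewrite oppr_gt0 ltr0_norm.
have main (M M' : R) : (M < M')%R -> L < M%:E ->
    limf_esup (fun e : R => f e / `|ln e|%R%:E) (0%R : R)^'+ <= M'%:E.
  move=> MM' /limf_esup_lt_near/near_right0P[d d0 dP].
  apply: limf_esup_near_le; apply/near_right0P.
  (* The value of [- ln e'] from which [M (- ln e' + ln C) + b <= M' (- ln e')]. *)
  pose A : R := ((M * ln C + b) / (M' - M))%R.
  exists (Num.min (Num.min 1 C) (Num.min (C * d) (expR (- A))))%R.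
    by rewrite !lt_min ltr01 C0 mulr_gt0// expR_gt0.
  move=> e' /andP[e'0]; rewrite !lt_min => /andP[/andP[e'1 e'C] /andP[e'd e'A]].
  pose e := (e' / C)%R; have e0 : (0 < e)%R by rewrite divr_gt0.
  have e1 : (e < 1)%R by rewrite ltr_pdivrMr// mul1r.
  have ed : (e < d)%R by rewrite ltr_pdivrMr// mulrC.
  have [l0 lE] := lnE e' (introT andP (conj e'0 e'1)).
  have [le0 leE] := lnE e (introT andP (conj e0 e1)).
  have lee : (- ln e = - ln e' + ln C)%R by rewrite ln_div ?posrE// opprB addrC.
  have := dP e (introT andP (conj e0 ed)).
  rewrite leE lE !inver !gt_eqF// !lee_pdivrMr// => hM.
  have -> : e' = (C * e)%R by rewrite mulrC divfK// gt_eqF.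
  apply: le_trans (fh e _) _; first by rewrite e0.
  apply: le_trans (leeD2r _ hM) _; rewrite -!EFinM -EFinD lee_fin.
  have -> : (C * e = e')%R by rewrite mulrC divfK// gt_eqF.
  rewrite lee; have : (A < - ln e')%R.
    by rewrite ltrNr -ltr_expR lnK// posrE.
  rewrite /A ltr_pdivrMr ?subr_gt0//; nra.
case LE : L main => [l| |] main; last 2 first.
- by rewrite leey.
- have {}main A : limf_esup (fun e : R => f e / `|ln e|%R%:E) (0%R : R)^'+ <= A%:E.
    by apply: (main (A - 1)%R); rewrite ?ltNyr// gtrBl.
  case: (limf_esup _ _) main => [v /(_ (v - 1)%R)|/(_ 0%R)|] //.
  by rewrite lee_fin lerBrDr gerDl ler10.
- apply/lee_addgt0Pr => _/posnumP[eps]; rewrite -EFinD.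
  by apply: (main (l + eps%:num / 2)%R);
    rewrite ?lte_fin ?ltrD2l ?ltrDl// ltr_pdivrMr// ltr_pMr// ltr1n.
Qed.

End LimitSuperior.

Section PackingCovering.
Variables (R : realType) (T : Type) (d : T -> T -> R) (X : set T).
Hypothesis dC : forall x y, X x -> X y -> d x y = d y x.
Hypothesis dD : forall x y z, X x -> X y -> X z -> d x z <= d x y + d y z.

(** Two packing centers in one covering ball would both have its center, a point of [X], in their
    balls; hence no loss in the radius. *)
Lemma packing_le_covering e : (packing_number d X e <= covering_number d X e)%E.
Proof.
apply: ge_ereal_sup => _ [N [x [xX xt]] <-].
apply: le_ereal_inf_tmp => _ [M [y [yX yc]] <-]; rewrite lee_fin ler_nat.
have /choice[f fP] : forall i, exists j, X (x i) /\ d (y j) (x i) < e.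
  by move=> i; have [j _ [_ jx]] := yc _ (xX i); exists j.
have fI : injective f.
  move=> i i' ff; apply: (xt i i') => //; exists (y (f i)); split; split=> //.
    by rewrite dC//; case: (fP i).
  by rewrite ff dC//; case: (fP i').
by have := leq_card f fI; rewrite !card_ord.
Qed.

(** A point at distance at least [2 e] from all centers of a packing could be added to it; if
    packings can always be extended, the packing number is infinite. *)
Lemma covering_le_packing e : 0 < e ->
  (covering_number d X (2 * e)%R <= packing_number d X e)%E.
Proof.
move=> e0; pose pack N := exists x : 'I_N -> T,
  (forall i, X (x i)) /\ trivIset setT (fun i => rel_ball d X e (x i)).
have [[N [[x [xX xt]] Nmax]]|/forallNP allN] := pselect (exists N, pack N /\ ~ pack N.+1).
  apply: (@le_trans _ _ N%:R%:E); last by apply: ereal_sup_ubound; exists N => //; exists x.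
  apply: ereal_inf_lbound; exists N => //; exists x; split=> // y yX.
  have [//|ny] := pselect ((\bigcup_i rel_ball d X (2 * e) (x i)) y).
  exfalso; apply: Nmax.
  pose x' (i : 'I_N.+1) := if unlift ord_max i is Some j then x j else y.
  have far i w : rel_ball d X e (x i) w -> rel_ball d X e y w -> False.
    move=> [wX iw] [_ yw]; apply: ny; exists i => //; split=> //.
    apply: le_lt_trans (dD (xX i) wX yX) _; rewrite (dC wX yX).
    by rewrite mulr_natl mulr2n ltrD.
  exists x'; split=> [i|i i' _ _]; first by rewrite /x'; case: unliftP.
  rewrite /x'; case: unliftP => [j ->|->]; case: unliftP => [j' ->|->] [w [iw i'w]] //.
  - by congr lift; apply: (xt j j') => //; exists w.
  - by case: (far j w).
  - by case: (far j' w).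
have packN N : pack N.
  elim: N => [|N IH].
    by exists (fun i : 'I_0 => False_rect _ (elimF idP erefl (ltn_ord i))); split=> [[]|[]].
  by have /not_andP[//|/contrapT] := allN N.
have -> : packing_number d X e = +oo%E; last by rewrite leey.
apply/eqyP => A A0; apply: (@le_trans _ _ (Num.bound A)%:R%:E).
  by rewrite lee_fin ltW// archi_boundP// ltW.
by apply: ereal_sup_ubound; exists (Num.bound A) => //; exact: packN.
Qed.

End PackingCovering.

Section Rates.
Variable R : realType.
Local Open Scope ereal_scope.

Lemma selfadjoint_microstates (H : hilbert R) (phi : (H -> H) -> R[i]%C) (I : finType)
    (c : I -> H -> H) r m k g (x : I -> 'M[R[i]%C]_k) i :
  microstates phi c r m g x -> selfadjoint_mx (x i).
Proof. by case. Qed.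

Lemma eq_microstates (H H' : hilbert R) (phi : (H -> H) -> R[i]%C)
    (phi' : (H' -> H') -> R[i]%C) (I : finType) (c : I -> H -> H) (c' : I -> H' -> H') r m k g :
  (forall w, phi (op_prod (map c w)) = phi' (op_prod (map c' w))) ->
  @microstates _ _ phi _ c r m k g = @microstates _ _ phi' _ c' r m k g.
Proof.
move=> cc; apply/seteqP; split=> x [xs xr xm]; split=> // w wm.
  by rewrite -cc; exact: xm.
by rewrite cc; exact: xm.
Qed.

Lemma eq_rate num (H H' : hilbert R) (phi : (H -> H) -> R[i]%C)
    (phi' : (H' -> H') -> R[i]%C) n (c : 'I_n -> H -> H) (c' : 'I_n -> H' -> H') e :
  (forall w, phi (op_prod (map c w)) = phi' (op_prod (map c' w))) ->
  rate phi num c e = rate phi' num c' e.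
Proof.
move=> cc; rewrite /rate; congr (ereal_sup (_ @` _)); apply/funext => r.
rewrite /rate_R; congr (ereal_inf (_ @` _)); apply/funext => mg.
rewrite /rate_Rmg; congr limn_esup; apply/funext => k.
by rewrite (eq_microstates _ _ _ _ cc).
Qed.

Lemma le_rate (H : hilbert R) (phi : (H -> H) -> R[i]%C) n (a : 'I_n -> H -> H)
    (num1 num2 : forall T : Type, (T -> T -> R) -> set T -> R -> \bar R) e1 e2 :
  (forall r m k g, num1 _ (@rho R _ k) (@microstates _ _ phi _ a r m k g) e1 <=
     num2 _ (@rho R _ k) (@microstates _ _ phi _ a r m k g) e2) ->
  rate phi num1 a e1 <= rate phi num2 a e2.
Proof.
move=> num12; apply: ge_ereal_sup => _ [r r0 <-].
apply: le_trans (ereal_sup_ubound _); last by exists r.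
apply: le_ereal_inf_tmp => _ [mg mg0 <-].
apply: (@le_trans _ _ (rate_Rmg phi num1 a e1 r mg.1 mg.2)).
  by apply: ereal_inf_lbound; exists mg.
rewrite -[leLHS]adde0; apply: limf_esup_leD; apply: nearW => k; rewrite adde0.
by rewrite lee_wpmul2l ?lee_fin ?invr_ge0 ?exprn_ge0// le_lne.
Qed.

Lemma packing_rate_le_covering (H : hilbert R) (phi : (H -> H) -> R[i]%C) n
    (a : 'I_n -> H -> H) e : packing_rate phi a e <= covering_rate phi a e.
Proof.
apply: le_rate => r m k g; apply: packing_le_covering => x y xP yP.
by apply: rho_sym => i; [exact: selfadjoint_microstates xP|exact: selfadjoint_microstates yP].
Qed.

Lemma covering_rate_le_packing (H : hilbert R) (phi : (H -> H) -> R[i]%C) n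
    (a : 'I_n -> H -> H) e : (0 < e)%R ->
  covering_rate phi a (2 * e)%R <= packing_rate phi a e.
Proof.
move=> e0; apply: le_rate => r m k g; apply: (covering_le_packing _ _ e0).
  by move=> x y xP yP; apply: rho_sym => i;
     [exact: selfadjoint_microstates xP|exact: selfadjoint_microstates yP].
move=> x y w xP yP wP; apply: rho_triangle => i;
  by [exact: selfadjoint_microstates xP|exact: selfadjoint_microstates yP
     |exact: selfadjoint_microstates wP].
Qed.

Section FreeEntropyBounds.
Variables (N : tracial_vna R) (n : nat) (a s : 'I_n -> N -> N).
Local Notation tau := (@vna_state R N).
Hypothesis aM : forall i, vna_set (a i).
Hypothesis free_as : free_semicircular_family a s.
Variables (e : R) (e0 : (0 < e)%R).
Let ae i := (a i + e%:C%C *: s i)%R.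

Let s2 i : moment s [:: i; i] = 1%R.
Proof. by apply: semicircular_moment2; case: free_as. Qed.

Let sM i : vna_set (s i).
Proof. by case: free_as => sM _ _ _; case: (sM i). Qed.

Lemma chi_le_covering_rate : chi tau ae s <= covering_rate tau a e +
  (n%:R * ln e + ((1 + Num.sqrt (n%:R * 2)) ^+ 2 / 2 + n%:R * (ln (2 * pi) / 2)))%R%:E.
Proof.
set X : R := (_ + _)%R; apply: ge_ereal_sup => _ [r r0 <-].
have r1 : (0 < r * (1 + e))%R by rewrite mulr_gt0 ?addr_gt0.
apply: (@le_trans _ _ (rate_R tau (@covering_number R) a e (r * (1 + e)) + X%:E)); last first.
  by apply: leeD2r; apply: ereal_sup_ubound; exists (r * (1 + e))%R.
rewrite -leeBlDr//; apply: le_ereal_inf_tmp => _ [[m g] g0 <-]; rewrite leeBlDr//.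
(* For each pair [(m, g)] of the covering side, a finer pair on the side of [chi] survives the
   change of variables. *)
pose m1 := maxn m 2; pose g1 : R := Num.min 1%R (g / (1 + e) ^+ m1)%R.
have e1 : (0 < (1 + e) ^+ m1)%R by rewrite exprn_gt0// addr_gt0.
have g10 : (0 < g1)%R by rewrite lt_min ltr01 divr_gt0.
apply: (@le_trans _ _ (chi_Rmg tau ae s r m1 g1)).
  by apply: ereal_inf_lbound; exists (m1, g1).
rewrite -leeBlDr//; apply: limf_esup_leD; exists 1%N => // k /= k1; rewrite EFinN leeBlDr//.
apply: log_vol_le => //.
- by rewrite leq_max orbT.
- by rewrite ge_min lexx.
- by rewrite leq_max leqnn.
by rewrite mulrC -ler_pdivlMr// ge_min lexx orbT.
Qed.

Lemma packing_rate_le_chi :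
  packing_rate tau a ((1 + 2 * Num.sqrt (n%:R * 2)) * e)%R +
    (n%:R * ln e + (n%:R * (ln (2 * pi) / 2) - ln 2))%R%:E <= chi tau ae s.
Proof.
set X : R := (n%:R * ln e + _)%R; rewrite -leeBrDr//; apply: ge_ereal_sup => _ [r r0 <-].
(* The cutoff must also admit the Gaussian partners, whose norms are bounded by twice the constant
   [T]. *)
rewrite leeBrDr//; pose r1 := (Num.max r (2 * (16 + 4 * n%:R)) * (1 + e))%R.
apply: (@le_trans _ _ (chi_R tau ae s r1)); last first.
  apply: ereal_sup_ubound; exists r1 => //=.
  by rewrite mulr_gt0 ?addr_gt0// lt_max r0.
apply: le_ereal_inf_tmp => _ [[m g] g0 <-].
have [m' [d [k1 [d0 H]]]] := log_vol_ge aM free_as e0 r m g0.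
apply: (@le_trans _ _ (rate_Rmg tau (@packing_number R) a
  ((1 + 2 * Num.sqrt (n%:R * 2)) * e) r m' d + X%:E)).
  by apply: leeD2r; apply: ereal_inf_lbound; exists (m', d).
apply: limf_esup_leD; exists (maxn k1 1) => // k /=; rewrite geq_max => /andP[kk1 k0].
exact: H.
Qed.

End FreeEntropyBounds.

Lemma limf_esup_packing_covering (H : hilbert R) (phi : (H -> H) -> R[i]%C) n
    (a : 'I_n -> H -> H) :
  limf_esup (fun e : R => packing_rate phi a e / `|ln e|%R%:E) (0%R : R)^'+ =
  limf_esup (fun e : R => covering_rate phi a e / `|ln e|%R%:E) (0%R : R)^'+.
Proof.
apply/eqP; rewrite eq_le; apply/andP; split.
  apply: (@limf_esup_log_le _ _ _ 1 0) => // e _; rewrite mul1r adde0.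
  exact: packing_rate_le_covering.
apply: (@limf_esup_log_le _ _ _ 2 0) => // e /andP[e0 _]; rewrite adde0.
exact: covering_rate_le_packing.
Qed.

Lemma delta0E (N : tracial_vna R) n (a s : 'I_n -> N -> N) :
  (forall i, vna_set (a i)) -> free_semicircular_family a s ->
  delta0 (@vna_state R N) a s =
  limf_esup (fun e : R => packing_rate (@vna_state R N) a e / `|ln e|%R%:E) (0%R : R)^'+.
Proof.
move=> aM fas; set tau := @vna_state R N.
pose ch e := chi tau (fun i => (a i + e%:C%C *: s i)%R) s.
(* For [e < 1] the summand [n] is [- n ln e] divided by [|ln e|], so [delta0] becomes an upper limit
   of the form compared by [limf_esup_log_le]. *)
pose h e := ch e + (- (n%:R * ln e))%R%:E.
have -> : delta0 tau a s = limf_esup (fun e : R => h e / `|ln e|%R%:E) (0%R : R)^'+.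
  rewrite /delta0 addeC -limf_esupD; apply/eqP; rewrite eq_le.
  have E : \forall e \near (0%R : R)^'+, ch e / `|ln e|%R%:E + n%:R%:E = h e / `|ln e|%R%:E.
    apply/near_right0P; exists 1%R => // e e01; have ln0 := ln_lt0 e01.
    have l0 : (0 < `|ln e|)%R by rewrite normr_gt0 lt_eqF.
    rewrite /h inver gt_eqF// muleDl ?fin_num_adde_defl//; congr (_ + _).
    by rewrite -EFinM ltr0_norm// -mulrN mulfK// oppr_eq0 lt_eqF.
  apply/andP; split; rewrite -[leLHS]adde0; apply: limf_esup_leD;
    by apply: filterS E => e eE; rewrite adde0 eE.
apply/eqP; rewrite eq_le; apply/andP; split.
  rewrite limf_esup_packing_covering; apply: (@limf_esup_log_le _ _ _ 1 _) => // e /andP[e0 _].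
  rewrite mul1r /h; apply: le_trans (leeD2r _ (chi_le_covering_rate aM fas e0)) _.
  by rewrite -addeA -EFinD addrAC subrr add0r.
apply: (@limf_esup_log_le _ _ _ (1 + 2 * Num.sqrt (n%:R * 2))
  (- (n%:R * (ln (2 * pi) / 2) - ln 2))) => [|e /andP[e0 _]].
  by rewrite ltr_wpDr// mulr_ge0// sqrtr_ge0.
have := packing_rate_le_chi aM fas e0; rewrite -leeBrDr//.
by rewrite /h -addeA -EFinN -EFinD opprD.
Qed.

End Rates.

Unset Implicit Arguments.
Local Open Scope ereal_scope.

Theorem corollary2p4 (R : realType) (M : tracial_vna R) (n : nat)
    (a : 'I_n -> M -> M) (aP : forall i, selfadjoint_in (@vna_set R M) (a i)) :
  (forall (N : tracial_vna R) (iota : (M -> M) -> (N -> N)) (s : 'I_n -> N -> N),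
     enlargement iota ->
     free_semicircular_family (fun i => iota (a i)) s ->
     delta0 (@vna_state R N) (fun i => iota (a i)) s
     = limf_esup (fun e : R =>
           packing_rate (@vna_state R M) a e / `|ln e|%R%:E) (0%R : R)^'+)
  /\
  limf_esup (fun e : R =>
      packing_rate (@vna_state R M) a e / `|ln e|%R%:E) (0%R : R)^'+
  = limf_esup (fun e : R =>
      covering_rate (@vna_state R M) a e / `|ln e|%R%:E) (0%R : R)^'+.
Proof.
split; last exact: limf_esup_packing_covering.
move=> N iota s en fas; have aM l : vna_set (a l) by case: (aP l).
rewrite (delta0E (fun i => enl_in en (aM i)) fas).
(* Microstates depend only on the joint moments, which [iota] preserves. *)
have E : packing_rate (@vna_state R N) (fun i => iota (a i)) = packing_rate (@vna_state R M) a.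
  apply/funext => e; apply: eq_rate => w.
  have -> : op_prod (map (fun i => iota (a i)) w) = iota (op_prod (map a w)).
    elim: w => [|i w IH] /=; first by rewrite (enl_unit en).
    by rewrite IH (enl_mul en)//; exact: (vna_opw aM).
  by rewrite (enl_state en)//; exact: (vna_opw aM).
by rewrite E.
Qed.
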